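(* The monomial $\mathbf{x}=\omega$ is the smallest infinite monomial of $\mathbb K$: every monomial $\mathfrak m\in\mathfrak G=\bigcup_n\mathfrak G_n$ with $\mathfrak m>1$ satisfies $\mathfrak m\geq\mathbf{x}$.
   Context: $\mathbf{No}$ is Conway's field of surreal numbers, identified with the Hahn field $\mathbb R((\mathfrak M))_{\mathbf{On}}$ over the class $\mathfrak M$ of monomials, with Gonshor's exponential $e^{(\cdot)}$ and inverse $\log$; $\omega$ is a monomial. $\mathbf{No}^\uparrow$ is the set of purely infinite surreals (all support monomials $>1$). For a subgroup $\mathfrak G\subseteq\mathfrak M$, $\mathbb R((\mathfrak G))$ is the set of surreals with support in $\mathfrak G$. Let $\mathbf{x}=\omega$, $\mathfrak G_0=\mathbf{x}^{\mathbb Z}$, $\mathbb K_0=\mathbb R((\mathfrak G_0))$, $\mathfrak G_{n+1}=\{e^{\gamma+\log(\mathbf{x})(\theta+k)}:\gamma,\theta\in\mathbb K_n^\uparrow,k\in\mathbb Z\}$, $\mathbb K_{n+1}=\mathbb R((\mathfrak G_{n+1}))$, with $\mathbb K_n^\uparrow=\mathbb K_n\cap\mathbf{No}^\uparrow$, and $\mathbb K=\bigcup_n\mathbb K_n$. *)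

(* Defs.v *)
From Stdlib Require Import ZArith Arith Wellfounded ClassicalEpsilon.

(** * Surreal numbers

    A surreal number is a numeric game, and equality of surreal numbers is
    Conway's [x == y := x <= y /\ y <= x]; there is no quotient.  Every
    predicate on surreal numbers below is invariant under [==]. *)

(** The universe of sets; the proper class of games lives one level above. *)
Definition small := Type.

Inductive game : Type :=
  Game (L R : small) (l : L -> game) (r : R -> game).

Declare Scope game_scope.
Delimit Scope game_scope with G.
Bind Scope game_scope with game.
Local Open Scope game_scope.

(** [cmp x y] is the pair of propositions [(x <= y, y <= x)]: Conway's
    definition of [x <= y] calls [<=] with its arguments exchanged.  The usual
    recursive characterization is [leE] below. *)
Fixpoint cmp (x : game) : game -> Prop * Prop :=
  fix cmpx (y : game) : Prop * Prop :=
    match x, y with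
    | Game XL XR xl xr, Game YL YR yl yr =>
        ( (forall i, ~ snd (cmp (xl i) y)) /\ (forall j, ~ snd (cmpx (yr j))),
          (forall j, ~ fst (cmpx (yl j))) /\ (forall i, ~ fst (cmp (xr i) y)) )
    end.

Definition le (x y : game) : Prop := fst (cmp x y).
Definition lt (x y : game) : Prop := le x y /\ ~ le y x.
Definition eqg (x y : game) : Prop := le x y /\ le y x.

Notation "x <= y" := (le x y) : game_scope.
Notation "x < y" := (lt x y) : game_scope.
Notation "x == y" := (eqg x y) (at level 70, no associativity) : game_scope.

Lemma cmpE (x y : game) :
  cmp x y =
    match x, y with
    | Game XL XR xl xr, Game YL YR yl yr =>
        ( (forall i, ~ snd (cmp (xl i) y)) /\ (forall j, ~ snd (cmp x (yr j))),
          (forall j, ~ fst (cmp x (yl j))) /\ (forall i, ~ fst (cmp (xr i) y)) )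
    end.
Proof. now destruct x, y. Qed.

Lemma cmp_swap (x y : game) : snd (cmp x y) <-> fst (cmp y x).
Proof.
enough (H : (snd (cmp x y) <-> fst (cmp y x)) /\
            (fst (cmp x y) <-> snd (cmp y x))) by apply H.
revert y; induction x as [XL XR xl IHl xr IHr].
induction y as [YL YR yl JHl yr JHr].
rewrite (cmpE (Game XL XR xl xr)), (cmpE (Game YL YR yl yr)).
cbn [fst snd].
split; split; intros [H1 H2]; split; intros k Hk.
all: solve [ now apply (H1 k), (proj2 (JHl k)) | now apply (H2 k), (proj2 (IHr k _))
           | now apply (H1 k), (proj1 (IHl k _)) | now apply (H2 k), (proj1 (JHr k)) ].
Qed.

Lemma leE (XL XR YL YR : small) (xl : XL -> game) (xr : XR -> game)
    (yl : YL -> game) (yr : YR -> game) :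
  let x := Game XL XR xl xr in let y := Game YL YR yl yr in
  x <= y <-> (forall i, ~ y <= xl i) /\ (forall j, ~ yr j <= x).
Proof.
intros x y; unfold le; rewrite (cmpE x y); cbn [fst snd].
split; intros [H1 H2]; split; intros k Hk.
- now apply (H1 k), cmp_swap.
- now apply (H2 k), cmp_swap.
- now apply (H1 k), cmp_swap.
- now apply (H2 k), cmp_swap.
Qed.

Fixpoint numeric (x : game) : Prop :=
  match x with
  | Game XL XR xl xr =>
      (forall i j, ~ xr j <= xl i) /\
      (forall i, numeric (xl i)) /\ (forall j, numeric (xr j))
  end.

(** ** Field operations *)

Definition zero : game :=
  Game Empty_set Empty_set (Empty_set_rect _) (Empty_set_rect _).

Fixpoint natg (n : nat) : game :=
  match n with
  | O => zero
  | S m => Game unit Empty_set (fun _ => natg m) (Empty_set_rect _)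
  end.

Notation one := (natg 1).

Fixpoint opp (x : game) : game :=
  match x with
  | Game XL XR xl xr => Game XR XL (fun j => opp (xr j)) (fun i => opp (xl i))
  end.

Fixpoint add (x : game) : game -> game :=
  fix addx (y : game) : game :=
    match x, y with
    | Game XL XR xl xr, Game YL YR yl yr =>
        Game (XL + YL)%type (XR + YR)%type
          (fun k => match k with inl i => add (xl i) y | inr j => addx (yl j) end)
          (fun k => match k with inl i => add (xr i) y | inr j => addx (yr j) end)
    end.

Notation "- x" := (opp x) : game_scope.
Notation "x + y" := (add x y) : game_scope.
Notation "x - y" := (add x (opp y)) : game_scope.

Fixpoint mul (x : game) : game -> game :=
  fix mulx (y : game) : game :=
    match x, y with
    | Game XL XR xl xr, Game YL YR yl yr =>
        Game (XL * YL + XR * YR)%type (XL * YR + XR * YL)%type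
          (fun k => match k with
            | inl (i, j) => mul (xl i) y + mulx (yl j) - mul (xl i) (yl j)
            | inr (i, j) => mul (xr i) y + mulx (yr j) - mul (xr i) (yr j)
            end)
          (fun k => match k with
            | inl (i, j) => mul (xl i) y + mulx (yr j) - mul (xl i) (yr j)
            | inr (i, j) => mul (xr i) y + mulx (yl j) - mul (xr i) (yl j)
            end)
    end.

Notation "x * y" := (mul x y) : game_scope.

(** Unspecified at [x == zero]. *)
Definition inv (x : game) : game :=
  epsilon (inhabits zero) (fun z => numeric z /\ x * z == one).

Notation "x / y" := (mul x (inv y)) : game_scope.

Definition intg (k : Z) : game :=
  match k with
  | Z0 => zero
  | Zpos p => natg (Pos.to_nat p)
  | Zneg p => - natg (Pos.to_nat p)
  end.

Fixpoint pow (x : game) (n : nat) : game :=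
  match n with O => one | S m => x * pow x m end.

Definition powz (x : game) (k : Z) : game :=
  match k with
  | Z0 => one
  | Zpos p => pow x (Pos.to_nat p)
  | Zneg p => inv (pow x (Pos.to_nat p))
  end.

(** Conway's definition of the real numbers inside the surreal numbers:
    [-n < x < n] for some [n], and [x = {x - 1/n | x + 1/n}] with [n > 0]. *)
Definition is_real (x : game) : Prop :=
  numeric x /\
  (exists n : nat, - natg n < x /\ x < natg n) /\
  x == Game nat nat (fun n => x - inv (natg (S n)))
                    (fun n => x + inv (natg (S n))).

(** ** Simplicity *)

(** The day on which the game [x] is created is at most that of [y]. *)
Fixpoint created_no_later (x y : game) : Prop :=
  match x, y with
  | Game XL XR xl xr, Game YL YR yl yr =>
      (forall i, (exists j, created_no_later (xl i) (yl j)) \/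
                 (exists j, created_no_later (xl i) (yr j))) /\
      (forall i, (exists j, created_no_later (xr i) (yl j)) \/
                 (exists j, created_no_later (xr i) (yr j)))
  end.

(** The birthday of a surreal number is the first day on which a numeric game
    equal to it is created. *)
Definition birthday_le (x y : game) : Prop :=
  exists g, numeric g /\ g == x /\
    forall h, numeric h -> h == y -> created_no_later g h.

Definition simplest (C : game -> Prop) (z : game) : Prop :=
  numeric z /\ C z /\ forall y, numeric y -> C y -> birthday_le z y.

(** ** Monomials *)

Definition omega : game := Game nat Empty_set natg (Empty_set_rect _).

(** [omega ^ x = {0, k omega ^ x' | 2 ^ (-k) omega ^ x''}], where [x'], [x'']
    range over the left and right options of [x] and [k] over [nat]. *)
Fixpoint omega_pow (x : game) : game :=
  match x with
  | Game XL XR xl xr =>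
      Game (option (XL * nat)%type) (XR * nat)%type
        (fun p => match p with
          | None => zero
          | Some (i, k) => natg k * omega_pow (xl i)
          end)
        (fun p => let (j, k) := p in inv (natg (2 ^ k)) * omega_pow (xr j))
  end.

Definition monomial (m : game) : Prop :=
  numeric m /\ exists a, numeric a /\ m == omega_pow a.

Definition infinite (x : game) : Prop :=
  numeric x /\ forall n : nat, natg n < x.

(** ** Conway normal form *)

(** For [y > 0]: every integer multiple of [x] is smaller than [y] in absolute
    value. *)
Definition negligible (x y : game) : Prop :=
  forall n : nat, - y < natg n * x /\ natg n * x < y.

Section NormalForm.

Variables (I : small) (ltI : I -> I -> Prop) (a r : I -> game).

Let term (i : I) : game := r i * omega_pow (a i).

(** [z] is the sum of the terms with index in the initial segment [D] of [I],
    provided that [S i] is the sum of the terms with index before [i]: if [D]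
    has a last element [j] then [z] is [S j + term j], and otherwise [z] is the
    simplest number such that [z - (S j + term j)] is negligible with respect
    to [omega ^ a j] for all [j] in [D]. *)
Definition sum_of (S : I -> game) (D : I -> Prop) (z : game) : Prop :=
  (forall j, D j -> (forall k, D k -> ~ ltI j k) -> z == S j + term j) /\
  ((forall j, D j -> exists k, D k /\ ltI j k) ->
     simplest (fun z => forall j, D j ->
       negligible (z - (S j + term j)) (omega_pow (a j))) z).

(** [I] is a well-ordered set, that is, an ordinal, the exponents [a i] strictly
    decrease, the coefficients [r i] are nonzero reals, and
    [x = \sum_(i in I) r i * omega ^ a i]. *)
Definition normal_form (x : game) : Prop :=
  well_founded ltI /\
  (forall i j k, ltI i j -> ltI j k -> ltI i k) /\
  (forall i j, ltI i j \/ i = j \/ ltI j i) /\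
  (forall i, numeric (a i)) /\
  (forall i j, ltI i j -> a j < a i) /\
  (forall i, is_real (r i) /\ ~ r i == zero) /\
  exists S : I -> game,
    (forall i, numeric (S i) /\ sum_of S (fun j => ltI j i) (S i)) /\
    sum_of S (fun _ => True) x.

End NormalForm.

(** [R((G))].  By Conway's theorem every surreal number has exactly one normal
    form, so it does not matter that the form is quantified existentially. *)
Definition hahn (G : game -> Prop) (x : game) : Prop :=
  numeric x /\
  exists (I : small) (ltI : I -> I -> Prop) (a r : I -> game),
    normal_form I ltI a r x /\ forall i, G (omega_pow (a i)).

Definition purely_infinite : game -> Prop := hahn (fun m => one < m).

(** ** Gonshor's exponential *)

(** [[x]_n = \sum_(i <= n) x ^ i / i!]. *)
Fixpoint exp_trunc (x : game) (n : nat) : game :=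
  match n with
  | O => one
  | S m => exp_trunc x m + pow x n / natg (fact n)
  end.

(** With [x'], [x''] the left and right options of [x],
<<
      exp x = { 0, exp x' [x - x']_n, exp x'' [x - x'']_(2n+1)
              | exp x'' / [x'' - x]_n, exp x' / [x' - x]_(2n+1) }
>>
    where the options that contain a truncation of odd order [2n+1] occur only
    if that truncation is positive. *)
Fixpoint exp (x : game) : game :=
  match x with
  | Game XL XR xl xr =>
      Game
        (unit + XL * nat +
         {p : XR * nat | zero < exp_trunc (x - xr (fst p)) (2 * snd p + 1)})%type
        (XR * nat +
         {p : XL * nat | zero < exp_trunc (xl (fst p) - x) (2 * snd p + 1)})%type
        (fun k => match k with
          | inl (inl _) => zero
          | inl (inr (i, n)) => exp (xl i) * exp_trunc (x - xl i) n
          | inr (exist _ (j, n) _) =>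
              exp (xr j) * exp_trunc (x - xr j) (2 * n + 1)
          end)
        (fun k => match k with
          | inl (j, n) => exp (xr j) / exp_trunc (xr j - x) n
          | inr (exist _ (i, n) _) =>
              exp (xl i) / exp_trunc (xl i - x) (2 * n + 1)
          end)
  end.

(** The inverse of [exp]; unspecified at [x <= zero]. *)
Definition log (x : game) : game :=
  epsilon (inhabits zero) (fun z => numeric z /\ exp z == x).

(** * The field K *)

Fixpoint GG (n : nat) : game -> Prop :=
  match n with
  | O => fun m => numeric m /\ exists k : Z, m == powz omega k
  | S n' => fun m =>
      numeric m /\
      exists (gamma theta : game) (k : Z),
        (hahn (GG n') gamma /\ purely_infinite gamma) /\
        (hahn (GG n') theta /\ purely_infinite theta) /\
        m == exp (gamma + log omega * (theta + intg k))
  end.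

Definition KK (n : nat) : game -> Prop := hahn (GG n).

Definition GGunion (m : game) : Prop := exists n, GG n m.
Definition KKunion (x : game) : Prop := exists n, KK n x.

Definition least (P : game -> Prop) (x : game) : Prop :=
  P x /\ forall y, P y -> x <= y.

(* Main.v *)
From Stdlib Require Import Permutation.
From HB Require Import structures.
From mathcomp Require Import all_boot all_order all_algebra.
From mathcomp Require Import ring lra zify boolp.
Require Import Defs.

Set Implicit Arguments.
Unset Strict Implicit.
Unset Printing Implicit Defensive.

Import Order.TTheory GRing.Theory Num.Theory.

(** Write [L] for the logarithm of [omega]; it is infinite and [L ^ n] is smaller
    than [omega] for all [n].  The induction on [n] shows that two monomials
    [g > t] of [GG n] satisfy [g > k L t] for all integers [k].  The difference of
    the arguments of the exponentials that define two elements of [GG (n + 1)] has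
    the form [D + L (E + k)], where [D] and [E] are differences of purely infinite
    elements of [KK n].  Comparing two normal forms at the first place where they
    differ shows that [D], if it is not zero, belongs to the archimedean class of a
    monomial [g > 1] of [GG n], and [E] to that of a monomial [t > 1].  By the
    induction hypothesis [g] and [L t] belong to different archimedean classes, so
    that [D] and [L E] cannot cancel: [D + L E] is zero or infinitely larger than
    [L].  Hence [D + L (E + k) > 0] implies [D + L (E + k) >= L].  Since
    [exp x > exp y * (x - y) ^ 2 / 2] for [x > y], this gives the gap for
    [GG (n + 1)], and for [t = 1] the monotonicity of [exp] gives [g >= omega]. *)

(** What the recursive definition of [exp] yields directly is not a product formula but the
    inequality [exp u * [v - u]_n < exp v] for [u < v]. A difference of arguments of at least [L]
    thus gives a factor [L ^ 2 / 2] rather than [omega]. This is why the induction carries the gap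
    [k L t] and not [omega t], and why [omega] itself is reached only at [t = 1], where
    [exp zero = 1] allows a comparison with [exp L].

    Most of the work is to make the operations behave. Products, powers of omega and [exp] are well
    defined only through claims on single numbers that use claims on pairs of their options and
    conversely; the inductions therefore run on finite lists of games. For [exp] there is a second
    obstacle: surreal numbers are not archimedean, so truncations of the series cannot be compared
    through limits. Their inequalities come from signs of coefficients of polynomials, and errors
    are measured against powers of an argument that may be infinitesimal.

    Since [log omega] is a choice among the solutions of [exp z == omega], an explicit cut with
    exponential [omega] has to be exhibited. *)

(** * Games *)

Local Open Scope game_scope.

(* [opt true x] holds of the left options of [x], [opt false x] of the right
   ones. *)
Definition opt (b : bool) (x : game) : game -> Prop :=
  let: Game L R l r := x in
  if b then fun y => exists i, y = l i else fun y => exists j, y = r j.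

Lemma opt_ind (P : game -> Prop) :
  (forall x, (forall b y, opt b x y -> P y) -> P x) -> forall x, P x.
Proof.
move=> H; elim=> L R l IHl r IHr; apply: H => -[] y /= [i ->]; [exact: IHl|exact: IHr].
Qed.

Lemma le_opt (x y : game) :
  x <= y <-> (forall x', opt true x x' -> ~ y <= x') /\
             (forall y', opt false y y' -> ~ y' <= x).
Proof.
case: x y => [XL XR xl xr] [YL YR yl yr].
apply: iff_trans (leE _ _ _ _ _ _ _ _) _; rewrite /=.
split=> -[H1 H2]; split.
- by move=> _ [i ->].
- by move=> _ [i ->].
- by move=> i; apply: H1; exists i.
- by move=> i; apply: H2; exists i.
Qed.

Lemma gle_refl (x : game) : x <= x.
Proof.
elim/opt_ind: x => x IH; apply/le_opt; split => x' ox' le'.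
- by move/le_opt: le' => [/(_ _ ox')]; have := IH _ _ ox'.
- by move/le_opt: le' => [_ /(_ _ ox')]; have := IH _ _ ox'.
Qed.
#[local] Hint Resolve gle_refl : core.

Lemma opt_not_le (b : bool) (x x' : game) :
  opt b x x' -> ~ if b then x <= x' else x' <= x.
Proof.
case: b => ox H; move/le_opt: H => [H1 H2]; [apply: (H1 _ ox)|apply: (H2 _ ox)]; exact: gle_refl.
Qed.

(** Replacing one of the three games by an option turns one cyclic rotation of the claim into
    another, so the three rotations are proved together. *)
Lemma gle_trans (x y z : game) : x <= y -> y <= z -> x <= z.
Proof.
suff H : forall x y z, (x <= y -> y <= z -> x <= z) /\ (y <= z -> z <= x -> y <= x)
      /\ (z <= x -> x <= y -> z <= y) by case: (H x y z).
elim/opt_ind=> {}x IHx; elim/opt_ind=> {}y IHy; elim/opt_ind=> {}z IHz.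
split; [|split] => H1 H2; apply/le_opt; split=> w ow le'.
- by move/le_opt: H1 => [/(_ _ ow) nle _]; apply: nle; have [_ [h _]] := IHx _ _ ow y z; exact: h.
- by move/le_opt: H2 => [_ /(_ _ ow) nle]; apply: nle; have [_ [_ h]] := IHz _ _ ow; exact: h.
- by move/le_opt: H1 => [/(_ _ ow) nle _]; apply: nle; have [_ [_ h]] := IHy _ _ ow z; exact: h.
- by move/le_opt: H2 => [_ /(_ _ ow) nle]; apply: nle; have [h _] := IHx _ _ ow y z; exact: h.
- by move/le_opt: H1 => [/(_ _ ow) nle _]; apply: nle; have [h _] := IHz _ _ ow; exact: h.
- by move/le_opt: H2 => [_ /(_ _ ow) nle]; apply: nle; have [_ [h _]] := IHy _ _ ow z; exact: h.
Qed.

Lemma eqg_refl x : x == x. Proof. by []. Qed.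
Lemma eqg_sym x y : x == y -> y == x. Proof. by case. Qed.
Lemma eqg_trans x y z : x == y -> y == z -> x == z.
Proof. by move=> [a b] [c d]; split; [apply: gle_trans a c|apply: gle_trans d b]. Qed.

(** Most identities between games are reduced by this criterion to their instances at options. *)
Lemma eqg_opts (x y : game) :
  (forall b x', opt b x x' -> exists2 y', opt b y y' & x' == y') ->
  (forall b y', opt b y y' -> exists2 x', opt b x x' & x' == y') -> x == y.
Proof.
move=> H1 H2; split; apply/le_opt; split=> w ow le'.
- have [y' oy' [e _]] := H1 _ _ ow; exact: (opt_not_le oy' (gle_trans le' e)).
- have [y' oy' [e _]] := H2 _ _ ow; exact: (opt_not_le oy' (gle_trans e le')).
- have [y' oy' [_ e]] := H2 _ _ ow; exact: (opt_not_le oy' (gle_trans le' e)).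
- have [y' oy' [_ e]] := H1 _ _ ow; exact: (opt_not_le oy' (gle_trans e le')).
Qed.

Lemma opt_zero b z : opt b zero z -> False.
Proof. by case: b => -[]. Qed.

Lemma opt_natS b n z : opt b (natg n.+1) z <-> b /\ z = natg n.
Proof. by case: b; split=> /=; [case|case=> _ ->; exists tt|case=> -[]|case]. Qed.

Lemma opt_opp b x z : opt b (- x) z <-> exists2 x', opt (~~ b) x x' & z = - x'.
Proof.
case: x b => L R l r [] /=; split.
- by move=> [i ->]; exists (r i) => //; exists i.
- by move=> [_ [i ->] ->]; exists i.
- by move=> [i ->]; exists (l i) => //; exists i.
- by move=> [_ [i ->] ->]; exists i.
Qed.

Lemma opt_add b x y z : opt b (x + y) z <->
  (exists2 x', opt b x x' & z = x' + y) \/ (exists2 y', opt b y y' & z = x + y').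
Proof.
case: x y b => XL XR xl xr [YL YR yl yr] [] /=; split.
- by move=> [[i|i] ->]; [left; exists (xl i)|right; exists (yl i)] => //; exists i.
- by case=> -[_ [i ->] ->]; [exists (inl i)|exists (inr i)].
- by move=> [[i|i] ->]; [left; exists (xr i)|right; exists (yr i)] => //; exists i.
- by case=> -[_ [i ->] ->]; [exists (inl i)|exists (inr i)].
Qed.

(* The sign of an option of a product is the product of the signs of the options
   that it is made of. *)
Lemma opt_mul b x y z : opt b (x * y) z <->
  exists s x' y', [/\ opt s x x', opt (s (+) ~~ b) y y' & z = x' * y + x * y' - x' * y'].
Proof.
case: x y b => XL XR xl xr [YL YR yl yr] [] /=; split.
- by move=> [[[i j]|[i j]] ->]; [exists true, (xl i), (yl j)|exists false, (xr i), (yr j)];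
    split=> //; [exists i|exists j|exists i|exists j].
- by move=> [[] [_ [_ [[i ->] [j ->] ->]]]]; [exists (inl (i, j))|exists (inr (i, j))].
- by move=> [[[i j]|[i j]] ->]; [exists true, (xl i), (yr j)|exists false, (xr i), (yl j)];
    split=> //; [exists i|exists j|exists i|exists j].
- by move=> [[] [_ [_ [[i ->] [j ->] ->]]]]; [exists (inl (i, j))|exists (inr (i, j))].
Qed.

Lemma numeric_opt x : numeric x <->
  (forall x' x'', opt true x x' -> opt false x x'' -> ~ x'' <= x') /\
  (forall b y, opt b x y -> numeric y).
Proof.
case: x => L R l r /=; split.
  move=> [H1 [H2 H3]]; split; first by move=> _ _ [i ->] [j ->].
  by case=> _ [i ->].
move=> [H1 H2]; split; [|split].
- by move=> i j; apply: H1; [exists i|exists j].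
- by move=> i; apply: (H2 true); exists i.
- by move=> i; apply: (H2 false); exists i.
Qed.

(** For a left option [x'], the induction puts each left option of [x'] below [x'], so [x] below it
    would give [x <= x']. The right options of [x] are handled by numericity. *)
Lemma numeric_opt_le b x x' :
  numeric x -> opt b x x' -> if b then x' <= x else x <= x'.
Proof.
elim/opt_ind: x b x' => x IH b x' nx ox; have [H1 H2] := (numeric_opt x).1 nx.
case: b ox => ox; apply/le_opt; split.
- move=> x'' ox'' le'; apply: (opt_not_le ox); apply: (gle_trans le').
  by apply: (IH _ _ ox true) ox''; apply: H2 ox.
- by move=> x'' ox''; apply: H1.
- by move=> x'' ox''; apply: H1.
- move=> x'' ox'' le'; apply: (opt_not_le ox); apply: (gle_trans _ le').
  by apply: (IH _ _ ox false) ox''; apply: H2 ox.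
Qed.

Lemma numeric_opt_lt b x x' :
  numeric x -> opt b x x' -> if b then x' < x else x < x'.
Proof.
move=> nx ox; have := numeric_opt_le nx ox; have := opt_not_le ox.
by case: b {ox} => *; split.
Qed.

Lemma numeric_total x y : numeric x -> numeric y -> ~ y <= x -> x <= y.
Proof.
move=> nx ny nle; apply/le_opt; split=> w ow le'; apply: nle.
- by apply: gle_trans le' _; apply: (numeric_opt_le nx ow).
- by apply: gle_trans _ le'; apply: (numeric_opt_le ny ow).
Qed.

Lemma numeric_opt_num b x x' : numeric x -> opt b x x' -> numeric x'.
Proof. by move=> /numeric_opt[_]; apply. Qed.

Lemma numeric_zero : numeric zero.
Proof. by apply/numeric_opt; split=> [? ? /opt_zero|? ? /opt_zero]. Qed.

Lemma numeric_nat n : numeric (natg n).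
Proof.
elim: n => [|n IH]; first exact: numeric_zero.
by apply/numeric_opt; split=> [x' x'' _ /opt_natS[]//|b y /opt_natS[_ ->]].
Qed.

(** ** The group of games *)

Lemma addgC x y : x + y == y + x.
Proof.
elim/opt_ind: x y => x IHx; elim/opt_ind=> y IHy; apply: eqg_opts => b z /opt_add [] [w ow ->].
- by exists (y + w); [apply/opt_add; right; exists w|apply: (IHx _ _ ow)].
- by exists (w + x); [apply/opt_add; left; exists w|apply: (IHy _ _ ow)].
- by exists (x + w); [apply/opt_add; right; exists w|apply: (IHy _ _ ow)].
- by exists (w + y); [apply/opt_add; left; exists w|apply: (IHx _ _ ow)].
Qed.

Lemma addg0 x : x + zero == x.
Proof.
elim/opt_ind: x => x IHx; apply: eqg_opts => b z.
  by move=> /opt_add[] [w ow ->]; [exists w => //; apply: IHx ow|case: (opt_zero ow)].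
by move=> oz; exists (z + zero); [apply/opt_add; left; exists z|apply: IHx oz].
Qed.

Lemma addgA x y z : x + (y + z) == x + y + z.
Proof.
elim/opt_ind: x y z => x IHx; elim/opt_ind=> y IHy; elim/opt_ind=> z IHz.
apply: eqg_opts => b w /opt_add [] [v].
- move=> ov ->; exists (v + y + z); last exact: (IHx _ _ ov).
  by apply/opt_add; left; exists (v + y) => //; apply/opt_add; left; exists v.
- move=> /opt_add[] [u ou ->] ->.
  + exists (x + u + z); last exact: (IHy _ _ ou).
    by apply/opt_add; left; exists (x + u) => //; apply/opt_add; right; exists u.
  + exists (x + y + u); last exact: (IHz _ _ ou).
    by apply/opt_add; right; exists u.
- move=> /opt_add[] [u ou ->] ->.
  + exists (u + (y + z)); last exact: (IHx _ _ ou).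
    by apply/opt_add; left; exists u.
  + exists (x + (u + z)); last exact: (IHy _ _ ou).
    by apply/opt_add; right; exists (u + z) => //; apply/opt_add; left; exists u.
- move=> ov ->; exists (x + (y + v)); last exact: (IHz _ _ ov).
  by apply/opt_add; right; exists (y + v) => //; apply/opt_add; right; exists v.
Qed.

(** Unfolding [<=] at an option reverses the comparison, so the induction carries both orders of the
    two games; [le_add2r] uses the same device. *)
Lemma gle_opp x y : - y <= - x <-> x <= y.
Proof.
suff H : forall x y, (- y <= - x <-> x <= y) /\ (- x <= - y <-> y <= x) by case: (H x y).
elim/opt_ind=> {}x IHx; elim/opt_ind=> {}y IHy; split; split=> /le_opt[H1 H2]; apply/le_opt.
- split=> w ow le'.
  + by apply: (H2 (- w)); [apply/opt_opp; exists w|apply/(IHx _ _ ow y).2].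
  + by apply: (H1 (- w)); [apply/opt_opp; exists w|apply/(IHy _ _ ow).2].
- split=> w /opt_opp[v ov ->] le'.
  + by apply: (H2 _ ov); apply/(IHy _ _ ov).2.
  + by apply: (H1 _ ov); apply/(IHx _ _ ov y).2.
- split=> w ow le'.
  + by apply: (H2 (- w)); [apply/opt_opp; exists w|apply/(IHy _ _ ow).1].
  + by apply: (H1 (- w)); [apply/opt_opp; exists w|apply/(IHx _ _ ow y).1].
- split=> w /opt_opp[v ov ->] le'.
  + by apply: (H2 _ ov); apply/(IHx _ _ ov y).1.
  + by apply: (H1 _ ov); apply/(IHy _ _ ov).1.
Qed.

Lemma opt_addl b x y x' : opt b x x' -> opt b (x + y) (x' + y).
Proof. by move=> ox; apply/opt_add; left; exists x'. Qed.

Lemma opt_addr b x y y' : opt b y y' -> opt b (x + y) (x + y').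
Proof. by move=> oy; apply/opt_add; right; exists y'. Qed.

Lemma le_add2r z x y : x + z <= y + z <-> x <= y.
Proof.
suff H : forall x y z, (x + z <= y + z <-> x <= y) /\ (y + z <= x + z <-> y <= x).
  by case: (H x y z).
elim/opt_ind=> {}x IHx; elim/opt_ind=> {}y IHy; elim/opt_ind=> {}z IHz.
split; split=> H; apply/le_opt; split.
- move=> x' ox le'; apply: (opt_not_le (opt_addl z ox)).
  by apply: gle_trans H _; apply/(IHx _ _ ox y z).2.
- move=> y' oy le'; apply: (opt_not_le (opt_addl z oy)).
  by apply: gle_trans _ H; apply/(IHy _ _ oy z).2.
- move=> w /opt_add[] [v ov ->] le'.
    by move/le_opt: H => [/(_ _ ov) + _]; apply; apply/(IHx _ _ ov y z).2.
  apply: (opt_not_le (opt_addr y ov)); apply: gle_trans le' _; exact/(IHz _ _ ov).1.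
- move=> w /opt_add[] [v ov ->] le'.
    by move/le_opt: H => [_ /(_ _ ov)]; apply; apply/(IHy _ _ ov z).2.
  apply: (opt_not_le (opt_addr x ov)); apply: gle_trans le'; exact/(IHz _ _ ov).1.
- move=> x' ox le'; apply: (opt_not_le (opt_addl z ox)).
  by apply: gle_trans H _; apply/(IHy _ _ ox z).1.
- move=> y' oy le'; apply: (opt_not_le (opt_addl z oy)).
  by apply: gle_trans _ H; apply/(IHx _ _ oy y z).1.
- move=> w /opt_add[] [v ov ->] le'.
    by move/le_opt: H => [/(_ _ ov) + _]; apply; apply/(IHy _ _ ov z).1.
  apply: (opt_not_le (opt_addr x ov)); apply: gle_trans le' _; exact/(IHz _ _ ov).2.
- move=> w /opt_add[] [v ov ->] le'.
    by move/le_opt: H => [_ /(_ _ ov)]; apply; apply/(IHx _ _ ov y z).1.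
  apply: (opt_not_le (opt_addr y ov)); apply: gle_trans le'; exact/(IHz _ _ ov).2.
Qed.

Lemma addgN x : x - x == zero.
Proof.
have oN b z z' : opt b z z' -> opt (~~ b) (- z) (- z').
  by move=> oz; apply/opt_opp; exists z'; rewrite ?negbK.
elim/opt_ind: x => x IHx; split; apply/le_opt; split.
- move=> w /opt_add[] [v ov ->] le'.
    apply: (opt_not_le (opt_addr v (oN _ _ _ ov))); exact: gle_trans (IHx _ _ ov).1 le'.
  move: ov le' => /opt_opp[u ou ->] le'.
  apply: (opt_not_le (opt_addl (- u) ou)); exact: gle_trans (IHx _ _ ou).1 le'.
- by move=> ? /opt_zero.
- by move=> ? /opt_zero.
- move=> w /opt_add[] [v ov ->] le'.
    apply: (opt_not_le (opt_addr v (oN _ _ _ ov))); exact: gle_trans le' (IHx _ _ ov).2.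
  move: ov le' => /opt_opp[u ou ->] le'.
  apply: (opt_not_le (opt_addl (- u) ou)); exact: gle_trans le' (IHx _ _ ou).2.
Qed.

Lemma eqg_add2r z x y : x == y -> x + z == y + z.
Proof. by move=> [a b]; split; apply/le_add2r. Qed.

Lemma eqg_add x y z t : x == y -> z == t -> x + z == y + t.
Proof.
move=> e1 e2; apply: eqg_trans (eqg_add2r z e1) _.
by apply: eqg_trans (addgC _ _) (eqg_trans (eqg_add2r y e2) (addgC _ _)).
Qed.

Lemma eqg_opp x y : x == y -> - x == - y.
Proof. by move=> [a b]; split; apply/gle_opp. Qed.

(* The class of [x] modulo [==] is represented by the set of the games equal to
   [x]. *)
Record gclass := Gclass {gset :> game -> Prop; _ : exists x, gset = eqg x}.

Definition cls (x : game) : gclass := Gclass (ex_intro _ x erefl).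

Lemma clsP x y : cls x = cls y <-> x == y.
Proof.
split=> [[e]|e]; first by have : y == y by []; rewrite -[y == y]/(eqg y y) -e.
have e' : eqg x = eqg y.
  apply: funext => z; apply: propext; split; apply: eqg_trans => //; exact: eqg_sym.
by rewrite /cls; move: (ex_intro _ x _) (ex_intro _ y _); rewrite e' => p q; congr Gclass; exact: Prop_irrelevance.
Qed.

Lemma cls_ex (u : gclass) : exists x, u = cls x.
Proof. by case: u => s [x e]; subst s; exists x; congr Gclass; exact: Prop_irrelevance. Qed.

Definition gval (u : gclass) : game := sval (cid (cls_ex u)).
Lemma gvalK u : cls (gval u) = u.
Proof. by rewrite /gval; case: cid => x /= ->. Qed.
Lemma clsK x : gval (cls x) == x.
Proof. by apply/clsP; rewrite gvalK. Qed.

HB.instance Definition _ := gen_eqMixin gclass.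
HB.instance Definition _ := gen_choiceMixin gclass.

Definition gadd u v := cls (gval u + gval v).
Definition gopp u := cls (- gval u).

Lemma gaddE x y : gadd (cls x) (cls y) = cls (x + y).
Proof. by apply/clsP; apply: eqg_add; exact: clsK. Qed.

Fact gaddA : associative gadd.
Proof.
move=> u v w; rewrite -[u]gvalK -[v]gvalK -[w]gvalK !gaddE; apply/clsP; exact: addgA.
Qed.
Fact gaddC : commutative gadd.
Proof. by move=> u v; apply/clsP; exact: addgC. Qed.
Fact gadd0 : left_id (cls zero) gadd.
Proof.
by move=> u; rewrite gaddC -[u]gvalK gaddE; apply/clsP; exact: addg0.
Qed.
Fact gaddN : left_inverse (cls zero) gopp gadd.
Proof.
by move=> u; rewrite gaddC -[u]gvalK /gopp gaddE; apply/clsP; apply: eqg_trans (addgN (gval u));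
 apply: eqg_add; [exact: eqg_refl|apply: eqg_opp; exact: clsK].
Qed.

HB.instance Definition _ := GRing.isZmodule.Build gclass gaddA gaddC gadd0 gaddN.

Lemma cls0 : cls zero = 0%R. Proof. by []. Qed.
Lemma clsD x y : cls (x + y) = (cls x + cls y)%R. Proof. by rewrite -gaddE. Qed.
Lemma clsN x : cls (- x) = (- cls x)%R.
Proof. by apply/clsP; apply: eqg_opp; apply: eqg_sym; exact: clsK. Qed.
Definition clsE := (cls0, clsD, clsN).

(* The trivial extension of the integers by the group of games is a commutative
   ring, in which [ring] decides identities between games. *)
Definition gext : Type := (int * gclass)%type.
HB.instance Definition _ := GRing.Zmodule.on gext.
Definition gext_mul (p q : gext) : gext := (p.1 * q.1, p.2 *~ q.1 + q.2 *~ p.1)%R.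
Fact gext_mulA : associative gext_mul.
Proof.
move=> [a u] [b v] [c w]; rewrite /gext_mul /=; congr pair; first by rewrite mulrA.
by rewrite !mulrzDl -!mulrzA addrA (mulrC c a) (mulrC b a).
Qed.
Fact gext_mulC : commutative gext_mul.
Proof. by move=> [a u] [b v]; rewrite /gext_mul /= mulrC addrC. Qed.
Fact gext_mul1 : left_id ((1, 0)%R : gext) gext_mul.
Proof. by move=> [a u]; rewrite /gext_mul /= mul1r mul0rz add0r. Qed.
Fact gext_mulD : left_distributive gext_mul +%R.
Proof.
move=> [a u] [b v] [c w]; rewrite /gext_mul /=; congr pair; first by rewrite mulrDl.
by rewrite mulrzDl mulrzDr addrACA.
Qed.
Fact gext_1neq0 : ((1, 0)%R : gext) != 0%R.
Proof. by apply/eqP => -[]. Qed.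
HB.instance Definition _ := GRing.Zmodule_isComNzRing.Build gext
  gext_mulA gext_mulC gext_mul1 gext_mulD gext_1neq0.

Definition gemb (u : gclass) : gext := (0%R, u).
Lemma gemb_inj : injective gemb. Proof. by move=> u v []. Qed.
Lemma gemb0 : gemb 0%R = 0%R. Proof. by []. Qed.
Lemma gembD u v : gemb (u + v)%R = (gemb u + gemb v)%R. Proof. by []. Qed.
Lemma gembN u : gemb (- u)%R = (- gemb u)%R. Proof. by []. Qed.

Ltac gring := apply: gemb_inj; rewrite ?(gembD, gembN, gemb0); ring.

Definition gnneg (u : gclass) : Prop := zero <= gval u.
Definition gpos (u : gclass) : Prop := zero < gval u.

Lemma le_cls x y : x <= y <-> gnneg (cls y - cls x)%R.
Proof.
rewrite -clsN -clsD /gnneg; have [e1 e2] := clsK (y - x).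
have [a0 b0] := addgN x.
split.
  move=> le'; apply: gle_trans e2; apply: gle_trans b0 _; exact/le_add2r.
move=> H; apply/(le_add2r (- x)); apply: gle_trans a0 _; exact: gle_trans H e1.
Qed.

Lemma gposE u : gpos u <-> gnneg u /\ ~ gnneg (- u)%R.
Proof.
have E : gval u <= zero <-> gnneg (- u)%R.
  by apply: iff_trans (le_cls _ _) _; rewrite gvalK cls0 sub0r.
by split=> -[h1 h2]; split=> // h3; apply: h2; apply/E.
Qed.

Lemma lt_cls x y : x < y <-> gpos (cls y - cls x)%R.
Proof.
split=> [[h1 h2]|/gposE[h1 h2]].
  apply/gposE; split; first exact: (le_cls _ _).1 h1.
  by rewrite opprB => h; apply: h2; apply: (le_cls _ _).2 h.
split; first exact: (le_cls _ _).2 h1.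
by move=> h; apply: h2; rewrite opprB; apply: (le_cls _ _).1 h.
Qed.

Lemma gposW u : gpos u -> gnneg u. Proof. by case. Qed.

Lemma gnneg0 : gnneg 0%R. Proof. exact: (clsK zero).2. Qed.

Lemma gnnegD u v : gnneg u -> gnneg v -> gnneg (u + v)%R.
Proof.
move=> hu hv; suff : zero <= gval u + gval v.
  by move/(le_cls _ _).1; rewrite !clsE subr0 !gvalK.
apply: gle_trans hv _; apply: gle_trans (addg0 _).2 _; apply: gle_trans (addgC _ _).1 _.
exact/le_add2r.
Qed.

Lemma gposDl u v : gpos u -> gnneg v -> gpos (u + v)%R.
Proof.
move=> /gposE[h1 h2] h3; apply/gposE; split; first exact: gnnegD.
move=> h4; apply: h2; have -> : (- u = - (u + v) + v)%R by gring.
exact: gnnegD.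
Qed.

Lemma gposDr u v : gnneg u -> gpos v -> gpos (u + v)%R.
Proof. by move=> h1 h2; rewrite addrC; exact: gposDl. Qed.

Lemma glt_trans x y z : x < y -> y < z -> x < z.
Proof.
move=> /(lt_cls _ _).1 h1 /(lt_cls _ _).1 h2; apply: (lt_cls _ _).2.
have -> : (cls z - cls x = (cls z - cls y) + (cls y - cls x))%R by gring.
by apply: gposDl => //; exact: gposW.
Qed.

Lemma glt_le_trans x y z : x < y -> y <= z -> x < z.
Proof.
by move=> [h1 h2] h3; split; [exact: gle_trans h3|move=> h; apply: h2; exact: gle_trans h].
Qed.

Lemma gle_lt_trans x y z : x <= y -> y < z -> x < z.
Proof.
by move=> h3 [h1 h2]; split; [exact: gle_trans h3 h1|move=> h; apply: h2; exact: gle_trans h h3].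
Qed.

Lemma numeric_opp x : numeric x -> numeric (- x).
Proof.
elim/opt_ind: x => x IH /numeric_opt[H1 H2]; apply/numeric_opt; split.
  move=> _ _ /opt_opp[v ov ->] /opt_opp[w ow ->]; move/gle_opp; exact: H1.
by move=> b _ /opt_opp[v ov ->]; apply: IH (ov) (H2 _ _ ov).
Qed.

(** The separating game [z] may be any game, because [<] is transitive on all games; in
    [numeric_add] it is the sum whose numericity is being proved. *)
Lemma numeric_between (x z : game) :
  (forall b y, opt b x y -> numeric y /\ if b then y < z else z < y) -> numeric x.
Proof.
move=> H; apply/numeric_opt; split; last by move=> b y /H[].
by move=> x' x'' /H[_ h1] /H[_ h2]; case: (glt_trans h1 h2).
Qed.

Lemma numeric_add x y : numeric x -> numeric y -> numeric (x + y).
Proof.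
elim/opt_ind: x y => x IHx; elim/opt_ind=> y IHy nx ny.
apply: (@numeric_between _ (x + y)) => b _ /opt_add[] [v ov ->].
- split; first by apply: IHx (ov) _ _ ny; apply: numeric_opt_num ov.
  have := numeric_opt_lt nx ov; case: b {ov} => /(lt_cls _ _).1 h; apply: (lt_cls _ _).2; move: h;
  by set a := (_ - _)%R; set b := (_ - _)%R; suff -> : a = b by []; rewrite /a /b !clsE; gring.
- split; first by apply: IHy (ov) _ _ => //; apply: numeric_opt_num ov.
  have := numeric_opt_lt ny ov; case: b {ov} => /(lt_cls _ _).1 h; apply: (lt_cls _ _).2; move: h;
  by set a := (_ - _)%R; set b := (_ - _)%R; suff -> : a = b by []; rewrite /a /b !clsE; gring.
Qed.

(** ** Products of games *)

Lemma cls_eq x y : x == y -> cls x = cls y.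
Proof. by move/clsP. Qed.


(** Multiplication does not respect [==] on games that are not numbers. The ring laws are therefore
    proved with the classes of products as atoms of the additive group, rewritten only by induction
    hypotheses on the same products. *)
Lemma mulgC x y : x * y == y * x.
Proof.
elim/opt_ind: x y => x IHx; elim/opt_ind=> y IHy.
have E b c u v : opt b x u -> opt c y v ->
    u * y + x * v - u * v == v * x + y * u - v * u.
  move=> ou ov; apply/clsP; rewrite !clsE !(cls_eq (IHx _ _ ou _)) (cls_eq (IHy _ _ ov)).
  by gring.
apply: eqg_opts => b _ /opt_mul[s [u [v [ou ov ->]]]].
- exists (v * x + y * u - v * u); last exact: E ou ov.
  by apply/opt_mul; exists (s (+) ~~ b), v, u; split; rewrite ?addbK.
- exists (v * y + x * u - v * u); last exact: E ov ou.
  by apply/opt_mul; exists (s (+) ~~ b), v, u; split; rewrite ?addbK.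
Qed.

Lemma mulg0 x : x * zero == zero.
Proof. by apply: eqg_opts => b z; [move=> /opt_mul[s [u [v [_ /opt_zero]]]]|move=> /opt_zero]. Qed.

Lemma mulg1 x : x * one == x.
Proof.
elim/opt_ind: x => x IHx; apply: eqg_opts => b z.
  move=> /opt_mul[s [u [v [ou /opt_natS[bs ->] ->]]]]; exists u.
    by move: bs ou; case: s; case: b.
  apply/clsP; rewrite !clsE !(cls_eq (mulg0 _)) (cls_eq (IHx _ _ ou)) !clsE.
  by gring.
move=> oz; exists (z * one + x * zero - z * zero).
  by apply/opt_mul; exists b, z, zero; split => //; apply/opt_natS; case: b {oz}.
apply/clsP; rewrite !clsE !(cls_eq (mulg0 _)) (cls_eq (IHx _ _ oz)) !clsE.
by gring.
Qed.

Lemma mulNg x y : - x * y == - (x * y).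
Proof.
elim/opt_ind: x y => x IHx; elim/opt_ind=> y IHy.
have E b u v : opt b x u -> opt b y v \/ opt (~~ b) y v ->
    - u * y + - x * v - - u * v == - (u * y + x * v - u * v).
  move=> ou ov; apply/clsP; rewrite !clsE.
  rewrite !(cls_eq (IHx _ _ ou _)).
  have -> : cls (- x * v) = cls (- (x * v)).
    by apply: cls_eq; case: ov => ov; exact: (IHy _ _ ov).
  by rewrite !clsE; gring.
apply: eqg_opts => b z.
  move=> /opt_mul[s [_ [v [/opt_opp[u ou ->] ov ->]]]].
  exists (- (u * y + x * v - u * v)).
    apply/opt_opp; exists (u * y + x * v - u * v) => //; apply/opt_mul.
    by exists (~~ s), u, v; split=> //; move: ov; case: (s); case: (b).
  by apply: E ou _; move: ov; case: s; case: b; auto.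
move=> /opt_opp[_ /opt_mul[s [u [v [ou ov ->]]]] ->].
exists (- u * y + - x * v - - u * v).
  apply/opt_mul; exists (~~ s), (- u), v; split=> //; first by apply/opt_opp; exists u; rewrite ?negbK.
  by move: ov; case: (s); case: (b).
by apply: E ou _; move: ov; case: s; case: b; auto.
Qed.

Lemma mulgDl x y z : (x + y) * z == x * z + y * z.
Proof.
elim/opt_ind: x y z => x IHx; elim/opt_ind=> y IHy; elim/opt_ind=> z IHz.
have E1 b c u w : opt b x u -> opt c z w ->
    (u + y) * z + (x + y) * w - (u + y) * w == (u * z + x * w - u * w) + y * z.
  move=> ou ow; apply/clsP; rewrite !clsE.
  by rewrite !(cls_eq (IHx _ _ ou _ _)) (cls_eq (IHz _ _ ow)) !clsE; gring.
have E2 b c u w : opt b y u -> opt c z w ->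
    (x + u) * z + (x + y) * w - (x + u) * w == x * z + (u * z + y * w - u * w).
  move=> ou ow; apply/clsP; rewrite !clsE.
  by rewrite !(cls_eq (IHy _ _ ou _)) (cls_eq (IHz _ _ ow)) !clsE; gring.
apply: eqg_opts => b t.
  move=> /opt_mul[s [_ [w [/opt_add[] [u ou ->] ow ->]]]].
    exists (u * z + x * w - u * w + y * z); last exact: E1 ou ow.
    by apply: opt_addl; apply/opt_mul; exists s, u, w.
  exists (x * z + (u * z + y * w - u * w)); last exact: E2 ou ow.
  by apply: opt_addr; apply/opt_mul; exists s, u, w.
move=> /opt_add[] [_ /opt_mul[s [u [w [ou ow ->]]]] ->].
  exists ((u + y) * z + (x + y) * w - (u + y) * w); last exact: E1 ou ow.
  by apply/opt_mul; exists s, (u + y), w; split=> //; exact: opt_addl.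
exists ((x + u) * z + (x + y) * w - (x + u) * w); last exact: E2 ou ow.
by apply/opt_mul; exists s, (x + u), w; split=> //; exact: opt_addr.
Qed.

Lemma mulgDr x y z : z * (x + y) == z * x + z * y.
Proof.
apply: eqg_trans (mulgC _ _) _; apply: eqg_trans (mulgDl _ _ _) _.
by apply: eqg_add; exact: mulgC.
Qed.

Lemma mulgN x y : x * - y == - (x * y).
Proof.
apply: eqg_trans (mulgC _ _) _; apply: eqg_trans (mulNg _ _) _.
by apply: eqg_opp; exact: mulgC.
Qed.

Lemma cls_mulDl x y z : cls ((x + y) * z) = (cls (x * z) + cls (y * z))%R.
Proof. by rewrite -clsD; apply/clsP; exact: mulgDl. Qed.
Lemma cls_mulDr x y z : cls (z * (x + y)) = (cls (z * x) + cls (z * y))%R.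
Proof. by rewrite -clsD; apply/clsP; exact: mulgDr. Qed.
Lemma cls_mulNl x z : cls (- x * z) = (- cls (x * z))%R.
Proof. by rewrite -clsN; apply/clsP; exact: mulNg. Qed.
Lemma cls_mulNr x z : cls (z * - x) = (- cls (z * x))%R.
Proof. by rewrite -clsN; apply/clsP; exact: mulgN. Qed.
Definition cls_mulE := (cls_mulDl, cls_mulDr, cls_mulNl, cls_mulNr).

Lemma mulgA x y z : x * (y * z) == x * y * z.
Proof.
elim/opt_ind: x y z => x IHx; elim/opt_ind=> y IHy; elim/opt_ind=> z IHz.
(* Both sides expand to the same inclusion-exclusion sum over the triple products in which at least
   one factor is replaced by its option. *)
have E a b c u v w : opt a x u -> opt b y v -> opt c z w ->
    u * (y * z) + x * (v * z + y * w - v * w) - u * (v * z + y * w - v * w) ==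
    (u * y + x * v - u * v) * z + (x * y) * w - (u * y + x * v - u * v) * w.
  move=> ou ov ow; apply/clsP; rewrite !(clsE, cls_mulE).
  by rewrite !(cls_eq (IHx _ _ ou _ _)) !(cls_eq (IHy _ _ ov _)) (cls_eq (IHz _ _ ow)); gring.
apply: eqg_opts => b t.
  move=> /opt_mul[s [u [_ [ou /opt_mul[s' [v [w [ov ow ->]]]] ->]]]].
  exists ((u * y + x * v - u * v) * z + (x * y) * w - (u * y + x * v - u * v) * w); last exact: E ou ov ow.
  apply/opt_mul; exists (s (+) ~~ s'), (u * y + x * v - u * v), w; split=> //.
    by apply/opt_mul; exists s, u, v; split=> //; move: ov; case: (s); case: (s').
  by move: ow; case: (s); case: (s'); case: (b).
move=> /opt_mul[s [_ [w [/opt_mul[s' [u [v [ou ov ->]]]] ow ->]]]].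
exists (u * (y * z) + x * (v * z + y * w - v * w) - u * (v * z + y * w - v * w)); last exact: E ou ov ow.
apply/opt_mul; exists s', u, (v * z + y * w - v * w); split=> //.
apply/opt_mul; exists (s' (+) ~~ s), v, w; split=> //.
by move: ow; case: (s); case: (s'); case: (b).
Qed.

(** ** The hydra order on finite lists of games *)

(** This is the multiset extension of the option order. It allows one game to be traded for two of
    its options, as the inductions on products and exponentials require. *)
Definition hydra_step (l' l : seq game) : Prop :=
  exists a s t, [/\ Permutation l (a :: t), Permutation l' (s ++ t) &
                    forall b, List.In b s -> exists c, opt c a b].

Lemma Permutation_cons2 (T : Type) (a b : T) (l t : seq T) :
  Permutation (a :: l) (b :: t) ->
  (a = b /\ Permutation l t) \/
  exists t', Permutation t (a :: t') /\ Permutation l (b :: t').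
Proof.
move=> p; have : List.In b (a :: l) by apply: Permutation_in (Permutation_sym p) _; left.
case=> [e|]; first by left; split=> //; apply: (@Permutation_cons_inv _ _ _ b); rewrite -{1}e.
move=> /(List.in_split _ _)[l1 [l2 e]]; right; exists (l1 ++ l2); subst l.
split; last by apply: Permutation_sym; exact: Permutation_middle.
apply: (@Permutation_cons_inv _ _ _ b); apply: Permutation_trans (Permutation_sym p) _.
apply: Permutation_trans (perm_swap _ _ _); apply: perm_skip.
by apply: Permutation_sym; exact: Permutation_middle.
Qed.

Lemma Acc_hydra_perm l l' : Permutation l l' -> Acc hydra_step l -> Acc hydra_step l'.
Proof.
move=> p [H]; constructor=> m [a [s [t [p1 p2 h]]]]; apply: H; exists a, s, t; split=> //.
exact: Permutation_trans p1.
Qed.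

(** The usual nested induction for multiset orders: on [a] through its options, then on the
    accessibility of [l]. A step replaces either [a], whose options are then added one by one, or an
    element of [l]. *)
Lemma Acc_hydra_cons a l : Acc hydra_step l -> Acc hydra_step (a :: l).
Proof.
elim/opt_ind: a l => a IHa l acc; elim: acc => {}l H IHl.
have accl : Acc hydra_step l by constructor.
constructor=> m [a0 [s [t [p1 p2 h]]]]; case: (Permutation_cons2 p1) => [[e p]|[t' [pt pl]]].
  apply: Acc_hydra_perm (Permutation_sym p2) _.
  apply: (@Acc_hydra_perm (s ++ l)); first exact: Permutation_app_head.
  subst a0; elim: s h {p2} => [//|b s IHs] h /=; case: (h b (or_introl erefl)) => c oc.
  by apply: IHa oc _ _; apply: IHs => b' hb'; apply: h; right.
apply: (@Acc_hydra_perm (a :: (s ++ t'))).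
  apply: Permutation_sym; apply: Permutation_trans p2 _; apply: Permutation_sym.
  apply: Permutation_trans (Permutation_middle _ _ _) _.
  by apply: Permutation_app_head; apply: Permutation_sym.
by apply: IHl; exists a0, s, t'; split.
Qed.

Lemma hydra_ind (P : seq game -> Prop) :
  (forall l, (forall l', Relation_Operators.clos_trans _ hydra_step l' l -> P l') -> P l) ->
  forall l, P l.
Proof.
move=> H l; have wf : well_founded hydra_step.
  elim=> [|a {}l IH]; last exact: Acc_hydra_cons.
  constructor=> m [a [s [t [p _ _]]]]; by have := Permutation_length p.
exact: (well_founded_ind (Transitive_Closure.wf_clos_trans _ _ wf)).
Qed.

Notation hydra := (Relation_Operators.clos_trans (seq game) hydra_step).

Lemma hydra1 a t s : (forall b, List.In b s -> exists c, opt c a b) ->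
  hydra (s ++ t) (a :: t).
Proof. by move=> h; apply: Relation_Operators.t_step; exists a, s, t; split=> //; exact: Permutation_refl. Qed.

Lemma hydra_perml l1 l2 l : Permutation l1 l2 -> hydra l1 l -> hydra l2 l.
Proof.
move=> p h; elim: h l2 p => [{}l1 {}l [a [s [t [p1 p2 h]]]] l2 p|x y z h1 IH1 h2 IH2 l2 p].
  apply: Relation_Operators.t_step; exists a, s, t; split=> //; apply: Permutation_trans p2; exact: Permutation_sym.
by apply: Relation_Operators.t_trans h2; exact: IH1.
Qed.

Lemma hydra_permr l1 l2 l : Permutation l1 l2 -> hydra l l1 -> hydra l l2.
Proof.
move=> p h; elim: h l2 p => [{}l {}l1 [a [s [t [p1 p2 h]]]] l2 p|x y z h1 IH1 h2 IH2 l2 p].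
  apply: Relation_Operators.t_step; exists a, s, t; split=> //; apply: Permutation_trans p1; exact: Permutation_sym.
by apply: Relation_Operators.t_trans h1 _; exact: IH2.
Qed.

Lemma hydra_one a b c t : opt c a b -> hydra (b :: t) (a :: t).
Proof. by move=> o; apply: (@hydra1 a t [:: b]) => d /= [<-|//]; exists c. Qed.

Lemma hydra_drop a t : hydra t (a :: t).
Proof. by apply: (@hydra1 a t [::]). Qed.

Lemma hydra_two a b c b' c' t : opt c a b -> opt c' a b' -> hydra [:: b, b' & t] (a :: t).
Proof. by move=> o o'; apply: (@hydra1 a t [:: b; b']) => d /= [<-|[<-|//]]; [exists c|exists c']. Qed.

(** Here [A x] may use [B] at two options of [x], while [B x y] may use [A x] and [A y]. In the
    hydra order this is sound: [[:: u; v]] is below [[:: x]] for options [u], [v] of [x], and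
    [[:: x]] is below [[:: x; y]]. *)
Lemma numeric_pair_ind (A : game -> Prop) (B : game -> game -> Prop) :
  (forall x, numeric x -> (forall b u, opt b x u -> A u) ->
     (forall b c u v, opt b x u -> opt c x v -> B u v) -> A x) ->
  (forall x y, numeric x -> numeric y -> A x -> A y ->
     (forall b u, opt b x u -> [/\ A u, B u y & B y u]) ->
     (forall b u, opt b y u -> [/\ A u, B u x & B x u]) -> B x y) ->
  (forall x, numeric x -> A x) /\ (forall x y, numeric x -> numeric y -> B x y).
Proof.
move=> HA HB; suff H l : (forall x, Permutation l [:: x] -> numeric x -> A x) /\
    (forall x y, Permutation l [:: x; y] -> numeric x -> numeric y -> B x y).
  split=> [x|x y]; [exact: (H [:: x]).1 (Permutation_refl _)|].
  exact: (H [:: x; y]).2 (Permutation_refl _).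
elim/hydra_ind: l => l IH.
have IH1 x : hydra [:: x] l -> numeric x -> A x.
  by move=> h; apply: (IH _ h).1; exact: Permutation_refl.
have IH2 x y : hydra [:: x; y] l -> numeric x -> numeric y -> B x y.
  by move=> h; apply: (IH _ h).2; exact: Permutation_refl.
clear IH; have num := numeric_opt_num.
split.
  move=> x p nx; have q : Permutation [:: x] l by exact: Permutation_sym.
  apply: HA => //.
    by move=> b u ou; apply: IH1; [apply: hydra_permr q _; exact: hydra_one ou|exact: num ou].
  move=> b c u v ou ov; apply: IH2; [|exact: num ou|exact: num ov].
  by apply: hydra_permr q _; exact: hydra_two ou ov.
have sw a b : hydra [:: a; b] l -> hydra [:: b; a] l.
  by apply: hydra_perml; exact: perm_swap.
have step x y : Permutation [:: x; y] l -> numeric x -> numeric y ->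
    A y /\ forall b u, opt b x u -> [/\ A u, B u y & B y u].
  move=> q nx ny; split; first by apply: IH1 => //; apply: hydra_permr q _; exact: hydra_drop.
  move=> b u ou; have nu := num _ _ _ nx ou.
  have h : hydra [:: u; y] l by apply: hydra_permr q _; exact: hydra_one ou.
  split; [apply: IH1 => //|exact: IH2|by apply: IH2 => //; exact: sw].
  by apply: Relation_Operators.t_trans (sw _ _ h); exact: hydra_drop.
move=> x y p nx ny; have q : Permutation [:: x; y] l by exact: Permutation_sym.
have [Ay Hx] := step _ _ q nx ny.
have [Ax Hy] := step _ _ (Permutation_trans (perm_swap _ _ _) q) ny nx.
exact: HB.
Qed.

(** ** Products of numbers *)

Lemma not_le_ex x y : ~ y <= x ->
  (exists2 y', opt true y y' & x <= y') \/ (exists2 x', opt false x x' & x' <= y).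
Proof.
move=> nle; case: (pselect (exists2 y', opt true y y' & x <= y')); first by left.
move=> h1; right; apply: contrapT => h2; apply: nle; apply/le_opt; split=> w ow le'.
  by apply: h1; exists w.
by apply: h2; exists w.
Qed.

(* The formal expansion of [(x2 - x1) * (y2 - y1)]. *)
Definition rect (x1 x2 y1 y2 : game) : gclass :=
  (cls (x2 * y2) + cls (x1 * y1) - cls (x1 * y2) - cls (x2 * y1))%R.

Definition mul_cong (x1 x2 y : game) : Prop := x1 == x2 -> x1 * y == x2 * y.

(** The second side of the rectangle joins [y] to one of its own options, so that only three games
    enter the induction; [rect_pos] removes the restriction. *)
Definition mul_mono (x1 x2 y : game) : Prop := x1 < x2 ->
  (forall y', opt true y y' -> gpos (rect x1 x2 y' y)) /\
  (forall y', opt false y y' -> gpos (rect x1 x2 y y')).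

Lemma mul_mono_le x1 x2 y y' b : mul_cong x1 x2 y -> mul_cong x1 x2 y' -> mul_mono x1 x2 y ->
  x1 <= x2 -> opt b y y' -> gnneg (if b then rect x1 x2 y' y else rect x1 x2 y y').
Proof.
move=> c c' m le12 oy; case: (pselect (x2 <= x1)) => [le21|nle].
  have e : x1 == x2 by [].
  have -> : (if b then rect x1 x2 y' y else rect x1 x2 y y') = 0%R; last exact: gnneg0.
  by case: b oy => _; rewrite /rect (cls_eq (c e)) (cls_eq (c' e)); gring.
have [h1 h2] := m (conj le12 nle); apply: gposW.
by case: b oy => oy; [exact: h1|exact: h2].
Qed.

Lemma rectC x1 x2 y1 y2 : rect x1 x2 y1 y2 = rect y1 y2 x1 x2.
Proof.
by rewrite /rect (cls_eq (mulgC x2 y2)) (cls_eq (mulgC x1 y1)) (cls_eq (mulgC x1 y2)) (cls_eq (mulgC x2 y1)); gring.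
Qed.

Lemma numeric_mul_step x y : numeric x -> numeric y ->
  (forall b x', opt b x x' -> numeric (x' * y)) ->
  (forall b y', opt b y y' -> numeric (x * y')) ->
  (forall b c x' y', opt b x x' -> opt c y y' -> numeric (x' * y')) ->
  (forall b c u v, opt b x u -> opt c x v -> mul_cong u v y /\ mul_mono u v y) ->
  (forall b c d u v w, opt b x u -> opt c x v -> opt d y w -> mul_cong u v w) ->
  (forall b c u v, opt b y u -> opt c y v -> mul_cong u v x /\ mul_mono u v x) ->
  (forall b c d u v w, opt b y u -> opt c y v -> opt d x w -> mul_cong u v w) ->
  numeric (x * y).
Proof.
move=> nx ny N1 N2 N3 X1 X2 Y1 Y2.
have Xle b c d u v w : opt b x u -> opt c x v -> u <= v -> opt d y w ->
    gnneg (if d then rect u v w y else rect u v y w).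
  move=> ou ov le' ow; have [c1 m1] := X1 _ _ _ _ ou ov.
  exact: mul_mono_le (X2 _ _ _ _ _ _ ou ov ow) m1 le' ow.
have Xlt b c d u v w : opt b x u -> opt c x v -> u < v -> opt d y w ->
    gpos (if d then rect u v w y else rect u v y w).
  move=> ou ov lt' ow; have [c1 m1] := X1 _ _ _ _ ou ov; have [h1 h2] := m1 lt'.
  by case: d ow => ow; [exact: h1|exact: h2].
have Yle b c d u v w : opt b y u -> opt c y v -> u <= v -> opt d x w ->
    gnneg (if d then rect w x u v else rect x w u v).
  move=> ou ov le' ow; have [c1 m1] := Y1 _ _ _ _ ou ov.
  by have := mul_mono_le c1 (Y2 _ _ _ _ _ _ ou ov ow) m1 le' ow; rewrite !(rectC u v).
have Ylt b c d u v w : opt b y u -> opt c y v -> u < v -> opt d x w ->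
    gpos (if d then rect w x u v else rect x w u v).
  move=> ou ov lt' ow; have [c1 m1] := Y1 _ _ _ _ ou ov; have [h1 h2] := m1 lt'.
  by case: d ow => ow; rewrite rectC; [exact: h1|exact: h2].
have NX b x' : opt b x x' -> numeric x' by exact: numeric_opt_num.
have NY b y' : opt b y y' -> numeric y' by exact: numeric_opt_num.
have sep b z z' z'' : numeric z -> opt b z z' -> opt (~~ b) z z'' -> if b then z' < z'' else z'' < z'.
  move=> nz o1 o2; have := numeric_opt_lt nz o1; have := numeric_opt_lt nz o2.
  by case: b {o1 o2} => /= h1 h2; [exact: glt_trans h2 h1|exact: glt_trans h1 h2].
apply/numeric_opt; split; last first.
  move=> b _ /opt_mul[s [u [v [ou ov ->]]]]; apply: numeric_add; last first.
    by apply: numeric_opp; exact: N3 ou ov.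
  by apply: numeric_add; [exact: N1 ou|exact: N2 ov].
move=> _ _ /opt_mul[s1 [u1 [v1 [ou1 ov1 ->]]]] /opt_mul[s2 [u2 [v2 [ou2 ov2 ->]]]].
move: ov1 ov2; rewrite addbF addbT => ov1 ov2.
suff h : gpos (cls (u2 * y + x * v2 - u2 * v2) - cls (u1 * y + x * v1 - u1 * v1))%R.
  by case: ((lt_cls _ _).2 h).
(* Passing from [(u1, v1)] to [(u2, v2)] one coordinate at a time decomposes the difference in two
   ways. In each sign pattern one coordinate has both options on the same side; their order tells
   which decomposition has two summands of the right sign. *)
have E1 : (cls (u2 * y + x * v2 - u2 * v2) - cls (u1 * y + x * v1 - u1 * v1) =
  rect u1 u2 v1 y + rect u2 x v1 v2)%R by rewrite /rect !clsE; gring.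
have E2 : (cls (u2 * y + x * v2 - u2 * v2) - cls (u1 * y + x * v1 - u1 * v1) =
  rect u1 u2 v2 y + rect u1 x v1 v2)%R by rewrite /rect !clsE; gring.
have RN a b c d : rect a b c d = rect b a d c by rewrite /rect; gring.
have cases z z' : numeric z -> numeric z' -> z <= z' \/ z' < z.
  move=> nz nz'; case: (pselect (z <= z')) => [|nle]; first by left.
  by right; split=> //; apply: numeric_total.
case: s1 ou1 ov1 => ou1 ov1; case: s2 ou2 ov2 => /= ou2 ov2.
- have lv : v1 < v2 by apply: (sep true y).
  case: (cases u1 u2 (NX _ _ ou1) (NX _ _ ou2)) => h.
    rewrite E1; apply: gposDr; first exact: (Xle _ _ true _ _ _ ou1 ou2 h ov1).
    exact: (Ylt _ _ true _ _ _ ov1 ov2 lv ou2).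
  rewrite E2; apply: gposDl; last exact: (gposW (Ylt _ _ true _ _ _ ov1 ov2 lv ou1)).
  by rewrite RN; exact: (Xlt _ _ false _ _ _ ou2 ou1 h ov2).
- have lu : u1 < u2 by apply: (sep true x).
  case: (cases v1 v2 (NY _ _ ov1) (NY _ _ ov2)) => h.
    rewrite E2; apply: gposDl; first exact: (Xlt _ _ true _ _ _ ou1 ou2 lu ov2).
    exact: (Yle _ _ true _ _ _ ov1 ov2 h ou1).
  rewrite E1; apply: gposDl; first exact: (Xlt _ _ true _ _ _ ou1 ou2 lu ov1).
  by rewrite RN; exact: (gposW (Ylt _ _ false _ _ _ ov2 ov1 h ou2)).
- have lu : u2 < u1 by apply: (sep true x).
  case: (cases v2 v1 (NY _ _ ov2) (NY _ _ ov1)) => h.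
    rewrite E2; apply: gposDl; first by rewrite RN; exact: (Xlt _ _ false _ _ _ ou2 ou1 lu ov2).
    by rewrite RN; exact: (Yle _ _ false _ _ _ ov2 ov1 h ou1).
  rewrite E1; apply: gposDl; first by rewrite RN; exact: (Xlt _ _ false _ _ _ ou2 ou1 lu ov1).
  exact: (gposW (Ylt _ _ true _ _ _ ov1 ov2 h ou2)).
- have lv : v2 < v1 by apply: (sep true y).
  case: (cases u2 u1 (NX _ _ ou2) (NX _ _ ou1)) => h.
    rewrite E1; apply: gposDr; first by rewrite RN; exact: (Xle _ _ false _ _ _ ou2 ou1 h ov1).
    by rewrite RN; exact: (Ylt _ _ false _ _ _ ov2 ov1 lv ou2).
  rewrite E2; apply: gposDl; first exact: (Xlt _ _ true _ _ _ ou1 ou2 h ov2).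
  by rewrite RN; exact: (gposW (Ylt _ _ false _ _ _ ov2 ov1 lv ou1)).
Qed.

(** Once [x1 * v] and [x2 * v] are identified for options [v] of [y], each comparison with an option
    is the positivity of a rectangle between one of [x1], [x2] and an option of the other. *)
Lemma mul_le_step x1 x2 y : numeric x1 -> numeric x2 ->
  (forall b u, opt b x1 u -> mul_mono u x2 y /\ mul_mono x2 u y) ->
  (forall b u, opt b x2 u -> mul_mono u x1 y /\ mul_mono x1 u y) ->
  (forall b v, opt b y v -> mul_cong x1 x2 v) ->
  x1 == x2 -> x1 * y <= x2 * y.
Proof.
move=> n1 n2 H1 H2 H3 [le12 le21]; apply/le_opt; split.
- move=> _ /opt_mul[s [u [v [ou ov ->]]]]; rewrite addbF in ov.
  suff /(lt_cls _ _).2[] : gpos (cls (x2 * y) - cls (u * y + x1 * v - u * v))%R by [].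
  have [m1 m2] := H1 _ _ ou; have c := cls_eq (H3 _ _ ov (conj le12 le21)).
  have lt' := numeric_opt_lt n1 ou; case: s ou ov lt' => ou ov lt'.
    have [h _] := m1 (glt_le_trans lt' le12); have := h _ ov.
    by set a := rect _ _ _ _; suff -> : a = (cls (x2 * y) - cls (u * y + x1 * v - u * v))%R by []; rewrite /a /rect !clsE c; gring.
  have [_ h] := m2 (gle_lt_trans le21 lt'); have := h _ ov.
  by set a := rect _ _ _ _; suff -> : a = (cls (x2 * y) - cls (u * y + x1 * v - u * v))%R by []; rewrite /a /rect !clsE c; gring.
- move=> _ /opt_mul[s [u [v [ou ov ->]]]]; rewrite addbT in ov.
  suff /(lt_cls _ _).2[] : gpos (cls (u * y + x2 * v - u * v) - cls (x1 * y))%R by [].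
  have [m1 m2] := H2 _ _ ou; have c := cls_eq (H3 _ _ ov (conj le12 le21)).
  have lt' := numeric_opt_lt n2 ou; case: s ou ov lt' => ou ov lt'.
    have [_ h] := m1 (glt_le_trans lt' le21); have := h _ ov.
    by set a := rect _ _ _ _; suff -> : a = (cls (u * y + x2 * v - u * v) - cls (x1 * y))%R by []; rewrite /a /rect !clsE c; gring.
  have [h _] := m2 (gle_lt_trans le12 lt'); have := h _ ov.
  by set a := rect _ _ _ _; suff -> : a = (cls (u * y + x2 * v - u * v) - cls (x1 * y))%R by []; rewrite /a /rect !clsE c; gring.
Qed.

(** A rectangle with corner [(x, y)] is, up to sign, the difference of [x * y] and one of its
    options. *)
Lemma rect_opt b c x x' y y' : numeric (x * y) -> opt b x x' -> opt c y y' ->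
  gpos (if b then (if c then rect x' x y' y else rect x' x y y')
        else (if c then rect x x' y' y else rect x x' y y')).
Proof.
move=> n ox oy.
have o : opt (b (+) ~~ c) (x * y) (x' * y + x * y' - x' * y').
  by apply/opt_mul; exists b, x', y'; split=> //; move: oy; case: (b); case: (c).
have := numeric_opt_lt n o; case: b ox o; case: c oy => oy ox o /= /(lt_cls _ _).1 h; move: h;
by set p := (_ - _)%R; set a := rect _ _ _ _; suff -> : a = p by []; rewrite /a /p /rect !clsE; gring.
Qed.

(** A strict inequality has a witness among the left options of [x2] or the right options of [x1].
    Cutting the rectangle there leaves one part to the induction hypothesis and one to
    [rect_opt]. *)
Lemma mul_mono_step x1 x2 y : numeric (x1 * y) -> numeric (x2 * y) ->
  (forall u, opt true x2 u -> mul_mono x1 u y /\ mul_cong x1 u y) ->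
  (forall u, opt false x1 u -> mul_mono u x2 y /\ mul_cong u x2 y) ->
  (forall b u v, opt true x2 u -> opt b y v -> mul_cong x1 u v) ->
  (forall b u v, opt false x1 u -> opt b y v -> mul_cong u x2 v) ->
  mul_mono x1 x2 y.
Proof.
move=> n1 n2 H1 H2 C1 C2 [_ nle].
have key b y' : opt b y y' -> gpos (if b then rect x1 x2 y' y else rect x1 x2 y y').
  move=> oy; case: (not_le_ex nle) => -[u ou le'].
    have [m c] := H1 _ ou; have h1 := mul_mono_le c (C1 _ _ _ ou oy) m le' oy.
    have h2 := rect_opt n2 ou oy; case: b oy h1 h2 => oy h1 h2.
      suff -> : (rect x1 x2 y' y = rect x1 u y' y + rect u x2 y' y)%R by exact: gposDr.
      by rewrite /rect; gring.
    suff -> : (rect x1 x2 y y' = rect x1 u y y' + rect u x2 y y')%R by exact: gposDr.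
    by rewrite /rect; gring.
  have [m c] := H2 _ ou; have h1 := mul_mono_le c (C2 _ _ _ ou oy) m le' oy.
  have h2 := rect_opt n1 ou oy; case: b oy h1 h2 => oy h1 h2.
    suff -> : (rect x1 x2 y' y = rect x1 u y' y + rect u x2 y' y)%R by exact: gposDl.
    by rewrite /rect; gring.
  suff -> : (rect x1 x2 y y' = rect x1 u y y' + rect u x2 y y')%R by exact: gposDl.
  by rewrite /rect; gring.
by split=> y' oy; [exact: (key true)|exact: (key false)].
Qed.

(** Numericity of [x * y] uses the second claim at [[:: u; v; y]] for two options [u], [v] of [x],
    which is below [[:: x; y]]. The second claim at [[:: x1; x2; y]] uses numericity at a list from
    which one of the first two games is dropped. *)
Lemma mul_hydra (l : seq game) :
  (forall x y, Permutation l [:: x; y] -> numeric x -> numeric y -> numeric (x * y)) /\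
  (forall x1 x2 y, Permutation l [:: x1; x2; y] -> numeric x1 -> numeric x2 -> numeric y ->
     mul_cong x1 x2 y /\ mul_mono x1 x2 y).
Proof.
elim/hydra_ind: l => l IH.
have IH2 x y : hydra [:: x; y] l -> numeric x -> numeric y -> numeric (x * y).
  by move=> h; apply: (IH _ h).1; exact: Permutation_refl.
have IH3 x1 x2 y : hydra [:: x1; x2; y] l -> numeric x1 -> numeric x2 -> numeric y ->
     mul_cong x1 x2 y /\ mul_mono x1 x2 y.
  by move=> h; apply: (IH _ h).2; exact: Permutation_refl.
clear IH; have num := numeric_opt_num.
split.
  move=> x y p nx ny.
  have q : Permutation [:: x; y] l by exact: Permutation_sym.
  have q' : Permutation [:: y; x] l by apply: Permutation_trans (perm_swap _ _ _) q.
  apply: numeric_mul_step => //.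
  - move=> b x' ox; apply: IH2 => //; last exact: num ox.
    by apply: hydra_permr q _; exact: hydra_one ox.
  - move=> b y' oy; apply: IH2 => //; last exact: num oy.
    by apply: hydra_perml (perm_swap _ _ _) _; apply: hydra_permr q' _; exact: hydra_one oy.
  - move=> b c x' y' ox oy; apply: IH2; [|exact: num ox|exact: num oy].
    apply: hydra_permr q _; apply: Relation_Operators.t_trans (hydra_one _ ox).
    apply: hydra_perml (perm_swap _ _ _) _; apply: hydra_permr (perm_swap _ _ _) _; exact: hydra_one oy.
  - move=> b c u v ou ov; apply: IH3 => //; [|exact: num ou|exact: num ov].
    by apply: hydra_permr q _; exact: hydra_two ou ov.
  - move=> b c d u v w ou ov ow.
    apply: (proj1 (IH3 u v w _ _ _ _)); [|exact: num ou|exact: num ov|exact: num ow].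
    apply: hydra_permr q _; apply: Relation_Operators.t_trans (hydra_two _ ou ov).
    apply: (@hydra_perml [:: w; u; v]); first exact: (Permutation_cons_append [:: u; v] w).
    apply: (@hydra_permr [:: y; u; v]); first exact: (Permutation_cons_append [:: u; v] y).
    exact: hydra_one ow.
  - move=> b c u v ou ov; apply: IH3 => //; [|exact: num ou|exact: num ov].
    by apply: hydra_permr q' _; exact: hydra_two ou ov.
  - move=> b c d u v w ou ov ow.
    apply: (proj1 (IH3 u v w _ _ _ _)); [|exact: num ou|exact: num ov|exact: num ow].
    apply: hydra_permr q' _; apply: Relation_Operators.t_trans (hydra_two _ ou ov).
    apply: (@hydra_perml [:: w; u; v]); first exact: (Permutation_cons_append [:: u; v] w).
    apply: (@hydra_permr [:: x; u; v]); first exact: (Permutation_cons_append [:: u; v] x).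
    exact: hydra_one ow.
move=> x1 x2 y p n1 n2 ny.
have q12 : Permutation [:: x1; x2; y] l by exact: Permutation_sym.
have q21 : Permutation [:: x2; x1; y] l by apply: Permutation_trans (perm_swap _ _ _) q12.
have qy : Permutation [:: y; x1; x2] l.
  by apply: Permutation_trans q12; exact: (Permutation_cons_append [:: x1; x2] y).
have A1 b u : opt b x1 u -> hydra [:: u; x2; y] l.
  by move=> ou; apply: hydra_permr q12 _; exact: hydra_one ou.
have A2 b u : opt b x2 u -> hydra [:: u; x1; y] l.
  by move=> ou; apply: hydra_permr q21 _; exact: hydra_one ou.
have Ay b u : opt b y u -> hydra [:: x1; x2; u] l.
  move=> ou; apply: hydra_permr qy _; apply: hydra_perml (hydra_one _ ou).
  exact: (Permutation_cons_append [:: x1; x2] u).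
have A1y b c u v : opt b x1 u -> opt c y v -> hydra [:: u; x2; v] l.
  move=> ou ov; apply: Relation_Operators.t_trans (A1 _ _ ou).
  apply: hydra_perml (Permutation_cons_append [:: u; x2] v) _.
  apply: hydra_permr (Permutation_cons_append [:: u; x2] y) _; exact: hydra_one ov.
have A2y b c u v : opt b x2 u -> opt c y v -> hydra [:: x1; u; v] l.
  move=> ou ov; apply: hydra_perml (perm_swap _ _ _) _; apply: Relation_Operators.t_trans (A2 _ _ ou).
  apply: hydra_perml (Permutation_cons_append [:: u; x1] v) _.
  apply: hydra_permr (Permutation_cons_append [:: u; x1] y) _; exact: hydra_one ov.
have S a b c : hydra [:: a; b; c] l -> hydra [:: b; a; c] l.
  by apply: hydra_perml; exact: perm_swap.
split.
  move=> e.
  have M1 b u : opt b x1 u -> mul_mono u x2 y /\ mul_mono x2 u y.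
    by move=> ou; have nu := num _ _ _ n1 ou; split;
      [apply: (proj2 (IH3 _ _ _ (A1 _ _ ou) _ _ _))|apply: (proj2 (IH3 _ _ _ (S _ _ _ (A1 _ _ ou)) _ _ _))].
  have M2 b u : opt b x2 u -> mul_mono u x1 y /\ mul_mono x1 u y.
    by move=> ou; have nu := num _ _ _ n2 ou; split;
      [apply: (proj2 (IH3 _ _ _ (A2 _ _ ou) _ _ _))|apply: (proj2 (IH3 _ _ _ (S _ _ _ (A2 _ _ ou)) _ _ _))].
  have C1 b v : opt b y v -> mul_cong x1 x2 v.
    by move=> ov; apply: (proj1 (IH3 _ _ _ (Ay _ _ ov) _ _ _)) => //; exact: num ov.
  have C2 b v : opt b y v -> mul_cong x2 x1 v.
    by move=> ov /eqg_sym e'; apply: eqg_sym; exact: C1 ov e'.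
  by split; [apply: mul_le_step|apply: mul_le_step => //; exact: eqg_sym].
apply: mul_mono_step.
- apply: IH2 => //; apply: hydra_permr q21 _; exact: hydra_drop.
- apply: IH2 => //; apply: hydra_permr q12 _; exact: hydra_drop.
- by move=> u ou; case: (IH3 _ _ _ (S _ _ _ (A2 _ _ ou)) n1 (num _ _ _ n2 ou) ny).
- by move=> u ou; case: (IH3 _ _ _ (A1 _ _ ou) (num _ _ _ n1 ou) n2 ny).
- by move=> b u v ou ov; case: (IH3 _ _ _ (A2y _ _ _ _ ou ov) n1 (num _ _ _ n2 ou) (num _ _ _ ny ov)).
- by move=> b u v ou ov; case: (IH3 _ _ _ (A1y _ _ _ _ ou ov) (num _ _ _ n1 ou) n2 (num _ _ _ ny ov)).
Qed.

Lemma numeric_mul x y : numeric x -> numeric y -> numeric (x * y).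
Proof. exact: (mul_hydra [:: x; y]).1 (Permutation_refl _). Qed.

Lemma eqg_mul2r x1 x2 y : numeric x1 -> numeric x2 -> numeric y -> x1 == x2 -> x1 * y == x2 * y.
Proof. by move=> n1 n2 ny; exact: ((mul_hydra [:: x1; x2; y]).2 _ _ _ (Permutation_refl _) n1 n2 ny).1. Qed.

Lemma eqg_mul x1 x2 y1 y2 : numeric x1 -> numeric x2 -> numeric y1 -> numeric y2 ->
  x1 == x2 -> y1 == y2 -> x1 * y1 == x2 * y2.
Proof.
move=> *; apply: (@eqg_trans _ (x2 * y1)); first exact: eqg_mul2r.
apply: eqg_trans (mulgC _ _) _; apply: eqg_trans _ (mulgC _ _); exact: eqg_mul2r.
Qed.

(** An option of [y1] or [y2] lies weakly between them: the part of the rectangle next to its parent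
    is positive by [mul_mono], the other part by induction. *)
Lemma rect_pos x1 x2 y1 y2 : numeric x1 -> numeric x2 -> numeric y1 -> numeric y2 ->
  x1 < x2 -> y1 < y2 -> gpos (rect x1 x2 y1 y2).
Proof.
move=> n1 n2 + + lt12; have M y : numeric y -> mul_mono x1 x2 y.
  by move=> ny; exact: ((mul_hydra [:: x1; x2; y]).2 _ _ _ (Permutation_refl _) n1 n2 ny).2.
have Z u v : numeric u -> numeric v -> u == v -> rect x1 x2 u v = 0%R.
  move=> nu nv e; rewrite /rect (@cls_eq (x1 * u) (x1 * v)); last exact: eqg_mul.
  by rewrite (@cls_eq (x2 * u) (x2 * v)); [gring|exact: eqg_mul].
elim/opt_ind: y1 y2 => y1 IH1; elim/opt_ind=> y2 IH2 m1 m2 [_ nle].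
have D u : (rect x1 x2 y1 y2 = rect x1 x2 y1 u + rect x1 x2 u y2)%R by rewrite /rect; gring.
case: (not_le_ex nle) => -[u ou le']; rewrite (D u).
  have nu := numeric_opt_num m2 ou; have [h _] := M _ m2 lt12; apply: gposDr; last exact: h.
  case: (pselect (u <= y1)) => [le''|nle']; first by rewrite Z //; exact: gnneg0.
  by apply: gposW; apply: IH2 ou m1 nu _.
have nu := numeric_opt_num m1 ou; have [_ h] := M _ m1 lt12; apply: gposDl; first exact: h.
case: (pselect (y2 <= u)) => [le''|nle']; first by rewrite Z //; exact: gnneg0.
by apply: gposW; apply: IH1 ou _ nu m2 _.
Qed.

Lemma mul_gt0 x y : numeric x -> numeric y -> zero < x -> zero < y -> zero < x * y.
Proof.
move=> nx ny h1 h2; have := rect_pos numeric_zero nx numeric_zero ny h1 h2.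
rewrite /rect !(cls_eq (mulg0 _)) (cls_eq (eqg_trans (mulgC _ _) (mulg0 _))) => h.
apply: (lt_cls _ _).2; move: h; rewrite cls0.
by set a := (_ - _)%R; set b := (_ - _)%R; suff -> : a = b by []; rewrite /a /b; gring.
Qed.

(** * The ordered field of surreal numbers *)

(** Passing to classes turns [==] into Leibniz equality, which the algebraic structures require. *)
Record No := MkNo {No_cls : gclass; _ : exists2 x, numeric x & No_cls = cls x}.

Definition mkNo (x : game) (nx : numeric x) : No :=
  MkNo (ex_intro2 (fun y => numeric y) (fun y => cls x = cls y) x nx erefl).

(* [zero] if [x] is not a number. *)
Definition No_of (x : game) : No :=
  match pselect (numeric x) with
  | left nx => mkNo nx
  | right _ => mkNo numeric_zero
  end.

Lemma No_cls_of x : numeric x -> No_cls (No_of x) = cls x.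
Proof. by rewrite /No_of; case: pselect. Qed.

Lemma No_cls_inj : injective No_cls.
Proof. by move=> [u p] [v q] /= e; subst v; congr MkNo; exact: Prop_irrelevance. Qed.

Lemma nval_ex (u : No) : exists x, numeric x /\ No_of x = u.
Proof.
by case: u => u p; have [x nx e] := p; exists x; split=> //; apply: No_cls_inj; rewrite No_cls_of.
Qed.

Definition nval (u : No) : game := sval (cid (nval_ex u)).

Lemma nval_numeric u : numeric (nval u).
Proof. by rewrite /nval; case: cid => x []. Qed.

Lemma nvalK u : No_of (nval u) = u.
Proof. by rewrite /nval; case: cid => x []. Qed.

Lemma No_ofP x y : numeric x -> numeric y -> No_of x = No_of y <-> x == y.
Proof.
move=> nx ny; split=> [/(congr1 No_cls)|e]; first by rewrite !No_cls_of // => /clsP.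
by apply: No_cls_inj; rewrite !No_cls_of //; apply/clsP.
Qed.

Lemma No_of_eq x y : numeric x -> numeric y -> x == y -> No_of x = No_of y.
Proof. by move=> nx ny /No_ofP; apply. Qed.

Lemma No_ofK x : numeric x -> nval (No_of x) == x.
Proof. by move=> nx; apply/No_ofP => //; [exact: nval_numeric|rewrite nvalK]. Qed.

HB.instance Definition _ := gen_eqMixin No.
HB.instance Definition _ := gen_choiceMixin No.

Ltac numeric := by repeat first
  [ assumption | apply: nval_numeric | apply: numeric_zero | apply: numeric_nat
  | apply: numeric_add | apply: numeric_opp | apply: numeric_mul ].

Definition No_add u v := No_of (nval u + nval v).
Definition No_opp u := No_of (- nval u).
Definition No_mul u v := No_of (nval u * nval v).

Lemma No_addE x y : numeric x -> numeric y -> No_add (No_of x) (No_of y) = No_of (x + y).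
Proof. by move=> nx ny; apply: No_of_eq; [numeric|numeric|apply: eqg_add; exact: No_ofK]. Qed.

Lemma No_mulE x y : numeric x -> numeric y -> No_mul (No_of x) (No_of y) = No_of (x * y).
Proof.
move=> nx ny; apply: No_of_eq; [numeric|numeric|apply: eqg_mul]; try numeric; exact: No_ofK.
Qed.

Fact No_addA : associative No_add.
Proof.
move=> u v w; rewrite -[u]nvalK -[v]nvalK -[w]nvalK !No_addE; try numeric.
by apply: No_of_eq; [numeric|numeric|exact: addgA].
Qed.
Fact No_addC : commutative No_add.
Proof. by move=> u v; apply: No_of_eq; [numeric|numeric|exact: addgC]. Qed.
Fact No_add0 : left_id (No_of zero) No_add.
Proof.
move=> u; rewrite No_addC -[u]nvalK No_addE; try numeric.
by apply: No_of_eq; [numeric|numeric|exact: addg0].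
Qed.
Fact No_addN : left_inverse (No_of zero) No_opp No_add.
Proof.
move=> u; rewrite No_addC -[u]nvalK /No_opp No_addE; try numeric.
apply: No_of_eq; [numeric|numeric|apply: eqg_trans (addgN (nval u))].
by apply: eqg_add; [exact: eqg_refl|apply: eqg_opp; apply: No_ofK; numeric].
Qed.
HB.instance Definition _ := GRing.isZmodule.Build No No_addA No_addC No_add0 No_addN.

Fact No_mulA : associative No_mul.
Proof.
move=> u v w; rewrite -[u]nvalK -[v]nvalK -[w]nvalK !No_mulE; try numeric.
by apply: No_of_eq; [numeric|numeric|exact: mulgA].
Qed.
Fact No_mulC : commutative No_mul.
Proof. by move=> u v; apply: No_of_eq; [numeric|numeric|exact: mulgC]. Qed.
Fact No_mul1 : left_id (No_of one) No_mul.
Proof.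
move=> u; rewrite No_mulC -[u]nvalK No_mulE; try numeric.
by apply: No_of_eq; [numeric|numeric|exact: mulg1].
Qed.
Fact No_mulD : left_distributive No_mul No_add.
Proof.
move=> u v w; rewrite -[u]nvalK -[v]nvalK -[w]nvalK !(No_addE, No_mulE); try numeric.
by apply: No_of_eq; [numeric|numeric|exact: mulgDl].
Qed.
Lemma glt01 : zero < one.
Proof. by apply: (numeric_opt_lt (b := true)); [numeric|apply/opt_natS]. Qed.
Fact No_1neq0 : No_of one != No_of zero.
Proof.
by apply/eqP => /No_ofP e; have [e1 _] := e (numeric_nat 1) numeric_zero; case: glt01.
Qed.
HB.instance Definition _ := GRing.Zmodule_isComNzRing.Build No
  No_mulA No_mulC No_mul1 No_mulD No_1neq0.

(** Inverses are constructed only after the order, on which the sign analysis of Conway's formula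
    relies; until then a unit is whatever happens to have an inverse. *)
Definition No_unit : pred No := fun u => `[< exists v, (v * u = 1)%R >].
Definition No_inv (u : No) : No :=
  match pselect (exists v, (v * u = 1)%R) with
  | left h => sval (cid h)
  | right _ => u
  end.
Fact No_mulV : {in No_unit, left_inverse 1%R No_inv *%R}.
Proof. by move=> u /asboolP h; rewrite /No_inv; case: pselect => // h'; case: cid. Qed.
Fact No_unitP (u v : No) : (v * u = 1)%R -> No_unit u.
Proof. by move=> e; apply/asboolP; exists v. Qed.
Fact No_inv_out : {in [predC No_unit], No_inv =1 id}.
Proof. by move=> u /asboolP h; rewrite /No_inv; case: pselect. Qed.
HB.instance Definition _ := GRing.ComNzRing_hasMulInverse.Build No
  No_mulV No_unitP No_inv_out.

Definition No_lt (u v : No) : bool := `[< nval u < nval v >].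
Definition No_le (u v : No) : bool := (u == v)%bool || No_lt u v.
Definition No_norm (u : No) : No := if No_le (0%R) u then u else (- u)%R.

Lemma No_of0 : No_of zero = 0%R. Proof. by []. Qed.
Lemma No_of1 : No_of one = 1%R. Proof. by []. Qed.
Lemma No_ofD x y : numeric x -> numeric y -> No_of (x + y) = (No_of x + No_of y)%R.
Proof. by move=> *; rewrite -No_addE. Qed.
Lemma No_ofN x : numeric x -> No_of (- x) = (- No_of x)%R.
Proof. by move=> nx; apply: No_of_eq; [numeric|numeric|apply: eqg_opp; apply: eqg_sym; exact: No_ofK]. Qed.
Lemma No_ofM x y : numeric x -> numeric y -> No_of (x * y) = (No_of x * No_of y)%R.
Proof. by move=> *; rewrite -No_mulE. Qed.

Lemma eqg_lt x x' y y' : x == x' -> y == y' -> x < y -> x' < y'.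
Proof. by move=> [_ e1] [e2 _] h; apply: glt_le_trans e2; exact: gle_lt_trans h. Qed.

Lemma No_ltP x y : numeric x -> numeric y -> reflect (x < y) (No_lt (No_of x) (No_of y)).
Proof.
move=> nx ny; rewrite /No_lt; apply: (iffP (asboolP _)); apply: eqg_lt;
  by [exact: No_ofK | apply: eqg_sym; exact: No_ofK].
Qed.

Lemma game_trichotomy x y : numeric x -> numeric y -> [\/ x == y, x < y | y < x].
Proof.
move=> nx ny; case: (pselect (x <= y)) => h1; case: (pselect (y <= x)) => h2.
- by constructor 1.
- by constructor 2.
- by constructor 3.
- by constructor 2; split=> //; exact: numeric_total.
Qed.

Lemma lt_sub0 x y : zero < y - x <-> x < y.
Proof.
split=> /(lt_cls _ _).1 h; apply: (lt_cls _ _).2; move: h; rewrite !clsE;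
by rewrite ?subr0.
Qed.

Lemma ltg_add x y : zero < x -> zero < y -> zero < x + y.
Proof.
move=> /(lt_cls _ _).1 h1 /(lt_cls _ _).1 h2; apply: (lt_cls _ _).2; rewrite clsE.
have -> : (cls x + cls y - cls zero = (cls x - cls zero) + (cls y - cls zero))%R.
  by rewrite cls0; gring.
by apply: gposDl => //; exact: gposW.
Qed.

Fact No_lt0D (u v : No) : No_lt 0%R u -> No_lt 0%R v -> No_lt 0%R (u + v)%R.
Proof.
rewrite -[u]nvalK -[v]nvalK -No_of0 -No_ofD; try numeric.
by do 2![move=> /No_ltP-/(_ numeric_zero (nval_numeric _)) ?]; apply/No_ltP; [numeric|numeric|exact: ltg_add].
Qed.
Fact No_lt0M (u v : No) : No_lt 0%R u -> No_lt 0%R v -> No_lt 0%R (u * v)%R.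
Proof.
rewrite -[u]nvalK -[v]nvalK -No_of0 -No_ofM; try numeric.
by do 2![move=> /No_ltP-/(_ numeric_zero (nval_numeric _)) ?]; apply/No_ltP; [numeric|numeric|apply: mul_gt0; try numeric].
Qed.
Fact No_lt0_ngt0 (u : No) : No_lt 0%R u -> ~~ No_lt u 0%R.
Proof. by move=> /asboolP[h1 h2]; apply/asboolP => -[h3 h4]. Qed.
Fact No_sub_gt0 (u v : No) : No_lt 0%R (v - u)%R = No_lt u v.
Proof.
rewrite -[u]nvalK -[v]nvalK -No_of0 -No_ofN -?No_ofD; try numeric.
by apply/No_ltP/No_ltP; try numeric; move/lt_sub0.
Qed.
Fact No_lt_total (u v : No) : u != v -> No_lt u v || No_lt v u.
Proof.
move=> ne; case: (game_trichotomy (nval_numeric u) (nval_numeric v)) => h.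
- by case/eqP: ne; rewrite -[u]nvalK -[v]nvalK; apply: No_of_eq => //; numeric.
- by apply/orP; left; apply/asboolP.
- by apply/orP; right; apply/asboolP.
Qed.
Fact No_lt0_total (u : No) : u != 0%R -> No_lt 0%R u || No_lt u 0%R.
Proof. by rewrite eq_sym; exact: No_lt_total. Qed.
Fact No_integral (u v : No) : (u * v = 0)%R -> (u == 0%R) || (v == 0%R).
Proof.
have P (a b : No) : No_lt 0%R a -> No_lt 0%R b -> (a * b = 0)%R -> False.
  by move=> ha hb e; have := No_lt0M ha hb; rewrite e => /asboolP[_]; apply; exact: gle_refl.
have N (a : No) : No_lt a 0%R -> No_lt 0%R (- a)%R by rewrite -No_sub_gt0 sub0r.
move=> e; apply/norP => -[/No_lt0_total/orP[]hu /No_lt0_total/orP[]hv].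
- exact: P e.
- by apply: (P _ _ hu (N _ hv)); rewrite mulrN e oppr0.
- by apply: (P _ _ (N _ hu) hv); rewrite mulNr e oppr0.
- by apply: (P _ _ (N _ hu) (N _ hv)); rewrite mulrNN.
Qed.
HB.instance Definition _ := GRing.ComUnitRing_isIntegral.Build No No_integral.

Fact No_normN (u : No) : No_norm (- u)%R = No_norm u.
Proof.
case: (eqVneq u 0%R) => [->|ne]; first by rewrite oppr0.
rewrite /No_norm /No_le.
have ne' : ((0%R : No) == (- u)%R)%bool = false by rewrite eq_sym oppr_eq0 (negbTE ne).
have e : No_lt 0%R (- u)%R = No_lt u 0%R by rewrite -sub0r No_sub_gt0.
rewrite ne' e eq_sym (negbTE ne) /= opprK.
case: (boolP (No_lt u 0%R)) => h; last by have := No_lt0_total ne; rewrite (negbTE h) orbF => ->.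
by case: (boolP (No_lt 0%R u)) => // h'; have := No_lt0_ngt0 h'; rewrite h.
Qed.
Fact No_ge0_norm (u : No) : No_le 0%R u -> No_norm u = u.
Proof. by rewrite /No_norm => ->. Qed.
HB.instance Definition _ := Num.IntegralDomain_isLtReal.Build No
  No_lt0D No_lt0M No_lt0_ngt0 No_sub_gt0 No_lt0_total No_normN No_ge0_norm
  (fun _ _ => erefl).

Lemma ltNoP x y : numeric x -> numeric y -> reflect (x < y) (No_of x < No_of y)%R.
Proof. exact: No_ltP. Qed.

Lemma leNoP x y : numeric x -> numeric y -> reflect (x <= y) (No_of x <= No_of y)%R.
Proof.
move=> nx ny; apply: (iffP idP).
  rewrite le_eqVlt => /orP[/eqP/No_ofP|/ltNoP h]; first by case/(_ nx ny).
  by case: (h nx ny).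
move=> h; rewrite leNgt; apply/negP => /ltNoP-/(_ ny nx)[_]; exact.
Qed.

(** * Inverses of positive numbers *)

Section Inverse.

Variables (XL XR : small) (xl : XL -> game) (xr : XR -> game).
Let x := Game XL XR xl xr.
Hypotheses (nx : numeric x) (x_gt0 : zero < x).
Hypothesis opt_inv : forall b x', opt b x x' -> zero < x' ->
  exists z, numeric z /\ x' * z == one.

Let I : small := ({i : XL | zero < xl i} + XR)%type.
Let side (t : I) : bool := if t is inl _ then true else false.
Let xo (t : I) : game := match t with inl (exist i _) => xl i | inr j => xr j end.

Let xo_opt t : opt (side t) x (xo t).
Proof. by case: t => [[i p]|j]; [exists i|exists j]. Qed.
Let xo_num t : numeric (xo t). Proof. exact: numeric_opt_num (xo_opt t). Qed.
Let xo_gt0 t : zero < xo t.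
Proof.
case: t => [[i h]|j] //=; apply: glt_trans x_gt0 _.
by apply: (numeric_opt_lt (b := false) nx); exists j.
Qed.
Let inv_xo t : numeric (inv (xo t)) /\ xo t * inv (xo t) == one.
Proof. exact: (ClassicalEpsilon.epsilon_spec _ _ (opt_inv (xo_opt t) (xo_gt0 t))). Qed.

(* Conway's recursive formula for the inverse of [x] produces from an option [y']
   of it the option [(1 + (x' - x) y') / x'] for each positive option [x'] of [x];
   a list of options of [x] records how an option of the inverse is obtained
   from [zero]. *)
Let yv (l : seq I) : game := foldr (fun t y => (one + (xo t - x) * y) * inv (xo t)) zero l.
Let ys (l : seq I) : bool := foldr (fun t b => if side t then ~~ b else b) true l.
Let y : game := Game {l | ys l} {l | ~~ ys l} (fun l => yv (sval l)) (fun l => yv (sval l)).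
(** A form of [x] whose left options are [zero] and the positive left options of [x]. Every option
    of [xp * y] then comes from [zero] or from an option by which the recursive formula divides. *)
Let xp : game := Game (option {i : XL | zero < xl i}) XR
  (fun o => if o is Some i then xl (sval i) else zero) xr.

Let yv_cons t l : yv (t :: l) = (one + (xo t - x) * yv l) * inv (xo t).
Proof. by []. Qed.

Let yv_num l : numeric (yv l).
Proof.
elim: l => [|t l IH]; first exact: numeric_zero.
by have [h _] := inv_xo t; have nt := xo_num t; rewrite yv_cons; numeric.
Qed.

Let X : No := No_of x.
Let Xo t : No := No_of (xo t).
Let V l : No := No_of (yv l).

Let X_gt0 : (0 < X)%R. Proof. by apply/ltNoP => //; exact: numeric_zero. Qed.
Let Xo_gt0 t : (0 < Xo t)%R.
Proof. by apply/ltNoP => //; exact: numeric_zero. Qed.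
Let Xo_side t : if side t then (Xo t < X)%R else (X < Xo t)%R.
Proof.
by have := numeric_opt_lt nx (xo_opt t); case: (side t) => h; apply/ltNoP.
Qed.
Let V_cons t l : (Xo t * V (t :: l) = 1 + (Xo t - X) * V l)%R.
Proof.
have [h e] := inv_xo t; have nt := xo_num t; have nl := yv_num l.
rewrite /V yv_cons !(No_ofD, No_ofM, No_ofN); try numeric.
have : (Xo t * No_of (inv (xo t)) = 1)%R by rewrite -No_ofM //; apply: No_of_eq => //; numeric.
by rewrite -/X -/(Xo t) -/(V l); set z := No_of _ => e'; rewrite mulrCA e' mulr1.
Qed.

(** The recursion multiplies the error [1 - X * V l] by [(Xo t - X) / Xo t], which is negative
    exactly when [xo t] is a left option; [ys] keeps track of these sign changes. *)
Let V_side l : if ys l then (X * V l < 1)%R else (1 < X * V l)%R.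
Proof.
elim: l => [|t l IH] /=; first by rewrite /V /= No_of0 mulr0 ltr01.
have e := V_cons t l; have := Xo_side t; have h := Xo_gt0 t.
have E : (Xo t * (1 - X * V (t :: l)) = (Xo t - X) * (1 - X * V l))%R.
  have -> : (Xo t * (1 - X * V (t :: l)) = Xo t - X * (Xo t * V (t :: l)))%R by ring.
  by rewrite e; ring.
case: (side t) => hx; case: (ys l) IH => /= IH.
- have : (Xo t * (1 - X * V (t :: l)) < 0)%R by rewrite E; nra.
  by rewrite pmulr_rlt0 // subr_lt0.
- have : (0 < Xo t * (1 - X * V (t :: l)))%R by rewrite E; nra.
  by rewrite pmulr_rgt0 // subr_gt0.
- have : (0 < Xo t * (1 - X * V (t :: l)))%R by rewrite E; nra.
  by rewrite pmulr_rgt0 // subr_gt0.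
- have : (Xo t * (1 - X * V (t :: l)) < 0)%R by rewrite E; nra.
  by rewrite pmulr_rlt0 // subr_lt0.
Qed.

Let y_opt b z : opt b y z -> exists2 l, z = yv l & ys l = b.
Proof. by case: b => -[[l h] ->]; exists l => //; apply: negbTE. Qed.
Let opt_y l : opt (ys l) y (yv l).
Proof. by case e : (ys l); [exists (exist _ l e)|exists (exist _ l (negbT e))]. Qed.

Let y_num : numeric y.
Proof.
apply/numeric_opt; split; last by move=> b z /y_opt[l -> _].
move=> _ _ /y_opt[l1 -> h1] /y_opt[l2 -> h2] /(leNoP (yv_num _) (yv_num _)).
have := V_side l1; have := V_side l2; rewrite h1 h2 => h3 h4.
rewrite leNgt => /negP; apply; rewrite -(ltr_pM2l X_gt0); exact: (lt_trans h4 h3).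
Qed.

Let xp_opt b z : opt b xp z -> (b /\ z = zero) \/ exists2 t, z = xo t & side t = b.
Proof.
case: b => -[].
  by case=> [[i h]|] ->; [right; exists (inl (exist _ i h))|left].
by move=> j ->; right; exists (inr j).
Qed.
Let opt_xp t : opt (side t) xp (xo t).
Proof. by case: t => [[i h]|j]; [exists (Some (exist _ i h))|exists j]. Qed.

Let xp_num : numeric xp.
Proof.
apply: (@numeric_between _ x) => b z /xp_opt[[-> ->]|[t -> <-]].
  by split=> //; exact: numeric_zero.
by split=> //; exact: numeric_opt_lt (xo_opt t).
Qed.

Let xp_eq : xp == x.
Proof.
split; apply/le_opt; split=> z.
- move=> /xp_opt[[_ ->]|[t -> h] le']; first by case: x_gt0.
  by have := opt_not_le (xo_opt t); rewrite h.
- move=> [j ->]; apply: (@opt_not_le false xp); exact: (opt_xp (inr j)).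
- move=> [i ->] le'; have h : zero < xl i.
    apply: glt_le_trans le'; apply: (numeric_opt_lt (b := true) xp_num); by exists None.
  exact: (opt_not_le (opt_xp (inl (exist _ i h))) le').
- move=> /xp_opt[[]//|[t -> h] le'].
  by have := opt_not_le (xo_opt t); rewrite h.
Qed.

Lemma inverse_exists_step : exists z, numeric z /\ x * z == one.
Proof.
exists y; split; first exact: y_num.
have ny := y_num; have np := xp_num; have nz := numeric_zero.
apply: (@eqg_trans _ (xp * y)); first by apply: eqg_mul => //; exact: eqg_sym xp_eq.
have eX : No_of xp = X by exact: No_of_eq xp_eq.
have side_opt b z : opt b (xp * y) z -> if b then (No_of z < 1)%R else (1 < No_of z)%R.
  move=> /opt_mul[s [u [v [/xp_opt ou /y_opt[l -> hl] ->]]]].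
  have nl := yv_num l.
  case: ou => [[hs ->]|[t -> hs]].
    rewrite !(No_ofD, No_ofM, No_ofN) ?No_of0 ?eX; try numeric.
    rewrite !mul0r add0r subr0 -/(V l); have := V_side l; rewrite hl.
    by case: (s) hs => // _; case: (b).
  have nt := xo_num t; rewrite !(No_ofD, No_ofM, No_ofN) ?eX; try numeric.
  rewrite -/(V l) -/(Xo t).
  (* The formula for the inverse is made for this: the option of the product at [(xo t, yv l)]
     differs from 1 by a positive multiple of the distance from [y] to its own option
     [yv (t :: l)]. *)
  have -> : (Xo t * No_of y + X * V l - Xo t * V l = 1 + Xo t * (No_of y - V (t :: l)))%R.
    by rewrite mulrBr V_cons; ring.
  have := numeric_opt_lt ny (opt_y (t :: l)); rewrite /= hs hl.
  have h := Xo_gt0 t; case: (s); case: (b) => /= /(ltNoP _ _) h';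
  rewrite ?gtrDl ?ltrDl ?pmulr_rlt0 ?pmulr_rgt0 ?subr_lt0 ?subr_gt0 //; apply: h' => //; exact: (yv_num (t :: l)).
have nzz : numeric (xp * y) by numeric.
have onum b z : opt b (xp * y) z -> numeric z by exact: numeric_opt_num.
split; apply/le_opt; split.
- move=> z oz; have := side_opt _ _ oz; rewrite -No_of1 => /ltNoP h.
  by case: (h (onum _ _ oz) (numeric_nat 1)).
- by move=> z /opt_natS[].
- move=> _ /opt_natS[_ ->] /leNoP-/(_ nzz nz); rewrite leNgt => /negP; apply.
  (* The added left option [zero] of [xp] and the left option [zero] of [y] produce a left option of
     value 0. It makes the product positive, as the only option of [one] demands. *)
  have o : opt true (xp * y) (zero * y + xp * zero - zero * zero).
    by apply/opt_mul; exists true, zero, zero; split=> //; [exists None|exact: (opt_y [::])].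
  have /ltNoP-/(_ (onum _ _ o) nzz) := numeric_opt_lt nzz o.
  suff -> : No_of (zero * y + xp * zero - zero * zero) = 0%R by [].
  rewrite !(No_ofD, No_ofM, No_ofN); try numeric.
  by rewrite No_of0 !mul0r mulr0 add0r subr0.
- move=> z oz; have := side_opt _ _ oz; rewrite -No_of1 => /ltNoP h.
  by case: (h (numeric_nat 1) (onum _ _ oz)).
Qed.

End Inverse.

Lemma inverse_exists x : numeric x -> zero < x -> exists z, numeric z /\ x * z == one.
Proof.
elim/opt_ind: x => -[XL XR xl xr] IH nx x_gt0.
apply: inverse_exists_step => // b x' ox; exact: IH ox (numeric_opt_num nx ox).
Qed.

Fact No_fieldP : GRing.field_axiom No.
Proof.
have pos (u : No) : (0 < u)%R -> u \in GRing.unit.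
  rewrite -[u]nvalK => /ltNoP-/(_ numeric_zero (nval_numeric _)).
  move=> /(inverse_exists (nval_numeric u))[z [nz e]].
  by apply/unitrPr; exists (No_of z); rewrite -No_ofM; [apply: No_of_eq => //|..]; numeric.
move=> u; case: (ltgtP u 0%R) => // h _; last exact: pos.
by rewrite -unitrN; apply: pos; rewrite oppr_gt0.
Qed.
HB.instance Definition _ := GRing.UnitRing_isField.Build No No_fieldP.

Lemma inv_spec x : numeric x -> (No_of x != 0)%R ->
  numeric (inv x) /\ No_of (inv x) = (No_of x)^-1%R.
Proof.
move=> nx ne; have H : exists z, numeric z /\ x * z == one.
  exists (nval (No_of x)^-1)%R; split; first exact: nval_numeric.
  by apply/No_ofP; [numeric|numeric|rewrite No_ofM ?nvalK ?divff //; numeric].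
have [nz e] : numeric (inv x) /\ x * inv x == one by exact: (ClassicalEpsilon.epsilon_spec _ _ H).
split=> //; apply: (mulfI ne); rewrite divff // -No_ofM //.
by apply: No_of_eq => //; numeric.
Qed.

(** * Truncations of the exponential series *)

Section ExpTrunc.
Local Open Scope ring_scope.

(** The product [(d + 1) ... (d + m)] grows with [d]. *)
Lemma fact_unbalance (a d m : nat) : (d <= a)%N -> (a`! * (d + m)`! <= (a + m)`! * d`!)%N.
Proof.
move=> le_da; elim: m => [|m IH]; first by rewrite !addn0.
rewrite !addnS !factS mulnCA -mulnA; apply: leq_mul => //.
by rewrite ltnS leq_add2r.
Qed.

Lemma exp_le_fact (K q n0 : nat) : exists2 N, odd N && (n0 <= N)%N & (q * K ^ N.+1 <= N`!)%N.
Proof.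
have H n : (K ^ n <= n`! * K ^ K)%N.
  elim: n => [|n IH]; first by rewrite fact0 mul1n expn0 expn_gt0; case: K.
  case: (leqP n.+1 K) => le'.
    case: K le' {IH} => // K le'.
    by apply: (leq_trans (leq_pexp2l _ le')) => //; rewrite leq_pmull ?fact_gt0.
  by rewrite expnS factS -mulnA; apply: leq_mul => //; exact: ltnW.
(* [H] bounds [K ^ (N - 1)] by [(N - 1)! * K ^ K], and the last factor [N] of the factorial exceeds
   the remaining [q * K ^ (K + 2)]. The form [2 s + 1] makes [N] odd. *)
exists (n0 + q * K ^ K.+2).*2.+1.
  by rewrite oddS odd_double /= leqW // -addnn -addnA leq_addr.
rewrite factS; set M := (_.*2); rewrite !expnS !mulnA.
apply: (@leq_trans (q * K * K * (M`! * K ^ K))); first by rewrite leq_mul2l H orbT.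
rewrite mulnCA mulnC leq_mul2r; apply/orP; right; rewrite -!mulnA -!expnS.
by rewrite /M -addnn; apply: leqW; rewrite -addnA -addnCA leq_addr.
Qed.

Variable F : realFieldType.
Implicit Types (s t a c d : F) (n m k : nat).

Definition etr n t : F := \sum_(i < n.+1) t ^+ i / i`!%:R.

Lemma factR_gt0 i : (0 : F) < i`!%:R. Proof. by rewrite ltr0n fact_gt0. Qed.
Hint Resolve factR_gt0 : core.
Lemma factR_neq0 i : (i`!%:R : F) != 0. Proof. by rewrite gt_eqF. Qed.
Hint Resolve factR_neq0 : core.
Lemma powfact_ge0 t i : 0 <= t -> 0 <= t ^+ i / i`!%:R.
Proof. by move=> h; rewrite divr_ge0 ?exprn_ge0 // ltW. Qed.

Lemma etr0 t : etr 0 t = 1.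
Proof. by rewrite /etr big_ord1 expr0 fact0 divr1. Qed.
Lemma etrS n t : etr n.+1 t = etr n t + t ^+ n.+1 / n.+1`!%:R.
Proof. by rewrite /etr big_ord_recr. Qed.
Lemma etr_at0 n : etr n 0 = 1.
Proof. by elim: n => [|n IH]; rewrite ?etr0 // etrS IH expr0n mul0r addr0. Qed.

Lemma etr_mono m n t : 0 <= t -> (m <= n)%N -> etr m t <= etr n t.
Proof.
move=> h /subnK <-; elim: (n - m)%N => // i IH; rewrite addSn etrS.
by apply: le_trans IH _; rewrite lerDl powfact_ge0.
Qed.
Lemma etr_ge1 n t : 0 <= t -> 1 <= etr n t.
Proof. by move=> h; rewrite -(etr0 t) etr_mono. Qed.
Lemma etr_gt0 n t : 0 <= t -> 0 < etr n t.
Proof. by move=> h; apply: lt_le_trans (etr_ge1 n h). Qed.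
Lemma etr_le n s t : 0 <= s -> s <= t -> etr n s <= etr n t.
Proof.
move=> h1 h2; apply: ler_sum => i _; rewrite ler_pM2r ?invr_gt0 //.
by apply: lerXn2r; rewrite ?nnegrE //; exact: le_trans h2.
Qed.

Lemma etrD n s t : etr n (s + t) = \sum_(i < n.+1) s ^+ i / i`!%:R * etr (n - i) t.
Proof.
elim: n => [|n IH]; first by rewrite big_ord1 !etr0 expr0 fact0 divr1 mul1r.
rewrite etrS IH [RHS]big_ord_recr /= subnn etr0 mulr1.
have -> : \sum_(i < n.+1) s ^+ i / i`!%:R * etr (n.+1 - i) t =
  \sum_(i < n.+1) (s ^+ i / i`!%:R * etr (n - i) t +
      s ^+ i / i`!%:R * (t ^+ (n.+1 - i) / (n.+1 - i)`!%:R)).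
  by apply: eq_bigr => i _; rewrite (subSn (ltn_ord i : (i <= n)%N)) etrS mulrDr.
rewrite big_split /= -addrA; congr (_ + _).
rewrite [s + t]addrC exprDn mulr_suml [LHS]big_ord_recr /= subnn expr0 binn mul1r mulr1n.
congr (_ + _); apply: eq_bigr => i _.
have le_in : (i <= n.+1)%N by apply: ltnW.
rewrite -(bin_fact le_in) -mulr_natr !natrM.
have b : ('C(n.+1, i)%:R : F) != 0 by rewrite pnatr_eq0 -lt0n bin_gt0.
by field; rewrite b !factR_neq0.
Qed.

Lemma etrD_le n s t : 0 <= s -> 0 <= t -> etr n (s + t) <= etr n s * etr n t.
Proof.
move=> hs ht; rewrite etrD /(etr n s) mulr_suml; apply: ler_sum => i _.
by rewrite ler_wpM2l ?powfact_ge0 // etr_mono ?leq_subr.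
Qed.

Lemma etrM_le n m s t : 0 <= s -> 0 <= t -> etr n s * etr m t <= etr (n + m) (s + t).
Proof.
move=> hs ht; rewrite etrD /(etr n s) mulr_suml -addSn big_split_ord /=.
rewrite -[X in X <= _]addr0; apply: lerD.
  apply: ler_sum => i _; rewrite ler_wpM2l ?powfact_ge0 // etr_mono //.
  by have := ltn_ord i; rewrite ltnS => h; rewrite -addnBAC // leq_addl.
by apply: sumr_ge0 => i _; rewrite mulr_ge0 ?powfact_ge0 // ltW // etr_gt0.
Qed.

(** * Products of truncations at opposite arguments *)

Definition pe n : {poly F} := \poly_(i < n.+1) (i`!%:R)^-1.
Definition pm n : {poly F} := \poly_(i < n.+1) ((-1) ^+ i / i`!%:R).

Lemma horner_pe n t : (pe n).[t] = etr n t.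
Proof. by rewrite horner_poly; apply: eq_bigr => i _; rewrite mulrC. Qed.
Lemma horner_pm n t : (pm n).[t] = etr n (- t).
Proof. by rewrite horner_poly; apply: eq_bigr => i _; rewrite mulrAC -exprNn. Qed.

Lemma deriv_pe n : (pe n.+1)^`() = pe n.
Proof.
apply/polyP => i; rewrite coef_deriv !coef_poly ltnS.
case: ifP => _; last by rewrite mul0rn.
rewrite factS natrM -mulr_natr; field.
by rewrite factR_neq0 addrC natr1 pnatr_eq0.
Qed.
Lemma deriv_pm n : (pm n.+1)^`() = - pm n.
Proof.
apply/polyP => i; rewrite coefN coef_deriv !coef_poly ltnS.
case: ifP => _; last by rewrite mul0rn oppr0.
rewrite factS natrM -mulr_natr exprS; field.
by rewrite factR_neq0 addrC natr1 pnatr_eq0.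
Qed.
Lemma peS n : pe n.+1 = pe n + (n.+1`!%:R)^-1 *: 'X^(n.+1).
Proof.
apply/polyP => i; rewrite coefD coefZ coefXn !coef_poly (ltnS i n.+1) leq_eqVlt.
by case: eqVneq => [->|] /=; rewrite ?ltnn ?mulr1 ?add0r // mulr0 addr0.
Qed.
Lemma pmS n : pm n.+1 = pm n + ((-1) ^+ n.+1 / n.+1`!%:R) *: 'X^(n.+1).
Proof.
apply/polyP => i; rewrite coefD coefZ coefXn !coef_poly (ltnS i n.+1) leq_eqVlt.
by case: eqVneq => [->|] /=; rewrite ?ltnn ?mulr1 ?add0r // mulr0 addr0.
Qed.

(** As for [exp (- X) * exp X], everything in the derivative cancels except what the top terms of
    the two truncations contribute. *)
Lemma deriv_pmpe k n : (pm k.+1 * pe n.+1)^`() =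
  ((-1) ^+ k.+1 / k.+1`!%:R) *: ('X^(k.+1) * pe n) - (n.+1`!%:R)^-1 *: ('X^(n.+1) * pm k).
Proof.
rewrite derivM deriv_pm deriv_pe peS pmS -!mul_polyC.
by move: 'X^(k.+1) 'X^(n.+1) => u v; ring.
Qed.

(* The sign of the coefficients of the derivative of the product of the two
   truncations is constant. *)
Lemma deriv_pmpe_coef k n j : (k <= n)%N -> 0 <= (-1) ^+ k.+1 * (pm k.+1 * pe n.+1)^`()`_j.
Proof.
move=> le_kn; rewrite deriv_pmpe coefB !coefZ !coefXnM !coef_poly.
have S i : (-1) ^+ i * (-1) ^+ i = 1 :> F by rewrite -exprD addnn -signr_odd odd_double.
rewrite mulrBr mulrA [(-1) ^+ k.+1 * (_ / _)]mulrA S mul1r.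
case: (ltnP j n.+1) => [ltjn|le_nj].
  rewrite mulr0 mulr0 subr0; case: ifP => _; first by rewrite mulr0.
  by case: ifP => _; rewrite ?mulr0 // mulr_ge0 // invr_ge0 ltW.
have le_kj : (k < j)%N by apply: leq_trans le_nj.
rewrite ltnNge le_kj /=.
have -> : (j - k.+1 < n.+1)%N = (j - n.+1 < k.+1)%N by rewrite !ltn_subLR // addnC.
case: ifP => [lt1|_]; last by rewrite !mulr0 subr0.
(* In this degree both products contribute, possibly with opposite signs. The first one wins, since
   [(k+1)! (j-k-1)! <= (n+1)! (j-n-1)!] by [fact_unbalance]. *)
rewrite subr_ge0; apply: (@le_trans _ _ ((n.+1`!%:R)^-1 * (j - n.+1)`!%:R^-1)).
  rewrite mulrCA; apply: ler_wpM2l; first by rewrite invr_ge0 ltW.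
  rewrite mulrA -exprD -signr_odd; case: (odd _); rewrite ?expr1 ?expr0 ?mul1r //.
  by rewrite mulN1r ge0_cp // invr_ge0 ltW.
rewrite -!invfM lef_pV2 ?posrE ?mulr_gt0 // -!natrM ler_nat.
have := @fact_unbalance k.+1 (j - n.+1) (n - k).
have -> : (j - n.+1 + (n - k) = j - k.+1)%N by lia.
have -> : (k.+1 + (n - k) = n.+1)%N by lia.
by apply; lia.
Qed.

Lemma horner_coef_ge0 (p : {poly F}) a : (forall i, 0 <= p`_i) -> 0 <= a -> 0 <= p.[a].
Proof.
by move=> h ha; rewrite horner_coef sumr_ge0 // => i _; rewrite mulr_ge0 // exprn_ge0.
Qed.

Lemma coefS_deriv (p : {poly F}) j : p`_j.+1 = p^`()`_j / j.+1%:R.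
Proof. by rewrite coef_deriv -(mulr_natr p`_j.+1) mulfK // pnatr_eq0. Qed.

Lemma pmpe_coef0 k n : (pm k * pe n)`_0 = 1.
Proof. by rewrite coef0M !coef_poly /= expr0 fact0 divr1 invr1 mulr1. Qed.

(** The product of the two polynomials has constant coefficient 1, and its other coefficients
    inherit the constant sign of those of its derivative. *)
Lemma etr_sign k n a : (k <= n)%N -> 0 <= a ->
  0 <= (-1) ^+ k * (etr k (- a) * etr n a - 1).
Proof.
case: k => [|k]; first by move=> _ h; rewrite etr0 expr0 !mul1r subr_ge0 etr_ge1.
case: n => // n le_kn ha; rewrite -horner_pm -horner_pe.
have -> : (-1) ^+ k.+1 * ((pm k.+1).[a] * (pe n.+1).[a] - 1) =
  ((-1) ^+ k.+1 *: (pm k.+1 * pe n.+1 - 1)).[a] by rewrite !hornerE.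
apply: horner_coef_ge0 => // -[|j]; rewrite coefZ coefB coef1 /=.
  by rewrite pmpe_coef0 subrr mulr0.
by rewrite subr0 coefS_deriv mulrA divr_ge0 ?ler0n // deriv_pmpe_coef.
Qed.

(** The coefficient of [X ^ (k + 1)] is exactly [- 1 / (k + 1)!], and the remaining nonconstant ones
    are nonpositive. The explicit defect is what pays for the errors in splitting and merging
    truncations below. *)
Lemma etr_odd_le1 k n a : odd k -> (k < n)%N -> 0 <= a ->
  etr k (- a) * etr n a <= 1 - a ^+ k.+1 / k.+1`!%:R.
Proof.
case: k => // k ok; case: n => // n lt_kn ha; rewrite -horner_pm -horner_pe.
rewrite -subr_ge0.
have -> : 1 - a ^+ k.+2 / k.+2`!%:R - (pm k.+1).[a] * (pe n.+1).[a] =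
  (1 - pm k.+1 * pe n.+1 - (k.+2`!%:R)^-1 *: 'X^(k.+2)).[a].
  rewrite -polyC1 !hornerD !hornerN hornerZ hornerXn hornerM hornerC.
  by move: (k.+2)`!%:R^-1 => v; ring.
have sg : (-1) ^+ k.+1 = -1 :> F by rewrite -signr_odd ok expr1.
apply: horner_coef_ge0 => // -[|j]; rewrite !coefB coef1 coefZ coefXn /=.
  by rewrite pmpe_coef0 subrr mulr0 subr0.
rewrite sub0r coefS_deriv eqSS; case: eqVneq => [->|_]; last first.
  have := @deriv_pmpe_coef k n j (ltnW lt_kn); rewrite sg mulN1r => h.
  by rewrite mulr0 subr0 -mulNr divr_ge0 ?ler0n.
rewrite mulr1 deriv_pmpe coefB !coefZ !coefXnM ltnn subnn coef_poly /= fact0 invr1 mulr1.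
rewrite lt_kn mulr0 subr0 sg mulN1r mulNr opprK [k.+2`!]factS natrM invfM mulrC.
by rewrite subrr.
Qed.

(** For equal orders both products in [deriv_pmpe] start at the same power, so the error starts at
    [a ^ (k + 2)]. The factor 2 bounds [1 + (-1) ^ i] in its coefficients. *)
Lemma etr_tail k a : odd k.+1 -> 0 <= a ->
  1 - etr k.+1 (- a) * etr k.+1 a <= a ^+ k.+2 / k.+1`!%:R * etr k a *+ 2.
Proof.
move=> ok ha; rewrite -horner_pm -!horner_pe -subr_ge0.
have -> : a ^+ k.+2 / k.+1`!%:R * (pe k).[a] *+ 2 - (1 - (pm k.+1).[a] * (pe k.+1).[a]) =
  ((k.+1`!%:R)^-1 *: ('X^(k.+2) * pe k) *+ 2 - (1 - pm k.+1 * pe k.+1)).[a].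
  rewrite -polyC1 hornerD hornerN hornerMn hornerZ hornerM hornerXn hornerD hornerN hornerM hornerC.
  by move: (k.+1)`!%:R^-1 => v; ring.
have sg : (-1) ^+ k.+1 = -1 :> F by rewrite -signr_odd ok expr1.
apply: horner_coef_ge0 => // -[|j]; rewrite !coefB coef1 coefMn coefZ coefXnM /=.
  by rewrite pmpe_coef0 subrr mulr0 mul0rn subr0.
rewrite sub0r opprK coefS_deriv deriv_pmpe coefB !coefZ !coefXnM sg !ltnS subSS !coef_poly.
case: ifP => lt_jk; first by rewrite !mulr0 subr0 mul0r mul0rn addr0.
case: ifP => _; last by rewrite !mulr0 subr0 mul0r mul0rn addr0.
set u := (k.+1)`!%:R^-1; set v := (j - k.+1)`!%:R^-1.
have u0 : 0 < u by rewrite invr_gt0.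
have v0 : 0 < v by rewrite invr_gt0.
have e : -1 / k.+1`!%:R * v - u * ((-1) ^+ (j - k.+1) / (j - k.+1)`!%:R) = - (u * v * (1 + (-1) ^+ (j - k.+1))).
  by rewrite /u /v; ring.
rewrite {}e mulNr subr_ge0.
have h2 : 1 + (-1) ^+ (j - k.+1) <= 2 :> F by rewrite -signr_odd; case: odd; rewrite ?expr1 ?expr0; lra.
have h0 : 0 <= 1 + (-1) ^+ (j - k.+1) :> F by rewrite -signr_odd; case: odd; rewrite ?expr1 ?expr0; lra.
rewrite ler_pdivrMr ?ltr0n // -(mulr_natr (u * v)) -[X in _ <= X]mulrA; apply: ler_wpM2l; first by rewrite mulr_ge0 // ltW.
apply: le_trans h2 _; rewrite -natrM ler_nat; lia.
Qed.

(** The terms of orders [2m + 2] and [2m + 3] combine to [c ^ (2m+2) / (2m+2)! * (1 - c / (2m+3))].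
    Conversely, a positive odd truncation bounds [c] by its order, so an infinite [c] never
    satisfies the positivity condition in the options of [exp]. *)
Lemma etr_odd_neg k c : odd k -> k%:R <= c -> etr k (- c) <= 0.
Proof.
move=> ok; rewrite -[k]odd_double_half ok add1n; move: (k./2) => m {k ok}.
elim: m => [|m IH] hc.
  by rewrite double0 etrS etr0 expr1 divr1 subr_le0.
have c0 : 0 <= c by apply: le_trans hc; rewrite ler0n.
rewrite doubleS (etrS m.*2.+2) (etrS m.*2.+1) -addrA -[X in _ <= X]addr0; apply: lerD.
  by apply: IH; apply: le_trans hc; rewrite ler_nat doubleS; lia.
have e1 : (- c) ^+ m.*2.+2 = c ^+ m.*2.+2 by rewrite exprNn -signr_odd /= negbK odd_double mul1r.
have e2 : (- c) ^+ m.*2.+3 = - (c ^+ m.*2.+2 * c).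
  by rewrite exprSr e1 mulrN.
rewrite e1 e2 [m.*2.+3`!]factS natrM mulNr subr_le0 invfM mulrA.
rewrite ler_pM2r ?invr_gt0 // -mulrA ler_peMr ?exprn_ge0 //.
by rewrite ler_pdivlMr ?mul1r ?ltr0n.
Qed.

(** Expansion in powers of [- d] leaves the truncation of order [k - i] at [- a] as the factor of
    [(- d) ^ i]. Multiplied by [etr n a] it is at most 1 for even [i] and at least 1 for odd [i],
    since [k] is odd; this fits the sign of [(- d) ^ i]. *)
Lemma etr_mul_odd k n a d : odd k -> (k <= n)%N -> 0 <= a -> 0 <= d ->
  etr n a * etr k (- (a + d)) <= etr k (- d).
Proof.
move=> ok le_kn ha hd; rewrite opprD addrC etrD mulr_sumr /(etr k (- d)).
apply: ler_sum => i _; have lt_ik := ltn_ord i; rewrite ltnS in lt_ik.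
have := @etr_sign (k - i) n a (leq_trans (leq_subr _ _) le_kn) ha.
have -> : (-1) ^+ (k - i) = - (-1) ^+ i :> F.
  by rewrite -signr_odd oddB // ok -[in RHS]signr_odd; case: (odd i); rewrite ?expr1 ?expr0 ?opprK.
rewrite -subr_ge0 => h.
have -> : (- d) ^+ i / i`!%:R - etr n a * ((- d) ^+ i / i`!%:R * etr (k - i) (- a)) =
  (d ^+ i / i`!%:R) * (- (-1) ^+ i * (etr (k - i) (- a) * etr n a - 1)).
  rewrite (exprNn d); move: ((-1) ^+ i) (d ^+ i) (i`!%:R^-1) => u v w; ring.
by rewrite mulr_ge0 ?powfact_ge0.
Qed.

Lemma etr_odd_lt1 k n c : odd k -> 0 < c -> 0 < etr k (- c) -> etr k (- c) * etr n c < 1.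
Proof.
move=> ok hc h; have hc' := ltW hc.
apply: (@le_lt_trans _ _ (etr k (- c) * etr (k.+1 + n) c)).
  by rewrite ler_pM2l // etr_mono ?leq_addl.
apply: le_lt_trans (etr_odd_le1 ok _ hc') _; first exact: leq_addr.
by rewrite gtrBl divr_gt0 ?exprn_gt0.
Qed.

Lemma etr1_le3 n : etr n 1 <= 3.
Proof.
(* The reserve [1 / (n + 1)!] makes the bound inductive, because [2 / (n + 2)! <= 1 / (n + 1)!]. *)
suff h : etr n.+1 1 <= 3 - (n.+1`!%:R)^-1.
  apply: (@le_trans _ _ (etr n.+1 1)); first by rewrite etr_mono.
  by apply: le_trans h _; rewrite gerBl invr_ge0 ltW.
elim: n => [|n IH]; first by rewrite etrS etr0 expr1 invr1 mulr1; lra.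
rewrite etrS expr1n mul1r.
have e : (n.+1`!%:R)^-1 = (n.+2)%:R * (n.+2`!%:R)^-1 :> F.
  by rewrite [n.+2`!]factS natrM invfM mulrA divff ?mul1r // pnatr_eq0.
have u0 : 0 < (n.+2`!%:R)^-1 :> F by rewrite invr_gt0.
have h2 : 2 <= n.+2%:R :> F by rewrite ler_nat.
rewrite e in IH; nra.
Qed.

Lemma etr_nat_le n K : etr n K%:R <= 3 ^+ K.
Proof.
elim: K => [|K IH]; first by rewrite etr_at0 expr0.
rewrite -natr1 exprSr; apply: le_trans (etrD_le n (ler0n _ _) ler01) _.
by apply: ler_pM => //; rewrite ?etr1_le3 // ltW // etr_gt0 ?ler0n.
Qed.

(** The error is measured by [c ^ p], and not by a constant, because it must stay below the defect
    in [etr_odd_le1] even for infinitesimal [c]. *)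
Lemma etr_odd_approx (K p q n0 : nat) : exists2 N, odd N && (n0 <= N)%N &
  forall c, 0 <= c -> c <= K%:R -> 1 - etr N (- c) * etr N c <= c ^+ p / q.+1%:R.
Proof.
(* The 2 comes from [etr_tail], and [3 ^ K] bounds the truncation for [c <= K]. The base is [K.+1]
   so that it is at least 1 even for [K = 0]. *)
have [N /andP[oN leN] hN] := exp_le_fact K.+1 (q.+1 * 2 * 3 ^ K) (n0 + p).
exists N => [|c c0 cK]; first by rewrite oN (leq_trans _ leN) ?leq_addr.
case: N oN leN hN => // k ok lek hk; apply: le_trans (etr_tail ok c0) _.
have le_pk : (p <= k.+2)%N by rewrite leqW // (leq_trans _ lek) ?leq_addl.
have hc : c ^+ k.+2 <= c ^+ p * K.+1%:R ^+ k.+2.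
  rewrite -(subnKC le_pk) exprD ler_wpM2l ?exprn_ge0 //.
  apply: (@le_trans _ _ (K.+1%:R ^+ (k.+2 - p))).
    by apply: lerXn2r; rewrite ?nnegrE ?ler0n //; apply: le_trans cK _; rewrite ler_nat.
  by rewrite exprD ler_peMl ?exprn_ge0 ?ler0n // exprn_ege1 // ler1n.
have he : etr k c <= 3 ^+ K by apply: le_trans (etr_le k c0 cK) (etr_nat_le k K).
have hk' : q.+1%:R * 2 * 3 ^+ K * K.+1%:R ^+ k.+2 <= k.+1`!%:R :> F.
  by move: hk; rewrite -(ler_nat F) natrM (natrX _ K.+1) natrM (natrX _ 3) natrM.
have x0 : 0 <= c ^+ k.+2 by exact: exprn_ge0.
have p0 : 0 <= c ^+ p by exact: exprn_ge0.
have E0 : 0 <= etr k c by rewrite ltW // etr_gt0.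
have f0 := factR_gt0 k.+1; have Q0 : 0 < q.+1%:R :> F by rewrite ltr0n.
move: (c ^+ k.+2) (c ^+ p) (K.+1%:R ^+ k.+2) (etr k c) (3 ^+ K) (k.+1`!%:R) (q.+1%:R)
  hc he hk' x0 p0 E0 f0 Q0 => x cp y E T f Q hc he hk' x0 p0 E0 f0 Q0.
have hxE : x * E <= cp * y * T by apply: ler_pM.
rewrite ler_pdivlMr // mulrAC -[in X in X <= _]mulr_natr [_ / f]mulrC -!mulrA ler_pdivrMl //.
have -> : x * (E * (2 * Q)) = x * E * (2 * Q) by ring.
apply: (@le_trans _ _ (cp * y * T * (2 * Q))); first by rewrite ler_pM2r // mulr_gt0.
have -> : cp * y * T * (2 * Q) = cp * (Q * 2 * T * y) by ring.
by rewrite [f * cp]mulrC ler_wpM2l.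
Qed.

(** After multiplication by truncations at [s] and [t], the left side is at most [1 - e], with [e]
    the defect of order [j + 1], while for large [k] each factor on the right is at least
    [1 - e / 2]. *)
Lemma etr_odd_split j s t : odd j -> 0 <= s -> 0 <= t -> 0 < etr j (- (s + t)) ->
  exists2 k, odd k & [/\ 0 < etr k (- s), 0 < etr k (- t) &
                        etr j (- (s + t)) <= etr k (- s) * etr k (- t)].
Proof.
move=> oj hs ht; set D := s + t => hD.
have D0 : 0 <= D by rewrite addr_ge0.
have Dj : D <= j%:R.
  by rewrite leNgt; apply/negP => /ltW /(etr_odd_neg oj); rewrite leNgt hD.
(* Positivity gives [D <= j], whence the bound [j]. The other constants make the error at most
   [D ^ (j+1) / (2 (j+1)!)], half of the defect; the predecessor undoes the successor in
   [etr_odd_approx]. *)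
have [k /andP[ok lek] hk] := etr_odd_approx j j.+1 (2 * j.+1`!).-1 j.+1.
exists k => //; rewrite prednK ?muln_gt0 ?fact_gt0 // in hk.
set e := D ^+ j.+1 / j.+1`!%:R.
have b n : (j < n)%N -> etr j (- D) * etr n D <= 1 - e by move=> h; apply: etr_odd_le1.
have e1 : e < 1.
  by rewrite -subr_gt0; apply: lt_le_trans (b j.+1 _) => //; rewrite mulr_gt0 // etr_gt0.
have B c : 0 <= c -> c <= D -> 1 - e / 2 <= etr k (- c) * etr k c.
  move=> c0 cD; have := hk c c0 (le_trans cD Dj).
  have : c ^+ j.+1 / (2 * j.+1`!)%:R <= e / 2.
    rewrite /e natrM invfM mulrA [X in X <= _]mulrAC; rewrite ler_pM2r ?invr_gt0 //.
    by rewrite ler_pM2r ?invr_gt0 //; apply: lerXn2r; rewrite ?nnegrE.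
  lra.
have sD : s <= D by rewrite lerDl.
have tD : t <= D by rewrite lerDr.
have Bs := B _ hs sD; have Bt := B _ ht tD.
have es : 0 < etr k s by apply: etr_gt0.
have et : 0 < etr k t by apply: etr_gt0.
have e0 : 0 <= e by exact: powfact_ge0.
split.
- by rewrite -(pmulr_lgt0 _ es); lra.
- by rewrite -(pmulr_lgt0 _ et); lra.
- rewrite -(ler_pM2r (mulr_gt0 es et)).
  apply: (@le_trans _ _ (etr j (- D) * etr (k + k) D)).
    by rewrite ler_pM2l // etrM_le.
  apply: le_trans (b _ _) _; first by rewrite ltn_addl.
  rewrite mulrACA; apply: (@le_trans _ _ ((1 - e / 2) * (1 - e / 2))); first by nra.
  by apply: ler_pM => //; lra.
Qed.

(** The defect of the factor at the larger argument [c] covers the error at [c + d], because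
    [c + d <= 2 c]. *)
Lemma etr_odd_merge_le k l c d : odd k -> odd l -> 0 <= d -> d <= c ->
  0 < etr k (- c) -> 0 < etr l (- d) ->
  exists2 N, odd N & etr k (- c) * etr l (- d) <= etr N (- (c + d)).
Proof.
move=> ok ol d0 dc hc hd; have c0 : 0 <= c by exact: le_trans dc.
have ck : c <= k%:R.
  by rewrite leNgt; apply/negP => /ltW /(etr_odd_neg ok); rewrite leNgt hc.
(* Positivity gives [c <= k], so [c + d <= k + k]. The power of 2 turns [(c + d) ^ (k+1)] into at
   most [c ^ (k+1)], and the last argument puts [N] above both [k] and [l]. *)
have [N /andP[oN leN] hN] := etr_odd_approx (k + k) k.+1 (2 ^ k.+1 * k.+1`!).-1 (k.+1 + l.+1).
exists N => //; rewrite prednK ?muln_gt0 ?fact_gt0 ?expn_gt0 // in hN.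
set e := c ^+ k.+1 / k.+1`!%:R.
have lkN : (k < N)%N by apply: leq_trans leN; rewrite leq_addr.
have llN : (l < N)%N by apply: leq_trans leN; rewrite leq_addl.
have h1 : etr k (- c) * etr N c <= 1 - e by exact: etr_odd_le1.
have h2 : etr l (- d) * etr N d <= 1.
  apply: le_trans (etr_odd_le1 ol llN d0) _; rewrite gerBl; exact: powfact_ge0.
have ec : 0 < etr N c by apply: etr_gt0.
have ed : 0 < etr N d by apply: etr_gt0.
have cd0 : 0 <= c + d by rewrite addr_ge0.
have h3 : 1 - e <= etr N (- (c + d)) * etr N (c + d).
  have hcd : c + d <= (k + k)%:R by rewrite natrD; lra.
  have := hN (c + d) cd0 hcd.
  have : (c + d) ^+ k.+1 / (2 ^ k.+1 * k.+1`!)%:R <= e; last by lra.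
  rewrite /e natrM natrX invfM mulrA ler_pM2r ?invr_gt0 // ler_pdivrMr ?exprn_gt0 //.
  by rewrite -exprMn; apply: lerXn2r; rewrite ?nnegrE //; lra.
have p1 : 0 < etr k (- c) * etr N c by rewrite mulr_gt0.
have p2 : 0 < etr l (- d) * etr N d by rewrite mulr_gt0.
have hp : 0 < etr N (- (c + d)).
  by rewrite -(pmulr_lgt0 _ (etr_gt0 N cd0)); lra.
rewrite -(ler_pM2r (mulr_gt0 ec ed)) mulrACA.
apply: (@le_trans _ _ (etr N (- (c + d)) * etr N (c + d))); last by rewrite ler_pM2l // etrD_le.
apply: le_trans h3; rewrite -[1 - e]mulr1; apply: ler_pM => //; exact: ltW.
Qed.

Lemma etr_odd_merge k l c d : odd k -> odd l -> 0 <= c -> 0 <= d ->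
  0 < etr k (- c) -> 0 < etr l (- d) ->
  exists2 N, odd N & etr k (- c) * etr l (- d) <= etr N (- (c + d)).
Proof.
move=> ok ol c0 d0 hc hd; case: (leP d c) => h; first exact: etr_odd_merge_le.
by rewrite mulrC addrC; apply: etr_odd_merge_le => //; exact: ltW.
Qed.

End ExpTrunc.

(** * The exponential function on numbers *)

Lemma natg_succ n : natg n.+1 == natg n + one.
Proof.
elim: n => [|n IH]; apply: eqg_opts => b z.
- move=> /opt_natS[-> ->]; exists (zero + zero); last exact: eqg_sym (addg0 _).
  by apply: opt_addr; apply/opt_natS.
- move=> /opt_add[] [w]; first by move/opt_zero.
  by move=> /opt_natS[-> ->] ->; exists zero; [exact/opt_natS|exact: eqg_sym (addg0 _)].
- move=> /opt_natS[-> ->]; exists (natg n.+1 + zero); last exact: eqg_sym (addg0 _).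
  by apply: opt_addr; apply/opt_natS.
- move=> /opt_add[] [w] /opt_natS[-> ->] ->; exists (natg n.+1); try exact/opt_natS.
    exact: IH.
  exact: eqg_sym (addg0 _).
Qed.

Lemma No_of_nat n : No_of (natg n) = n%:R%R.
Proof.
elim: n => [|n IH] //; rewrite -natr1 -IH -No_of1 -No_ofD; try numeric.
by apply: No_of_eq; [numeric|numeric|exact: natg_succ].
Qed.

Lemma numeric_natg_inv n : numeric (inv (natg n.+1)) /\ No_of (inv (natg n.+1)) = (n.+1%:R^-1)%R.
Proof.
by rewrite -No_of_nat; apply: inv_spec; [numeric|rewrite No_of_nat pnatr_eq0].
Qed.

Lemma factE n : Factorial.fact n = n`!.
Proof. by elim: n => [|n IH] //=; rewrite IH factS. Qed.

Lemma pow_spec x n : numeric x -> numeric (pow x n) /\ No_of (pow x n) = (No_of x ^+ n)%R.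
Proof.
move=> nx; elim: n => [|n [IH1 IH2]] /=; first by split; [numeric|rewrite expr0].
by split; [numeric|rewrite No_ofM // IH2 exprS].
Qed.

Lemma exp_trunc_spec x n :
  numeric x -> numeric (exp_trunc x n) /\ No_of (exp_trunc x n) = etr n (No_of x).
Proof.
move=> nx; elim: n => [|n [IH1 IH2]]; first by split; [exact: numeric_nat|rewrite etr0].
have [np ep] := pow_spec n.+1 nx.
have [] := numeric_natg_inv (n.+1)`!.-1; rewrite prednK ?fact_gt0 // => ni ei.
rewrite -[exp_trunc _ _]/(exp_trunc x n + pow x n.+1 / natg (Factorial.fact n.+1)) factE.
split; first by numeric.
rewrite No_ofD; try numeric.
by rewrite No_ofM // IH2 ep ei etrS.
Qed.

Lemma opt_exp_left x z : opt true (exp x) z <->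
  [\/ z = zero,
      exists x' n, opt true x x' /\ z = exp x' * exp_trunc (x - x') n |
      exists x'' n, [/\ opt false x x'', zero < exp_trunc (x - x'') (2 * n + 1) &
                      z = exp x'' * exp_trunc (x - x'') (2 * n + 1)]].
Proof.
case: x => XL XR xl xr; split.
  case=> -[[u|[i n]]|[[j n] h]] ->.
  - by constructor 1.
  - by constructor 2; exists (xl i), n; split=> //; exists i.
  - by constructor 3; exists (xr j), n; split=> //; exists j.
case=> [->|[_ [n [[i ->] ->]]]|[_ [n [[j ->] h ->]]]].
- by exists (inl (inl tt)).
- by exists (inl (inr (i, n))).
- by exists (inr (exist _ (j, n) h)).
Qed.

Lemma opt_exp_right x z : opt false (exp x) z <->
  (exists x'' n, opt false x x'' /\ z = exp x'' / exp_trunc (x'' - x) n) \/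
  (exists x' n, [/\ opt true x x', zero < exp_trunc (x' - x) (2 * n + 1) &
                   z = exp x' / exp_trunc (x' - x) (2 * n + 1)]).
Proof.
case: x => XL XR xl xr; split.
  case=> -[[j n]|[[i n] h]] ->.
  - by left; exists (xr j), n; split=> //; exists j.
  - by right; exists (xl i), n; split=> //; exists i.
case=> [[_ [n [[j ->] ->]]]|[_ [n [[i ->] h ->]]]].
- by exists (inl (j, n)).
- by exists (inr (exist _ (i, n) h)).
Qed.

(* [exp v / exp u] lies between the truncations of the series of
   [exp (v - u)] and the inverses of those of [exp (u - v)]. *)
Definition exp_rel (u v : game) : Prop :=
  (forall n, No_of (exp u) * etr n (No_of v - No_of u) < No_of (exp v))%R /\
  (forall k, odd k -> No_of (exp v) * etr k (No_of u - No_of v) < No_of (exp u))%R.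

Definition exp_ok (x : game) : Prop :=
  [/\ numeric (exp x), (0 < No_of (exp x))%R,
      forall x', opt true x x' -> exp_rel x' x & forall x'', opt false x x'' -> exp_rel x x''].

Definition exp_cmp (x y : game) : Prop :=
  (x < y -> exp_rel x y) /\ (x == y -> No_of (exp x) = No_of (exp y)).

Lemma odd_half k : odd k -> (2 * k./2 + 1)%N = k.
Proof. by move=> ok; rewrite -[RHS]odd_double_half ok addnC mul2n. Qed.

(** The first half is submultiplicativity of truncations. The second has content only for a positive
    odd truncation, which [etr_odd_split] distributes over the two steps. *)
Lemma exp_rel_trans u v w : numeric u -> numeric v -> numeric w -> u < v -> v < w ->
  (0 < No_of (exp u))%R -> (0 < No_of (exp v))%R -> (0 < No_of (exp w))%R ->
  exp_rel u v -> exp_rel v w -> exp_rel u w.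
Proof.
move=> nu nv nw /(ltNoP nu nv) uv /(ltNoP nv nw) vw pu pv pw [h1 h2] [h3 h4]; rewrite /exp_rel.
move: (No_of (exp u)) (No_of (exp v)) (No_of (exp w)) pu pv pw h1 h2 h3 h4 => eu ev ew.
move: (No_of u) (No_of v) (No_of w) uv vw => U V W uv vw pu pv pw h1 h2 h3 h4.
have d1 : (0 <= V - U)%R by rewrite subr_ge0 ltW.
have d2 : (0 <= W - V)%R by rewrite subr_ge0 ltW.
split=> [n|k ok].
  apply: le_lt_trans _ (h3 n); apply: (@le_trans _ _ (eu * (etr n (V - U) * etr n (W - V))))%R.
    rewrite ler_pM2l //; apply: le_trans (etrD_le n d1 d2).
    by rewrite (_ : (V - U + (W - V) = W - U)%R) //; ring.
  by rewrite mulrA ler_pM2r ?etr_gt0 // ltW.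
case: (leP (etr k (U - W)) 0%R) => hk; first by apply: le_lt_trans _ pu; rewrite pmulr_rle0.
have e : (U - W = - ((V - U) + (W - V)))%R by ring.
rewrite e in hk *; have [j oj [j1 j2 hj]] := etr_odd_split ok d1 d2 hk.
apply: (@le_lt_trans _ _ (ew * (etr j (- (V - U)) * etr j (- (W - V)))))%R.
  by rewrite ler_pM2l.
have h2' := h2 j oj; have h4' := h4 j oj; rewrite -(opprB V) in h2'; rewrite -(opprB W) in h4'.
by rewrite mulrCA mulrC; apply: (lt_trans _ h2'); rewrite ltr_pM2r.
Qed.

(* Covers the comparisons between a left and a right option of [exp x] that come
   from options of [x] on the same side. *)
Lemma exp_cross u v (a c : No) k n : numeric u -> numeric v -> exp_cmp u v -> exp_cmp v u ->
  (0 < No_of (exp u))%R -> (0 < No_of (exp v))%R ->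
  (0 < a)%R -> (0 < c)%R -> (No_of u + a = No_of v + c)%R -> odd k -> (0 < etr k (- c))%R ->
  (No_of (exp u) * etr n a * etr k (- c) < No_of (exp v))%R.
Proof.
move=> nu nv [c1 c2] [c3 _] pu pv a0 c0 e ok hk; have a0' := ltW a0; have c0' := ltW c0.
(* If [u < v], then [a = c + (v - u)] and the truncation at [a] splits by [etrD_le]. If [v < u],
   then [c = a + (u - v)] and [etr_mul_odd] absorbs the truncation at [a]. *)
case: (game_trichotomy nu nv) => h.
- have e1 : a = c.
    by have := No_of_eq nu nv h => eq; rewrite eq in e; apply: addrI e.
  by rewrite (c2 h) e1 -mulrA gtr_pMr // mulrC; apply: etr_odd_lt1.
- have [h1 _] := c1 h; have {}h1 := h1 n; move/(ltNoP nu nv): h; rewrite -subr_gt0 => d0.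
  have -> : a = (c + (No_of v - No_of u))%R by apply: (addrI (No_of u)); rewrite e; ring.
  apply: le_lt_trans _ h1; rewrite -mulrA ler_pM2l //.
  apply: (@le_trans _ _ (etr n c * etr n (No_of v - No_of u) * etr k (- c)))%R.
    by rewrite ler_pM2r // etrD_le // ltW.
  by rewrite mulrAC ler_piMl ?ltW ?etr_gt0 ?ltW // mulrC etr_odd_lt1.
- have [_ h2] := c3 h; have {}h2 := h2 k ok; move/(ltNoP nv nu): h; rewrite -subr_gt0 => d0.
  have ec : c = (a + (No_of u - No_of v))%R.
    by apply: (addrI (No_of v)); rewrite -e; ring.
  rewrite -(opprB (No_of u)) in h2; apply: le_lt_trans _ h2; rewrite -mulrA ler_pM2l //.
  apply: (@le_trans _ _ (etr (k + n) a * etr k (- c)))%R.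
    by rewrite ler_pM2r // etr_mono // leq_addl.
  by rewrite ec; apply: etr_mul_odd => //; [exact: leq_addr|exact: ltW].
Qed.

Lemma exp_trunc_sub u v n : numeric u -> numeric v -> numeric (exp_trunc (u - v) n) /\
  No_of (exp_trunc (u - v) n) = etr n (No_of u - No_of v).
Proof.
move=> nu nv; have n' : numeric (u - v) by numeric.
by have [h1 ->] := exp_trunc_spec n n'; rewrite No_ofD ?No_ofN //; numeric.
Qed.

Lemma div_spec x y : numeric x -> numeric y -> (0 < No_of y)%R ->
  numeric (x / y) /\ No_of (x / y) = (No_of x / No_of y)%R.
Proof.
move=> n1 n2 g0; have [n3 e3] := inv_spec n2 (lt0r_neq0 g0).
by split; [numeric|rewrite No_ofM // e3].
Qed.

Lemma No_opt_lt b x u : numeric x -> opt b x u ->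
  (0 < if b then No_of x - No_of u else No_of u - No_of x)%R.
Proof.
move=> nx ou; have nu := numeric_opt_num nx ou; have := numeric_opt_lt nx ou.
by case: b {ou} => /ltNoP h; rewrite subr_gt0; apply: h.
Qed.

Section ExpOptions.
Variable x : game.
Hypotheses (nx : numeric x) (nexp : forall b u, opt b x u -> numeric (exp u)).
Let NU b u : opt b x u -> numeric u. Proof. exact: numeric_opt_num. Qed.
Let odd21 n : odd (2 * n + 1). Proof. by rewrite oddD oddM. Qed.

Lemma exp_left_value z : opt true (exp x) z -> numeric z /\
  [\/ No_of z = 0%R,
     exists u n, opt true x u /\ No_of z = (No_of (exp u) * etr n (No_of x - No_of u))%R |
     exists u k, [/\ opt false x u, odd k, (0 < etr k (- (No_of u - No_of x)))%R &
       No_of z = (No_of (exp u) * etr k (- (No_of u - No_of x)))%R]].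
Proof.
case/opt_exp_left => [->|[u [n [ou ->]]]|[u [n [ou h ->]]]].
- by split; [numeric|constructor 1].
- have [n1 e1] := exp_trunc_sub n nx (NU ou); have n2 := nexp ou.
  by split; [numeric|constructor 2; exists u, n; rewrite No_ofM // e1].
- have [n1 e1] := exp_trunc_sub (2 * n + 1)%N nx (NU ou); have n2 := nexp ou.
  split; [numeric|constructor 3; exists u, (2 * n + 1)%N]; rewrite opprB -e1 No_ofM //.
  by split=> //; apply/ltNoP => //; numeric.
Qed.

Lemma exp_right_value z : opt false (exp x) z -> numeric z /\
  ((exists u n, opt false x u /\ No_of z = (No_of (exp u) / etr n (No_of u - No_of x))%R) \/
   (exists u k, [/\ opt true x u, odd k, (0 < etr k (- (No_of x - No_of u)))%R &
       No_of z = (No_of (exp u) / etr k (- (No_of x - No_of u)))%R])).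
Proof.
case/opt_exp_right => [[u [n [ou ->]]]|[u [n [ou h ->]]]].
- have [n1 e1] := exp_trunc_sub n (NU ou) nx; have n2 := nexp ou.
  have p : (0 < No_of (exp_trunc (u - x) n))%R by rewrite e1 etr_gt0 // ltW // (No_opt_lt nx ou).
  have [n3 e3] := div_spec n2 n1 p.
  by split=> //; left; exists u, n; rewrite e3 e1.
- have [n1 e1] := exp_trunc_sub (2 * n + 1)%N (NU ou) nx; have n2 := nexp ou.
  have p : (0 < No_of (exp_trunc (u - x) (2 * n + 1)))%R by apply/ltNoP => //; numeric.
  have [n3 e3] := div_spec n2 n1 p.
  by split=> //; right; exists u, (2 * n + 1)%N; rewrite opprB -e1.
Qed.

End ExpOptions.

Lemma exp_ok_step x : numeric x -> (forall b u, opt b x u -> exp_ok u) ->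
  (forall b c u v, opt b x u -> opt c x v -> exp_cmp u v) -> exp_ok x.
Proof.
move=> nx Hok Hcmp.
have NU b u : opt b x u -> numeric u by exact: numeric_opt_num.
have NE b u : opt b x u -> numeric (exp u) by move=> /Hok[].
have PE b u : opt b x u -> (0 < No_of (exp u))%R by move=> /Hok[].
have SL u : opt true x u -> (0 < No_of x - No_of u)%R.
  by move=> ou; rewrite subr_gt0; apply/ltNoP; [exact: NU ou|exact: nx|exact: (numeric_opt_lt nx ou)].
have SR u : opt false x u -> (0 < No_of u - No_of x)%R.
  by move=> ou; rewrite subr_gt0; apply/ltNoP; [exact: nx|exact: NU ou|exact: (numeric_opt_lt nx ou)].
have L := exp_left_value nx NE; have R := exp_right_value nx NE.
have sep z w : opt true (exp x) z -> opt false (exp x) w -> (No_of z < No_of w)%R.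
  move=> /L[_ Lz] /R[_ Rw].
  (* For options of [x] on opposite sides, [exp_rel] between them suffices after the two truncations
     are merged by [etrM_le] or [etr_odd_merge]; options on the same side are the case of
     [exp_cross]. *)
  case: Rw => [[v [m [ov ->]]]|[v [l [ov ol lv ->]]]]; (rewrite ltr_pdivlMr; last first).
  - by rewrite ?etr_gt0 // ltW // SR.
  - case: Lz => [->|[u [n [ou ->]]]|[u [k [ou ok ku ->]]]].
    + by rewrite mul0r (PE _ _ ov).
    + have lt_uv : u < v.
        exact: glt_trans (numeric_opt_lt nx ou) (numeric_opt_lt nx ov).
      have [h _] := (Hcmp _ _ _ _ ou ov).1 lt_uv; apply: le_lt_trans _ (h (n + m)%N).
      rewrite -mulrA ler_pM2l ?(PE _ _ ou) //.
      have -> : (No_of v - No_of u = (No_of x - No_of u) + (No_of v - No_of x))%R by ring.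
      by apply: etrM_le; apply: ltW; [exact: SL|exact: SR].
    + rewrite mulrAC; apply: exp_cross (Hcmp _ _ _ _ ou ov) (Hcmp _ _ _ _ ov ou) (PE _ _ ou) (PE _ _ ov) (SR _ ov) (SR _ ou) _ ok ku;
        [exact: NU ou|exact: NU ov|ring].
  - exact: lv.
  - case: Lz => [->|[u [n [ou ->]]]|[u [k [ou ok ku ->]]]].
    + by rewrite mul0r (PE _ _ ov).
    + apply: exp_cross (Hcmp _ _ _ _ ou ov) (Hcmp _ _ _ _ ov ou) (PE _ _ ou) (PE _ _ ov) (SL _ ou) (SL _ ov) _ ol lv;
        [exact: NU ou|exact: NU ov|ring].
    + have lt_vu : v < u.
        exact: glt_trans (numeric_opt_lt nx ov) (numeric_opt_lt nx ou).
      have [_ h] := (Hcmp _ _ _ _ ov ou).1 lt_vu.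
      have [N oN hN] := etr_odd_merge ok ol (ltW (SR _ ou)) (ltW (SL _ ov)) ku lv.
      apply: le_lt_trans _ (h N oN); rewrite -mulrA ler_pM2l ?(PE _ _ ou) //.
      apply: le_trans hN _; rewrite (_ : (- (_ + _) = No_of v - No_of u)%R) //; ring.
have nE : numeric (exp x).
  apply/numeric_opt; split; last by case=> z; [case/L|case/R].
  move=> z w oz ow; have := sep _ _ oz ow => /(ltNoP (L _ oz).1 (R _ ow).1); by case.
have ltL z : opt true (exp x) z -> (No_of z < No_of (exp x))%R.
  by move=> oz; apply/(ltNoP (L _ oz).1 nE); exact: (numeric_opt_lt nE oz).
have ltR z : opt false (exp x) z -> (No_of (exp x) < No_of z)%R.
  by move=> oz; apply/(ltNoP nE (R _ oz).1); exact: (numeric_opt_lt nE oz).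
have pE : (0 < No_of (exp x))%R by apply: (ltL zero); apply/opt_exp_left; constructor 1.
split=> // u ou; have nu := NU _ _ ou; have ne := NE _ _ ou; have pu := PE _ _ ou.
- split=> [n|k ok].
    have [n1 e1] := exp_trunc_sub n nx nu; rewrite -e1 -No_ofM //; apply: ltL.
    by apply/opt_exp_left; constructor 2; exists u, n.
  (* A nonpositive truncation yields no option of [exp x], but the inequality is then trivial. *)
  case: (leP (etr k (No_of u - No_of x)) 0%R) => hk; first by apply: le_lt_trans _ pu; rewrite pmulr_rle0.
  have [n1 e1] := exp_trunc_sub k nu nx; rewrite -e1 in hk *.
  have [n3 e3] := div_spec ne n1 hk; rewrite -ltr_pdivlMr // -e3; apply: ltR.
  apply/opt_exp_right; right; exists u, k./2; rewrite odd_half //; split=> //.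
  by apply/ltNoP => //; numeric.
- split=> [n|k ok].
    have [n1 e1] := exp_trunc_sub n nu nx; rewrite -e1.
    have p : (0 < No_of (exp_trunc (u - x) n))%R by rewrite e1 etr_gt0 // ltW // SR.
    have [n3 e3] := div_spec ne n1 p; rewrite -ltr_pdivlMr // -e3; apply: ltR.
    by apply/opt_exp_right; left; exists u, n.
  case: (leP (etr k (No_of x - No_of u)) 0%R) => hk; first by apply: le_lt_trans _ pE; rewrite pmulr_rle0.
  have [n1 e1] := exp_trunc_sub k nx nu; rewrite -e1 in hk *; rewrite -No_ofM //; apply: ltL.
  apply/opt_exp_left; constructor 3; exists u, k./2; rewrite odd_half //; split=> //.
  by apply/ltNoP => //; numeric.
Qed.

Lemma exp_le_step x y : numeric x -> numeric y -> x == y -> exp_ok x -> exp_ok y ->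
  (forall b u, opt b x u -> exp_ok u) -> (forall b u, opt b y u -> exp_ok u) ->
  (forall b u, opt b x u -> if b then exp_rel u y else exp_rel y u) ->
  (forall b u, opt b y u -> if b then exp_rel u x else exp_rel x u) ->
  exp x <= exp y.
Proof.
move=> nx ny exy [nex px _ _] [ney py _ _] okx oky rx ry.
have e : No_of x = No_of y by exact: No_of_eq.
have NX b u : opt b x u -> numeric (exp u) by move=> /okx[].
have NY b u : opt b y u -> numeric (exp u) by move=> /oky[].
apply/le_opt; split=> z oz.
- have [nz h] := exp_left_value nx NX oz; move=> /(leNoP ney nz); apply/negP; rewrite -ltNge.
  case: h => [->//|[u [n [ou ->]]]|[u [k [ou ok _ ->]]]]; rewrite e.
    by have [h _] := rx _ _ ou; exact: h.
  by have [_ h] := rx _ _ ou; rewrite opprB; exact: h.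
- have [nz h] := exp_right_value ny NY oz; move=> /(leNoP nz nex); apply/negP; rewrite -ltNge.
  case: h => [[u [n [ou ->]]]|[u [k [ou ok hk ->]]]].
    rewrite ltr_pdivlMr; last by rewrite etr_gt0 // ltW // (No_opt_lt ny ou).
    by have [h _] := ry _ _ ou; rewrite -e; exact: h.
  by rewrite ltr_pdivlMr //; have [_ h] := ry _ _ ou; rewrite opprB -e; exact: h.
Qed.

(** For [x < y] an option of one of them lies weakly between, and [exp_rel] is composed through it.
    For [x == y] the options of each exponential are compared with the other one. *)
Lemma exp_okP : (forall x, numeric x -> exp_ok x) /\
  (forall x y, numeric x -> numeric y -> exp_cmp x y).
Proof.
apply: numeric_pair_ind => [x nx ok cmp|x y nx ny okx oky cx cy]; first exact: exp_ok_step.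
have okxo b u : opt b x u -> exp_ok u by move=> /cx[].
have okyo b u : opt b y u -> exp_ok u by move=> /cy[].
have [nex px lx rx] := okx; have [ney py ly ry] := oky.
split.
  move=> [_ nle]; case: (not_le_ex nle) => -[u ou le'].
    have nu := numeric_opt_num ny ou; have [_ _ [c1 c2]] := cy _ _ ou; have r := ly _ ou.
    case: (game_trichotomy nx nu) => h.
    - by have e := No_of_eq nx nu h; move: r; rewrite /exp_rel e (c2 h).
    - have [_ pu _ _] := okyo _ _ ou.
      exact: exp_rel_trans nx nu ny h (numeric_opt_lt ny ou) px pu py (c1 h) r.
    - by case: h.
  have nu := numeric_opt_num nx ou; have [_ [c1 c2] _] := cx _ _ ou; have r := rx _ ou.
  case: (game_trichotomy nu ny) => h.
  - by have e := No_of_eq nu ny h; move: r; rewrite /exp_rel e (c2 h).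
  - have [_ pu _ _] := okxo _ _ ou.
    exact: exp_rel_trans nx nu ny (numeric_opt_lt nx ou) h px pu py r (c1 h).
  - by case: h.
move=> e.
have relx b u : opt b x u -> if b then exp_rel u y else exp_rel y u.
  move=> ou; have [_ [c1 _] [c2 _]] := cx _ _ ou; have := numeric_opt_lt nx ou.
  by case: b ou => ou h; [apply: c1; exact: glt_le_trans h e.1|apply: c2; exact: gle_lt_trans e.2 h].
have rely b u : opt b y u -> if b then exp_rel u x else exp_rel x u.
  move=> ou; have [_ [c1 _] [c2 _]] := cy _ _ ou; have := numeric_opt_lt ny ou.
  by case: b ou => ou h; [apply: c1; exact: glt_le_trans h e.2|apply: c2; exact: gle_lt_trans e.1 h].
apply: No_of_eq => //; split; apply: exp_le_step => //; exact: eqg_sym.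
Qed.

Lemma numeric_exp x : numeric x -> numeric (exp x).
Proof. by move=> nx; case: (exp_okP.1 _ nx). Qed.

Lemma exp_gt0 x : numeric x -> (0 < No_of (exp x))%R.
Proof. by move=> nx; case: (exp_okP.1 _ nx). Qed.

Lemma exp_relP x y : numeric x -> numeric y -> (No_of x < No_of y)%R -> exp_rel x y.
Proof.
move=> nx ny /(ltNoP nx ny); exact: (exp_okP.2 _ _ nx ny).1.
Qed.

Lemma exp_ge_trunc x y n : numeric x -> numeric y -> (No_of x < No_of y)%R ->
  (No_of (exp x) * etr n (No_of y - No_of x) < No_of (exp y))%R.
Proof. by move=> nx ny /(exp_relP nx ny)[]. Qed.

Lemma exp_eq x y : numeric x -> numeric y -> No_of x = No_of y -> No_of (exp x) = No_of (exp y).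
Proof.
move=> nx ny /(No_ofP nx ny); exact: (exp_okP.2 _ _ nx ny).2.
Qed.

Lemma exp_lt x y : numeric x -> numeric y ->
  (No_of (exp x) < No_of (exp y))%R = (No_of x < No_of y)%R.
Proof.
have H a b : numeric a -> numeric b -> (No_of a < No_of b -> No_of (exp a) < No_of (exp b))%R.
  by move=> na nb h; have := exp_ge_trunc 0 na nb h; rewrite etr0 mulr1.
move=> nx ny; apply/idP/idP; last exact: H.
case: (ltgtP (No_of x) (No_of y)) => // [/(H _ _ ny nx) h|e].
  by rewrite ltNge (ltW h).
by rewrite (exp_eq nx ny e) ltxx.
Qed.

Lemma exp_le x y : numeric x -> numeric y ->
  (No_of (exp x) <= No_of (exp y))%R = (No_of x <= No_of y)%R.
Proof. by move=> nx ny; rewrite !leNgt exp_lt. Qed.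

Lemma exp_zero : No_of (exp zero) = 1%R.
Proof.
apply: No_of_eq; [exact: numeric_exp numeric_zero|numeric|apply: eqg_opts => b z].
  case: b => [/opt_exp_left[->|[u [n [/opt_zero]]]//|[u [n [/opt_zero]]]//]|].
    by exists zero => //; exact/opt_natS.
  by move=> /opt_exp_right[[u [n [/opt_zero]]]|[u [n [/opt_zero]]]].
by move=> /opt_natS[-> ->]; exists zero => //; apply/opt_exp_left; constructor 1.
Qed.

(** * Powers of omega *)

Lemma opt_omega_pow_left a z : opt true (omega_pow a) z <->
  z = zero \/ exists a' k, opt true a a' /\ z = natg k * omega_pow a'.
Proof.
case: a => L R l r; split.
  by case=> -[[i k]|] ->; [right; exists (l i), k; split=> //; exists i|left].
by case=> [->|[_ [k [[i ->] ->]]]]; [exists None|exists (Some (i, k))].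
Qed.

Lemma opt_omega_pow_right a z : opt false (omega_pow a) z <->
  exists a' k, opt false a a' /\ z = inv (natg (Nat.pow 2 k)) * omega_pow a'.
Proof.
case: a => L R l r; split.
  by case=> -[i k] ->; exists (r i), k; split=> //; exists i.
by case=> [_ [k [[i ->] ->]]]; exists (i, k).
Qed.

Lemma pow2E k : Nat.pow 2 k = 2 ^ k.
Proof. by elim: k => [|k IH] //=; rewrite IH expnS; lia. Qed.

Lemma inv_pow2_spec k : numeric (inv (natg (Nat.pow 2 k))) /\
  No_of (inv (natg (Nat.pow 2 k))) = ((2 ^ k)%:R^-1)%R.
Proof.
by rewrite pow2E; have := numeric_natg_inv (2 ^ k).-1; rewrite prednK ?expn_gt0.
Qed.

Definition dominated (u v : No) : Prop := forall k : nat, (k%:R * u < v)%R.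

Definition omega_ok (a : game) : Prop :=
  [/\ numeric (omega_pow a), (0 < No_of (omega_pow a))%R &
      forall b u, opt b a u -> if b then dominated (No_of (omega_pow u)) (No_of (omega_pow a))
                               else dominated (No_of (omega_pow a)) (No_of (omega_pow u))].

Definition omega_cmp (a b : game) : Prop :=
  (a < b -> dominated (No_of (omega_pow a)) (No_of (omega_pow b))) /\
  (a == b -> No_of (omega_pow a) = No_of (omega_pow b)).

Lemma dominated_lt (u v : No) : dominated u v -> (u < v)%R.
Proof. by move=> /(_ 1); rewrite mul1r. Qed.

Lemma le_dominated_trans (u v w : No) : (u <= v)%R -> dominated v w -> dominated u w.
Proof. by move=> h d k; apply: le_lt_trans _ (d k); rewrite ler_wpM2l ?ler0n. Qed.

Lemma dominated_le_trans (u v w : No) : dominated u v -> (v <= w)%R -> dominated u w.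
Proof. by move=> d h k; exact: lt_le_trans (d k) h. Qed.

Lemma omega_okP : (forall a, numeric a -> omega_ok a) /\
  (forall a b, numeric a -> numeric b -> omega_cmp a b).
Proof.
have LV a z : (forall b u, opt b a u -> omega_ok u) -> opt true (omega_pow a) z ->
    numeric z /\ (No_of z = 0%R \/ exists u k, opt true a u /\ No_of z = (k%:R * No_of (omega_pow u))%R).
  move=> ok /opt_omega_pow_left[->|[u [k [ou ->]]]]; first by split; [numeric|left].
  have [n1 _ _] := ok _ _ ou; split; first by numeric.
  by right; exists u, k; rewrite No_ofM ?No_of_nat //; numeric.
have RV a z : (forall b u, opt b a u -> omega_ok u) -> opt false (omega_pow a) z ->
    numeric z /\ exists u k, opt false a u /\ No_of z = ((2 ^ k)%:R^-1 * No_of (omega_pow u))%R.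
  move=> ok /opt_omega_pow_right[u [k [ou ->]]].
  have [n1 _ _] := ok _ _ ou; have [n2 e2] := inv_pow2_spec k; split; first by numeric.
  by exists u, k; rewrite No_ofM // e2.
have p2 k : (0 < (2 ^ k)%:R :> No)%R by rewrite ltr0n expn_gt0.
apply: numeric_pair_ind => [a na ok cmp|a b na nb oka okb ca cb].
  have nW : numeric (omega_pow a).
    apply/numeric_opt; split; last by case=> z oz; [case: (LV _ _ ok oz)|case: (RV _ _ ok oz)].
    move=> z w /(LV _ _ ok)[nz hz] /(RV _ _ ok)[nw [v [m [ov ew]]]].
    have [_ pv _] := ok _ _ ov.
    suff /(ltNoP nz nw)[] : (No_of z < No_of w)%R by [].
    rewrite ew mulrC ltr_pdivlMr //.
    case: hz => [->|[u [k [ou ->]]]]; first by rewrite mul0r.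
    have lt_uv : u < v by exact: glt_trans (numeric_opt_lt na ou) (numeric_opt_lt na ov).
    have /(_ lt_uv) d := (cmp _ _ _ _ ou ov).1.
    by rewrite mulrAC -natrM; exact: d.
  have pW : (0 < No_of (omega_pow a))%R.
    apply/(ltNoP numeric_zero nW); apply: (numeric_opt_lt (b := true) nW).
    by apply/opt_omega_pow_left; left.
  split=> // b u ou; have [nu pu _] := ok _ _ ou.
  case: b ou => ou k.
    rewrite -No_of_nat -No_ofM; try numeric.
    have o : opt true (omega_pow a) (natg k * omega_pow u).
      by apply/opt_omega_pow_left; right; exists u, k.
    by apply/ltNoP; [numeric|numeric|exact: (numeric_opt_lt nW o)].
  have [n2 e2] := inv_pow2_spec k.
  have o : opt false (omega_pow a) (inv (natg (Nat.pow 2 k)) * omega_pow u).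
    by apply/opt_omega_pow_right; exists u, k.
  have := numeric_opt_lt nW o => /ltNoP-/(_ nW (numeric_mul n2 nu)).
  rewrite No_ofM // e2 mulrC ltr_pdivlMr // mulrC; apply: le_lt_trans.
  (* The right options bound only the multiples by powers of 2; [k < 2 ^ k] gives all integer
     multiples. *)
  by rewrite ler_pM2r // ler_nat ltnW // ltn_expl.
have [na1 pa ha] := oka; have [nb1 pb hb] := okb.
have okao c u : opt c a u -> omega_ok u by move=> /ca[].
have okbo c u : opt c b u -> omega_ok u by move=> /cb[].
split.
  move=> [_ nle]; case: (not_le_ex nle) => -[u ou le'].
    have nu := numeric_opt_num nb ou; have [_ _ [c1 c2]] := cb _ _ ou; have d := hb _ _ ou.
    apply: le_dominated_trans d; case: (game_trichotomy na nu) => h.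
    - by rewrite (c2 h).
    - exact: ltW (dominated_lt (c1 h)).
    - by case: h.
  have nu := numeric_opt_num na ou; have [_ [c1 c2] _] := ca _ _ ou; have d := ha _ _ ou.
  apply: dominated_le_trans d _; case: (game_trichotomy nu nb) => h.
  - by rewrite (c2 h).
  - exact: ltW (dominated_lt (c1 h)).
  - by case: h.
have le_step x y : numeric x -> numeric y -> x == y -> omega_ok x -> omega_ok y ->
    (forall c u, opt c x u -> [/\ omega_ok u, omega_cmp u y & omega_cmp y u]) ->
    (forall c u, opt c y u -> [/\ omega_ok u, omega_cmp u x & omega_cmp x u]) ->
    omega_pow x <= omega_pow y.
  move=> nx ny e [nWx px _] [nWy py _] cx cy.
  have okx c u : opt c x u -> omega_ok u by move=> /cx[].
  have oky c u : opt c y u -> omega_ok u by move=> /cy[].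
  apply/le_opt; split=> z oz.
    have [nz hz] := LV _ _ okx oz; move=> /(leNoP nWy nz); apply/negP; rewrite -ltNge.
    case: hz => [->//|[u [k [ou ->]]]]; have [_ [c _] _] := cx _ _ ou.
    by apply: c; exact: glt_le_trans (numeric_opt_lt nx ou) e.1.
  have [nz [u [k [ou hz]]]] := RV _ _ oky oz; move=> /(leNoP nz nWx); apply/negP; rewrite -ltNge.
  have [_ _ [c _]] := cy _ _ ou; rewrite hz mulrC ltr_pdivlMr // mulrC.
  by apply: c; exact: gle_lt_trans e.1 (numeric_opt_lt ny ou).
move=> e; apply: No_of_eq => //; split; apply: le_step => //; exact: eqg_sym.
Qed.

Lemma numeric_omega_pow a : numeric a -> numeric (omega_pow a).
Proof. by move=> /omega_okP.1[]. Qed.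

Lemma omega_pow_gt0 a : numeric a -> (0 < No_of (omega_pow a))%R.
Proof. by move=> /omega_okP.1[]. Qed.

Lemma omega_pow_dom a b : numeric a -> numeric b -> (No_of a < No_of b)%R ->
  dominated (No_of (omega_pow a)) (No_of (omega_pow b)).
Proof. by move=> na nb /(ltNoP na nb); exact: (omega_okP.2 _ _ na nb).1. Qed.

Lemma omega_pow_eq a b : numeric a -> numeric b -> No_of a = No_of b ->
  No_of (omega_pow a) = No_of (omega_pow b).
Proof. by move=> na nb /(No_ofP na nb); exact: (omega_okP.2 _ _ na nb).2. Qed.

Lemma opt_omega b z : opt b omega z <-> b /\ exists n, z = natg n.
Proof.
case: b; split; last by case.
- by move=> [n ->]; split=> //; exists n.
- by move=> [_ [n ->]]; exists n.
- by case.
Qed.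

Lemma numeric_omega : numeric omega.
Proof.
apply/numeric_opt; split=> [z w _ /opt_omega[]//|b z /opt_omega[_ [n ->]]].
exact: numeric_nat.
Qed.

Lemma omega_gt_nat n : (n%:R < No_of omega)%R.
Proof.
rewrite -No_of_nat; apply/ltNoP; [numeric|exact: numeric_omega|].
by apply: (numeric_opt_lt (b := true) numeric_omega); apply/opt_omega; split=> //; exists n.
Qed.

Lemma omega_pow_zero : No_of (omega_pow zero) = 1%R.
Proof.
apply: No_of_eq; [exact: numeric_omega_pow numeric_zero|numeric|apply: eqg_opts => -[] z].
- move=> /opt_omega_pow_left[->|[u [k [/opt_zero]]]//].
  by exists zero => //; exact/opt_natS.
- by move=> /opt_omega_pow_right[u [k [/opt_zero]]].
- by move=> /opt_natS[_ ->]; exists zero => //; apply/opt_omega_pow_left; left.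
- by move=> /opt_natS[].
Qed.

Lemma omega_pow_one : omega_pow one == omega.
Proof.
have e n : natg n * omega_pow zero == natg n.
  have n0 := numeric_omega_pow numeric_zero.
  by apply/No_ofP; [numeric|numeric|rewrite No_ofM ?omega_pow_zero ?mulr1 //; numeric].
apply: eqg_opts => -[] z.
- move=> /opt_omega_pow_left[->|[u [k [/opt_natS[_ ->] ->]]]].
    by exists (natg 0) => //; apply/opt_omega; split=> //; exists 0.
  by exists (natg k) => //; apply/opt_omega; split=> //; exists k.
- by move=> /opt_omega_pow_right[u [k [/opt_natS[]]]].
- move=> /opt_omega[_ [n ->]]; exists (natg n * omega_pow zero) => //.
  by apply/opt_omega_pow_left; right; exists zero, n; split=> //; apply/opt_natS.
- by move=> /opt_omega[].
Qed.

(** * The logarithm of omega *)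

(* [omega_root j] is [omega ^ (1 / 2 ^ j)]. *)
Fixpoint omega_root (j : nat) : game :=
  if j is j'.+1 then Game nat nat natg (fun m => inv (natg m.+1) * omega_root j')
  else omega.

Lemma opt_root b j z : numeric (omega_root j) -> opt b (omega_root j.+1) z ->
  numeric z /\ exists m : nat, No_of z = if b then m%:R%R else (No_of (omega_root j) / m.+1%:R)%R.
Proof.
move=> nj; case: b => -[m ->].
  by split; [exact: numeric_nat|exists m; rewrite No_of_nat].
have [n1 e1] := numeric_natg_inv m.
by split; [numeric|exists m; rewrite No_ofM // e1 mulrC].
Qed.

Lemma omega_root_step j : numeric (omega_root j) ->
  (forall n : nat, n%:R < No_of (omega_root j))%R ->
  [/\ numeric (omega_root j.+1), forall n : nat, (n%:R < No_of (omega_root j.+1))%R &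
      dominated (No_of (omega_root j.+1)) (No_of (omega_root j))].
Proof.
move=> nj hj; have O := opt_root nj.
have n1 : numeric (omega_root j.+1).
  apply/numeric_opt; split=> [z w /O[nz [m ez]] /O[nw [l ew]]|b z /O[]//].
  suff /(ltNoP nz nw)[] : (No_of z < No_of w)%R by [].
  by rewrite ez ew ltr_pdivlMr ?ltr0n // -natrM.
split=> // [n|n].
  rewrite -No_of_nat; apply/ltNoP; [numeric|numeric|].
  by apply: (numeric_opt_lt (b := true) n1); exists n.
have o : opt false (omega_root j.+1) (inv (natg n.+1) * omega_root j) by exists n.
have [no _] := O _ _ o; have := numeric_opt_lt n1 o => /ltNoP-/(_ n1 no).
have [n2 e2] := numeric_natg_inv n.
rewrite No_ofM // e2 mulrC ltr_pdivlMr ?ltr0n // mulrC; apply: le_lt_trans.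
rewrite ler_pM2r ?ler_nat //; have o' : opt true (omega_root j.+1) (natg 0) by exists 0.
by have := numeric_opt_lt n1 o' => /ltNoP-/(_ numeric_zero n1).
Qed.

Lemma omega_root_inf j : numeric (omega_root j) /\
  forall n : nat, (n%:R < No_of (omega_root j))%R.
Proof.
elim: j => [|j [nj hj]]; first by split; [exact: numeric_omega|exact: omega_gt_nat].
by case: (omega_root_step nj hj).
Qed.

(** The right options of [omega_root i.+1] are fractions of [omega_root i], which must be known to
    be its square. For [j = 0] the hypothesis is void, as [omega] has no right options. *)
Lemma omega_root_sqr_step j :
  (forall i, j = i.+1 -> No_of (omega_root j) ^+ 2 = No_of (omega_root i))%R ->
  (No_of (omega_root j.+1) ^+ 2 = No_of (omega_root j))%R.
Proof.
move=> IH; have [nu hu] := omega_root_inf j; have [ny hy dy] := omega_root_step nu hu.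
have O := opt_root nu; set y := omega_root j.+1 in ny hy dy O *; set u := omega_root j in nu hu dy O *.
have u0 : (0 < No_of u)%R by exact: (hu 0).
have y0 : (0 < No_of y)%R by exact: (hy 0).
have nyy : numeric (y * y) by numeric.
suff H : y * y == u by rewrite expr2 -No_ofM //; exact: No_of_eq.
have OV b z : opt b (y * y) z -> if b then (No_of z < No_of u)%R else (No_of u < No_of z)%R.
  move=> /opt_mul[s [v [w [/O[nv [k ev]] /O[nw [l ew]] ->]]]].
  rewrite !(No_ofD, No_ofM, No_ofN); try numeric.
  rewrite {}ev {}ew.
  have mix (p q : nat) :
      (No_of u < p%:R * No_of y + No_of y * (No_of u / q.+1%:R) - p%:R * (No_of u / q.+1%:R))%R.
    have h := hy (p + q.+1)%N; rewrite natrD in h.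
    have q0 : (0 < q.+1%:R :> No)%R by rewrite ltr0n.
    have p0 : (0 <= p%:R :> No)%R by rewrite ler0n.
    apply: (@lt_le_trans _ _ ((No_of y - p%:R) * (No_of u / q.+1%:R)))%R.
      rewrite mulrA ltr_pdivlMr // mulrC ltr_pM2r //; lra.
    by rewrite mulrBl lerB // lerDr mulr_ge0 // ltW.
  case: s; case: b => /=.
  - apply: le_lt_trans _ (dy (k + l)%N); rewrite natrD mulrDl [(No_of y * _)%R]mulrC.
    by rewrite gerBl mulr_ge0 ?ler0n.
  - exact: mix.
  - apply: lt_trans _ (u0).
    have h := dy (k.+1 + l.+1)%N; rewrite natrD in h.
    have k0 : (0 < k.+1%:R :> No)%R by rewrite ltr0n.
    have l0 : (0 < l.+1%:R :> No)%R by rewrite ltr0n.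
    have -> : (No_of u / k.+1%:R * No_of y + No_of y * (No_of u / l.+1%:R) -
        No_of u / k.+1%:R * (No_of u / l.+1%:R) =
        No_of u / k.+1%:R / l.+1%:R * ((k.+1%:R + l.+1%:R) * No_of y - No_of u))%R.
      by field; rewrite !(addrC 1%R) !natr1 !pnatr_eq0.
    by rewrite pmulr_rlt0 ?subr_lt0 // !divr_gt0.
  - by have := mix l k; move: (No_of u / k.+1%:R)%R => a; lra.
have ON b z : opt b (y * y) z -> numeric z by exact: numeric_opt_num.
split; apply/le_opt; split=> z oz.
- by have /(ltNoP (ON _ _ oz) nu)[] := OV _ _ oz.
- have [i ei [m [nz ez]]] : exists2 i, j = i.+1 &
      exists m : nat, numeric z /\ No_of z = (No_of (omega_root i) / m.+1%:R)%R.
    move: oz; rewrite /u; case: (j) => [[]//|i] o; exists i => //.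
    by have [nz [m ez]] := opt_root (omega_root_inf i).1 o; exists m.
  move=> /(leNoP nz nyy); apply/negP; rewrite -ltNge ez -(IH _ ei) -/u No_ofM //.
  rewrite ltr_pdivlMr ?ltr0n //; have h := dy m.+1; have h1 := dy 1%N; rewrite mul1r in h1.
  by rewrite -mulrA expr2 [(_ * m.+1%:R)%R]mulrC; apply: ltr_pM => //; rewrite ltW // mulr_gt0 ?ltr0n.
- have [n ->] : exists n, z = natg n.
    by rewrite /u in oz; case: (j) oz => [|j'] [n ->]; exists n.
  move=> /(leNoP nyy (numeric_nat n)); apply/negP; rewrite -ltNge No_of_nat No_ofM //.
  by have := hy n; have := hy 1%N; nra.
- by have /(ltNoP nu (ON _ _ oz))[] := OV _ _ oz.
Qed.

Lemma omega_root_pow j : (No_of (omega_root j) ^+ (2 ^ j) = No_of omega)%R.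
Proof.
have sq i : (No_of (omega_root i.+1) ^+ 2 = No_of (omega_root i))%R.
  by elim: i => [|i IH]; apply: omega_root_sqr_step => // i' [<-].
by elim: j => [|j IH]; [rewrite expn0 expr1|rewrite expnS exprM sq].
Qed.

(* This is [omega ^ (1 / omega)]. *)
Definition log_omega : game := Game nat nat natg omega_root.

Lemma opt_log_omega b z : opt b log_omega z <-> exists j, z = if b then natg j else omega_root j.
Proof. by case: b. Qed.

Lemma log_omega_spec :
  [/\ numeric log_omega, forall n : nat, (n%:R < No_of log_omega)%R &
      forall j, dominated (No_of log_omega) (No_of (omega_root j))].
Proof.
have n1 : numeric log_omega.
  apply/numeric_opt; split=> [z w /opt_log_omega[n ->] /opt_log_omega[j ->]|b z /opt_log_omega[j ->]].
    have [nj hj] := omega_root_inf j.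
    suff /(ltNoP (numeric_nat n) nj)[] : (No_of (natg n) < No_of (omega_root j))%R by [].
    by rewrite No_of_nat.
  by case: b; [exact: numeric_nat|exact: (omega_root_inf j).1].
split=> // [n|j].
  rewrite -No_of_nat; apply/ltNoP; [numeric|numeric|].
  by apply: (numeric_opt_lt (b := true) n1); apply/opt_log_omega; exists n.
have [nj hj] := omega_root_inf j; have [nj1 _ d] := omega_root_step nj hj.
apply: le_dominated_trans d; apply/ltW/ltNoP => //.
by apply: (numeric_opt_lt (b := false) n1); apply/opt_log_omega; exists j.+1.
Qed.

Lemma etr_le_pow n (t : No) : (1 <= t)%R -> (etr n t <= n.+1%:R * t ^+ n)%R.
Proof.
move=> t1; elim: n => [|n IH]; first by rewrite etr0 expr0 mulr1.
have t0 : (0 <= t)%R by exact: le_trans t1.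
rewrite etrS -natr1 mulrDl mul1r; apply: lerD.
  apply: le_trans IH _; rewrite ler_wpM2l ?ler0n // exprS ler_peMl ?exprn_ge0 //.
by rewrite ler_piMr ?exprn_ge0 // invf_le1 ?ltr0n ?fact_gt0 // ler1n fact_gt0.
Qed.

Lemma etr_ge_pow n (t : No) : (0 <= t)%R -> (t ^+ n / n`!%:R <= etr n t)%R.
Proof.
case: n => [|n] t0; first by rewrite etr0 expr0 fact0 divr1.
by rewrite etrS lerDr ltW // etr_gt0.
Qed.

Lemma exp_nat_le n : (No_of (exp (natg n)) <= 3 ^+ n)%R.
Proof.
elim: n => [|n IH]; first by rewrite exp_zero expr0.
have [_ h] : exp_rel (natg n) (natg n.+1).
  by apply: exp_relP; [exact: numeric_nat|exact: numeric_nat|rewrite !No_of_nat ltr_nat].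
(* Order 3 is the first odd order with a positive truncation at -1; its value 1/3 is the source of
   the base 3. *)
have := h 3 isT; rewrite !No_of_nat -[(n.+1%:R)%R]natr1.
have -> : (etr 3 (n%:R - (n%:R + 1)) = 3^-1 :> No)%R.
  rewrite (_ : (n%:R - (n%:R + 1) = -1 :> No)%R); last by ring.
  by rewrite !etrS etr0 -[3`!]/6 -[2`!]/2 -[1`!]/1%N; field.
by rewrite exprS => h'; lra.
Qed.

(** The options with odd truncations do not occur, the arguments being negative infinite. The left
    options that remain grow at most like a power of [Z], and all powers of [Z] are below
    [omega]. *)
Lemma exp_log_omega : No_of (exp log_omega) = No_of omega.
Proof.
have [nz zinf zroot] := log_omega_spec; have nE := numeric_exp nz.
set Z := No_of log_omega in zinf zroot *; set W := No_of omega.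
have NE b u : opt b log_omega u -> numeric (exp u).
  by move=> /(numeric_opt_num nz); exact: numeric_exp.
have inf_odd (c : No) k : odd k -> (forall n : nat, n%:R <= c)%R -> (etr k (- c) <= 0)%R.
  by move=> ok h; apply: etr_odd_neg.
have Z1 : (1 < Z)%R by exact: (zinf 1%N).
have Z0 : (0 < Z)%R by exact: lt_trans Z1.
have Zpow k (q : nat) : (q%:R * Z ^+ k < W)%R.
  rewrite /W -(omega_root_pow k.+1); set r := No_of _.
  have d := zroot k.+1; rewrite -/r in d.
  have Zr : (Z < r)%R by exact: dominated_lt.
  have r1 : (1 < r)%R by exact: lt_trans Zr.
  have r0 : (0 < r)%R by exact: lt_trans r1.
  apply: (@le_lt_trans _ _ (q%:R * r ^+ k))%R.
    by rewrite ler_wpM2l ?ler0n //; apply: lerXn2r; rewrite ?nnegrE ltW.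
  apply: (@lt_le_trans _ _ (r ^+ k.+1)%R).
    by rewrite exprS ltr_pM2r ?exprn_gt0 //; exact: (omega_root_inf k.+1).2.
  by apply: (ler_weXn2l (ltW r1)); apply: ltnW; apply: ltn_expl.
apply: No_of_eq => //; first exact: numeric_omega.
split; apply/le_opt; split=> z oz.
- have [nz' h] := exp_left_value nz NE oz.
  move=> /(leNoP numeric_omega nz'); apply/negP; rewrite -ltNge -/W.
  case: h => [->|[u [n [/opt_log_omega[j ->] ->]]]|[u [k [/opt_log_omega[j ->] ok hk _]]]].
  + exact: (omega_gt_nat 0).
  + rewrite No_of_nat -/Z.
    apply: (@le_lt_trans _ _ ((3 ^ j * n.+1)%:R * Z ^+ n))%R; last exact: Zpow.
    rewrite natrM natrX -mulrA; apply: ler_pM; rewrite ?exp_nat_le //.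
    * by rewrite ltW // exp_gt0 //; exact: numeric_nat.
    * by rewrite ltW // etr_gt0 // subr_ge0 ltW.
    * apply: le_trans (etr_le_pow n (ltW Z1)); apply: etr_le; first by rewrite subr_ge0 ltW.
      by rewrite gerBl ler0n.
  + exfalso; move: hk; apply/negP; rewrite -leNgt; apply: inf_odd => // n; rewrite -/Z lerBrDl.
    have := zroot j 2; have := zinf n; lra.
- by move: oz => /opt_omega[].
- move: oz => /opt_omega[_ [n ->]] /(leNoP nE (numeric_nat n)); apply/negP; rewrite -ltNge No_of_nat.
  have := exp_ge_trunc 1 numeric_zero nz Z0; rewrite exp_zero mul1r No_of0 subr0 -/Z.
  by apply: lt_trans; rewrite etrS etr0 expr1 divr1; have := zinf n; lra.
- have [nz' h] := exp_right_value nz NE oz.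
  move=> /(leNoP nz' numeric_omega); apply/negP; rewrite -ltNge -/W.
  case: h => [[u [k [/opt_log_omega[j ->] ->]]]|[u [k [/opt_log_omega[n ->] ok hk _]]]]; last first.
    exfalso; move: hk; apply/negP; rewrite -leNgt; apply: inf_odd => // m; rewrite No_of_nat -/Z lerBrDl -natrD.
    exact: ltW.
  have [nr rinf] := omega_root_inf j; rewrite -/Z; set r := No_of (omega_root j).
  have Zr : (Z < r)%R by exact: dominated_lt (zroot j).
  have r1 : (1 < r)%R by exact: lt_trans Zr.
  have r0 : (0 < r)%R by exact: lt_trans r1.
  rewrite ltr_pdivlMr; last by rewrite etr_gt0 // subr_ge0 ltW.
  apply: (@le_lt_trans _ _ (W * (k.+1%:R * r ^+ k)))%R.
    rewrite ler_pM2l; last exact: (omega_gt_nat 0).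
    apply: le_trans (etr_le_pow k (ltW r1)); apply: etr_le; first by rewrite subr_ge0 ltW.
    by rewrite gerBl ltW.
  (* Since [r ^ (2 ^ j) = omega], this order gives [omega * r ^ (k + 1)] up to an integer factor.
     The extra power of the infinite [r] beats all integers and the denominator of order [r ^ k]. *)
  have := exp_ge_trunc (2 ^ j + k.+1) numeric_zero nr r0.
  rewrite exp_zero mul1r No_of0 subr0 -/r; apply: le_lt_trans.
  apply: le_trans (etr_ge_pow _ (ltW r0)).
  rewrite ler_pdivlMr ?ltr0n ?fact_gt0 // exprD omega_root_pow -/W -mulrA ler_pM2l; last exact: (omega_gt_nat 0).
  rewrite exprS mulrAC ler_pM2r ?exprn_gt0 // -natrM.
  exact: ltW (rinf _).
Qed.

Lemma log_omega_ok : numeric (log omega) /\ No_of (exp (log omega)) = No_of omega.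
Proof.
have H : exists z, numeric z /\ exp z == omega.
  have [nz _ _] := log_omega_spec; exists log_omega; split=> //.
  by apply/No_ofP; [exact: numeric_exp|exact: numeric_omega|exact: exp_log_omega].
have [n e] : numeric (log omega) /\ exp (log omega) == omega by exact: (ClassicalEpsilon.epsilon_spec _ _ H).
by split=> //; apply: No_of_eq => //; [exact: numeric_exp|exact: numeric_omega].
Qed.

Lemma log_omega_inf (n : nat) : (n%:R < No_of (log omega))%R.
Proof.
have [nl el] := log_omega_ok; rewrite ltNge; apply/negP.
rewrite -No_of_nat -exp_le ?el; [|by []|exact: numeric_nat].
apply/negP; rewrite -ltNge; apply: le_lt_trans (exp_nat_le n) _.
by rewrite -natrX; exact: omega_gt_nat.
Qed.

Lemma log_omega_dom : dominated (No_of (log omega)) (No_of omega).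
Proof.
have [nl el] := log_omega_ok; have linf := log_omega_inf => k.
have l0 : (0 < No_of (log omega))%R by exact: (linf 0).
have := exp_ge_trunc 2 numeric_zero nl l0; rewrite exp_zero mul1r No_of0 subr0 el; apply: lt_trans.
rewrite !etrS etr0 expr1 !factS fact0 /= divr1.
have := linf (k * 2)%N; rewrite natrM; nra.
Qed.

(** * Comparison of normal forms *)

Lemma created_no_later_opt x y : created_no_later x y <->
  forall b x', opt b x x' -> exists c y', opt c y y' /\ created_no_later x' y'.
Proof.
case: x y => XL XR xl xr [YL YR yl yr]; split.
  move=> [h1 h2] [] _ [i ->].
    by case: (h1 i) => -[j hj]; [exists true, (yl j)|exists false, (yr j)]; split=> //; exists j.
  by case: (h2 i) => -[j hj]; [exists true, (yl j)|exists false, (yr j)]; split=> //; exists j.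
move=> h; split=> i.
  by have [|[] [_ [[j ->] hj]]] := h true (xl i); first (by exists i); [left|right]; exists j.
by have [|[] [_ [[j ->] hj]]] := h false (xr i); first (by exists i); [left|right]; exists j.
Qed.

Lemma created_no_later_trans x y z :
  created_no_later x y -> created_no_later y z -> created_no_later x z.
Proof.
elim/opt_ind: x y z => x IH y z /created_no_later_opt h1 /created_no_later_opt h2.
apply/created_no_later_opt => b x' ox; have [c [y' [oy h]]] := h1 _ _ ox.
have [d [z' [oz h']]] := h2 _ _ oy; exists d, z'; split=> //; exact: IH ox _ _ h h'.
Qed.

Lemma created_earlier b x x' : opt b x x' -> ~ created_no_later x x'.
Proof.
elim/opt_ind: x b x' => x IH b x' ox /created_no_later_opt h.
by have [c [y [oy]]] := h _ _ ox; exact: IH ox _ _ oy.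
Qed.

(** Two distinct solutions have representatives of least birthday, and an option of one of these
    lies weakly between them. By convexity it satisfies [C], although it is created before its
    parent. *)
Lemma simplest_unique (C : game -> Prop) z1 z2 :
  (forall u v w, numeric u -> numeric v -> numeric w -> C u -> C w -> u <= v -> v <= w -> C v) ->
  simplest C z1 -> simplest C z2 -> z1 == z2.
Proof.
move=> conv.
have key y1 y2 : simplest C y1 -> simplest C y2 -> y1 < y2 -> False.
  move=> [n1 [c1 b1]] [n2 [c2 b2]] lt12.
  have [g1 [m1 [e1 h1]]] := b1 _ n1 c1; have [g2 [m2 [e2 h2]]] := b2 _ n2 c2.
  have [_ nle] : g1 < g2 by apply: eqg_lt lt12; apply: eqg_sym.
  case: (not_le_ex nle) => -[u ou le'].
    have nu := numeric_opt_num m2 ou; have [ltu _] := numeric_opt_lt m2 ou.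
    have cu : C u.
      by apply: (conv y1 u y2) => //; [exact: gle_trans e1.2 le'|exact: gle_trans ltu e2.1].
    have [g [mg [eg hg]]] := b2 _ nu cu.
    apply: (created_earlier ou); apply: created_no_later_trans (h2 _ mg eg) (hg _ nu (eqg_refl _)).
  have nu := numeric_opt_num m1 ou; have [ltu _] := numeric_opt_lt m1 ou.
  have cu : C u.
    by apply: (conv y1 u y2) => //; [exact: gle_trans e1.2 ltu|exact: gle_trans le' e2.1].
  have [g [mg [eg hg]]] := b1 _ nu cu.
  apply: (created_earlier ou); apply: created_no_later_trans (h1 _ mg eg) (hg _ nu (eqg_refl _)).
move=> s1 s2; case: (game_trichotomy s1.1 s2.1) => // h; exfalso.
  exact: key s1 s2 h.
exact: key s2 s1 h.
Qed.

(** * Real coefficients and archimedean classes *)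

Lemma real_le (r s : game) : is_real r -> is_real s ->
  (forall n : nat, (No_of r < No_of s + n.+1%:R^-1)%R) -> (No_of r <= No_of s)%R.
Proof.
move=> [nr [_ er]] [ns [_ es]] h; apply/leNoP => //.
apply: gle_trans er.1 _; apply: gle_trans _ es.2.
have V t n : numeric t -> [/\ numeric (t - inv (natg n.+1)), numeric (t + inv (natg n.+1)),
    No_of (t - inv (natg n.+1)) = (No_of t - n.+1%:R^-1)%R &
    No_of (t + inv (natg n.+1)) = (No_of t + n.+1%:R^-1)%R].
  move=> nt; have [ni ei] := numeric_natg_inv n.
  by split; rewrite ?No_ofD ?No_ofN ?ei //; numeric.
apply/le_opt; split=> _ [n ->].
  have [n1 _ e1 _] := V r n nr; move=> le'; have := gle_trans es.1 le' => /(leNoP ns n1).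
  by apply/negP; rewrite -ltNge e1 ltrBlDr.
have [_ n1 _ e1] := V s n ns; move=> le'; have := gle_trans le' er.2 => /(leNoP n1 nr).
by apply/negP; rewrite -ltNge e1.
Qed.

(** A real is the cut of its translates by [1/n], so distinct reals cannot differ by an
    infinitesimal. Hence a nonzero difference of coefficients does not change the archimedean class
    of a monomial. *)
Lemma real_sep (r s : game) : is_real r -> is_real s -> No_of r != No_of s ->
  exists n : nat, (n.+1%:R^-1 <= `|No_of r - No_of s|)%R.
Proof.
move=> hr hs ne; apply: contrapT => hn.
have H n : (`|No_of r - No_of s| < n.+1%:R^-1)%R.
  by rewrite ltNge; apply/negP => h; apply: hn; exists n.
case/eqP: ne; apply/eqP; rewrite eq_le; apply/andP; split; apply: real_le => // n.
  by have := H n; rewrite ltr_norml; move: (n.+1%:R^-1)%R => e /andP[]; lra.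
by have := H n; rewrite ltr_norml; move: (n.+1%:R^-1)%R => e /andP[]; lra.
Qed.

Lemma real_bound (r : game) : is_real r -> exists n : nat, (`|No_of r| < n%:R)%R.
Proof.
move=> [nr [[n [h1 h2]] _]]; exists n; rewrite ltr_norml -No_of_nat -No_ofN; last exact: numeric_nat.
by apply/andP; split; apply/ltNoP => //; numeric.
Qed.

Lemma is_real_nat n : is_real (natg n).
Proof.
have V m : [/\ numeric (natg n - inv (natg m.+1)), numeric (natg n + inv (natg m.+1)),
    No_of (natg n - inv (natg m.+1)) = (n%:R - m.+1%:R^-1)%R &
    No_of (natg n + inv (natg m.+1)) = (n%:R + m.+1%:R^-1)%R].
  have [ni ei] := numeric_natg_inv m.
  by split; rewrite ?No_ofD ?No_ofN ?ei ?No_of_nat //; numeric.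
have I m : (0 < m.+1%:R^-1 :> No)%R by rewrite invr_gt0 ltr0n.
have nn := numeric_nat n.
split=> //; split.
  have n1 := numeric_nat n.+1.
  exists n.+1; split; apply/ltNoP; try numeric; rewrite ?No_ofN // !No_of_nat ?ltr_nat //.
  by rewrite -natr1; have := ler0n No n; lra.
set G := Game _ _ _ _.
have nG : numeric G.
  apply: (@numeric_between _ (natg n)) => -[] _ [m ->]; have [n1 n2 e1 e2] := V m; split=> //.
    by apply/ltNoP => //; rewrite e1 No_of_nat; have := I m; move: (m.+1%:R^-1)%R => e he; lra.
  by apply/ltNoP => //; rewrite e2 No_of_nat; have := I m; move: (m.+1%:R^-1)%R => e he; lra.
split; apply/le_opt; split.
- case: n @G V nn nG => [|n] G V nn nG z; first by move/opt_zero.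
  move=> /opt_natS[_ ->] /(leNoP nG (numeric_nat n)); apply/negP; rewrite -ltNge.
  have [n1 _ e1 _] := V 0; have -> : No_of (natg n) = No_of (natg n.+1 - inv (natg 1)).
    by rewrite e1 No_of_nat invr1 -natr1; ring.
  by apply/ltNoP => //; apply: (numeric_opt_lt (b := true) nG); exists 0.
- move=> _ [m ->]; have [_ n2 _ e2] := V m; move=> /(leNoP n2 nn); apply/negP.
  by rewrite -ltNge e2 No_of_nat; have := I m; move: (m.+1%:R^-1)%R => e he; lra.
- move=> _ [m ->]; have [n1 _ e1 _] := V m; move=> /(leNoP nn n1); apply/negP.
  by rewrite -ltNge e1 No_of_nat; have := I m; move: (m.+1%:R^-1)%R => e he; lra.
- by case: (n) => [|m] z; [move/opt_zero|move/opt_natS => -[]].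
Qed.

(* [u] and [v > 0] belong to the same archimedean class. *)
Definition arch_equiv (u v : No) : Prop :=
  exists k : nat, (`|u| <= k%:R * v)%R /\ (v <= k%:R * `|u|)%R.

Lemma dominated_add (u u' v : No) : dominated `|u|%R v -> dominated `|u'|%R v ->
  dominated `|u + u'|%R v.
Proof.
move=> h h' k; have := h (k * 2)%N; have := h' (k * 2)%N; rewrite natrM.
have := ler_normD u u'; have := normr_ge0 u; have := normr_ge0 u'.
have : (0 <= k%:R :> No)%R by rewrite ler0n.
by move: (`|u|)%R (`|u'|)%R (`|u + u'|)%R (k%:R)%R => *; nra.
Qed.

Lemma dominated_norm0 (v : No) : (0 < v)%R -> dominated `|0 : No|%R v.
Proof. by move=> h k; rewrite normr0 mulr0. Qed.

Lemma arch_equivN (u v : No) : arch_equiv u v -> arch_equiv (- u)%R v.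
Proof. by rewrite /arch_equiv normrN. Qed.

Lemma arch_equiv_add (u u' v : No) : (0 < v)%R -> arch_equiv u v -> dominated `|u'|%R v ->
  arch_equiv (u + u')%R v.
Proof.
move=> v0 [k [h1 h2]] h; exists (2 * k + 1)%N; rewrite natrD natrM.
have k0 : (0 <= k%:R :> No)%R by rewrite ler0n.
have := h (2 * k)%N; have := h 1%N; rewrite natrM => h3 h4.
have h5 := ler_normD u u'; have h6 := lerB_normD u u'.
have h7 := normr_ge0 u; have h8 := normr_ge0 u'; have h9 := normr_ge0 (u + u')%R.
move: (`|u|)%R (`|u'|)%R (`|u + u'|)%R (k%:R)%R h1 h2 h3 h4 h5 h6 h7 h8 h9 k0 => A B C K *.
split; nra.
Qed.

Lemma arch_equiv_unique a b (u : No) : numeric a -> numeric b ->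
  arch_equiv u (No_of (omega_pow a)) -> arch_equiv u (No_of (omega_pow b)) -> No_of a = No_of b.
Proof.
move=> na nb.
have H c d : numeric c -> numeric d -> (No_of c < No_of d)%R ->
    arch_equiv u (No_of (omega_pow c)) -> arch_equiv u (No_of (omega_pow d)) -> False.
  move=> nc nd lt' [k [h1 h2]] [l [h3 h4]].
  have := omega_pow_dom nc nd lt' (l * k)%N; apply/negP; rewrite -leNgt natrM -mulrA.
  by apply: le_trans h4 _; rewrite ler_wpM2l ?ler0n.
move=> ca cb; case: (ltgtP (No_of a) (No_of b)) => // h; exfalso.
  exact: H h ca cb.
exact: H h cb ca.
Qed.

Lemma arch_equiv_term (c : No) (v : No) : (0 < v)%R -> (exists n : nat, (`|c| < n%:R)%R) ->
  (exists n : nat, (n.+1%:R^-1 <= `|c|)%R) -> arch_equiv (c * v)%R v.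
Proof.
move=> v0 [n hn] [m hm]; exists (n + m.+1)%N; rewrite normrM (gtr0_norm v0) natrD.
have n0 : (0 <= n%:R :> No)%R by rewrite ler0n.
have m0 : (0 < m.+1%:R :> No)%R by rewrite ltr0n.
split; first by rewrite ler_pM2r //; apply: ltW; lra.
rewrite mulrA -[X in (X <= _)%R]mul1r ler_pM2r //.
move: hm; rewrite -[X in (X <= _)%R]mul1r ler_pdivrMr // => hm.
by rewrite mulrDl [(m.+1%:R * _)%R]mulrC; have := normr_ge0 c; nra.
Qed.

Lemma dominated_term (c : No) (u v : No) : (0 < u)%R -> (exists n : nat, (`|c| < n%:R)%R) ->
  dominated u v -> dominated `|c * u|%R v.
Proof.
move=> u0 [n hn] h k; rewrite normrM (gtr0_norm u0) mulrA.
apply: le_lt_trans _ (h (k * n)%N); rewrite natrM ler_pM2r // ler_wpM2l ?ler0n //.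
exact: ltW.
Qed.

Lemma negligibleP x y : numeric x -> numeric y ->
  negligible x y <-> dominated `|No_of x|%R (No_of y).
Proof.
move=> nx ny; have E k : - y < natg k * x /\ natg k * x < y <-> (k%:R * `|No_of x| < No_of y)%R.
  have -> : (k%:R * `|No_of x| = `|No_of (natg k * x)|)%R.
    by rewrite No_ofM ?No_of_nat ?normrM ?normr_nat //; numeric.
  have n1 : numeric (natg k * x) by numeric.
  have n2 := numeric_opp ny.
  rewrite ltr_norml -No_ofN //; split=> [[h1 h2]|/andP[/(ltNoP n2 n1) h1 /(ltNoP n1 ny) h2]] //.
  by apply/andP; split; apply/ltNoP.
by split=> h k; [apply/E; exact: h|apply/E; exact: h].
Qed.

(** * Remainders of a normal form *)

Section OneNormalForm.

Variables (I : small) (ltI : I -> I -> Prop) (a r S : I -> game).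

(** The partial sums [S], existentially bound in [normal_form], are exposed because the comparison
    of two forms has to match them. *)
Definition nf_family : Prop :=
  [/\ well_founded ltI, (forall i j k, ltI i j -> ltI j k -> ltI i k),
      (forall i j, ltI i j \/ i = j \/ ltI j i), (forall i, numeric (a i)) &
      [/\ (forall i j, ltI i j -> a j < a i), (forall i, is_real (r i) /\ ~ r i == zero) &
          (forall i, numeric (S i) /\ sum_of I ltI a r S (fun j => ltI j i) (S i))]].

Hypothesis nf : nf_family.

Definition nf_term (i : I) : No := (No_of (r i) * No_of (omega_pow (a i)))%R.

Let num_a i : numeric (a i). Proof. by case: nf. Qed.
Let num_S i : numeric (S i). Proof. by case: nf => _ _ _ _ [_ _ /(_ i)[]]. Qed.
Let num_r i : numeric (r i). Proof. by case: nf => _ _ _ _ [_ /(_ i)[[]]]. Qed.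
Let num_w i : numeric (omega_pow (a i)). Proof. exact: numeric_omega_pow. Qed.
Let w_gt0 i : (0 < No_of (omega_pow (a i)))%R. Proof. exact: omega_pow_gt0. Qed.

Lemma nf_decr i j : ltI i j -> (No_of (a j) < No_of (a i))%R.
Proof. by case: nf => _ _ _ _ [h _ _] /h; move/ltNoP; apply. Qed.

Lemma nf_incr i j : (No_of (a j) < No_of (a i))%R -> ltI i j.
Proof.
case: nf => _ _ tot _ _ h; case: (tot i j) => // -[e|/nf_decr]; first by rewrite e ltxx in h.
by rewrite ltNge (ltW h).
Qed.

Lemma nf_inj i j : No_of (a i) = No_of (a j) -> i = j.
Proof.
by case: nf => _ _ tot _ _ e; case: (tot i j) => [/nf_decr|[//|/nf_decr]]; rewrite e ltxx.
Qed.

Lemma nf_bound i : exists n : nat, (`|No_of (r i)| < n%:R)%R.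
Proof. by apply: real_bound; case: nf => _ _ _ _ [_ /(_ i)[]]. Qed.

Lemma nf_term_equiv i : arch_equiv (nf_term i) (No_of (omega_pow (a i))).
Proof.
apply: arch_equiv_term => //; first exact: nf_bound.
case: nf => _ _ _ _ [_ /(_ i)[hr nz] _].
have [|n] := real_sep hr (is_real_nat 0).
  by apply/eqP => /(No_ofP (num_r i) numeric_zero).
by rewrite No_of_nat subr0; exists n.
Qed.

Lemma nf_partial i : numeric (S i + r i * omega_pow (a i)) /\
  No_of (S i + r i * omega_pow (a i)) = (No_of (S i) + nf_term i)%R.
Proof.
have h1 := num_S i; have h2 := num_r i; have h3 := num_w i.
by split; [numeric|rewrite No_ofD ?No_ofM //; numeric].
Qed.

Lemma nf_negligible z i : numeric z ->
  negligible (z - (S i + r i * omega_pow (a i))) (omega_pow (a i)) <->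
  dominated `|No_of z - (No_of (S i) + nf_term i)|%R (No_of (omega_pow (a i))).
Proof.
move=> nz; have [np ep] := nf_partial i; have h := num_w i.
by rewrite -ep -No_ofN // -No_ofD //; [apply: negligibleP; numeric|numeric].
Qed.

Lemma sum_of_last (D : I -> Prop) z l : numeric z -> sum_of I ltI a r S D z ->
  D l -> (forall k, D k -> ~ ltI l k) -> No_of z = (No_of (S l) + nf_term l)%R.
Proof.
move=> nz [h _] Dl hl; have [np <-] := nf_partial l.
by apply: No_of_eq => //; exact: h.
Qed.

(** If [D] has a last index, [z] adds to its partial sum a term of smaller class than all earlier
    ones; otherwise the estimate is the condition among whose solutions [z] is simplest. *)
Lemma sum_of_step (D : I -> Prop) z : numeric z -> sum_of I ltI a r S D z ->
  (forall i j, D i -> ltI j i -> dominated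
     `|No_of (S i) - (No_of (S j) + nf_term j)|%R (No_of (omega_pow (a j)))) ->
  forall j, D j -> dominated `|No_of z - (No_of (S j) + nf_term j)|%R (No_of (omega_pow (a j))).
Proof.
move=> nz hz H j Dj; case: nf => _ _ tot _ _.
case: (pselect (exists l, D l /\ forall k, D k -> ~ ltI l k)) => [[l [Dl hl]]|nl].
  rewrite (sum_of_last nz hz Dl hl); case: (tot j l) => [lt_jl|[->|lt_lj]].
  - rewrite addrAC; apply: dominated_add; first exact: H Dl lt_jl.
    by apply: dominated_term; [exact: w_gt0|exact: nf_bound|apply: omega_pow_dom => //; exact: nf_decr].
  - by rewrite subrr; exact: dominated_norm0.
  - by case: (hl _ Dj).
have [_ [|_ [h _]]] := hz; last by apply/nf_negligible => //; exact: h.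
move=> i Di; apply: contrapT => hn; apply: nl; exists i; split=> // k Dk lt_ik.
by apply: hn; exists k.
Qed.

Lemma nf_rest_partial i j : ltI j i -> dominated
  `|No_of (S i) - (No_of (S j) + nf_term j)|%R (No_of (omega_pow (a j))).
Proof.
case: (nf) => wf tr _ _ [_ _ hS]; elim/(well_founded_ind wf): i j => i IH j lt_ji.
by have [ni hi] := hS i; apply: (sum_of_step ni hi) lt_ji => k l lt_ki; exact: IH.
Qed.

Lemma nf_rest x i : numeric x -> sum_of I ltI a r S (fun _ => True) x ->
  dominated `|No_of x - (No_of (S i) + nf_term i)|%R (No_of (omega_pow (a i))).
Proof.
by move=> nx hx; apply: (sum_of_step nx hx) => // k l _; exact: nf_rest_partial.
Qed.

Lemma nf_rest_equiv x i : numeric x -> sum_of I ltI a r S (fun _ => True) x ->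
  arch_equiv (No_of x - No_of (S i))%R (No_of (omega_pow (a i))).
Proof.
move=> nx hx; have := arch_equiv_add (w_gt0 i) (nf_term_equiv i) (nf_rest i nx hx).
by rewrite (_ : (_ + (_ - _) = No_of x - No_of (S i))%R) //; ring.
Qed.

End OneNormalForm.

(** * The first difference of two normal forms *)

Section TwoNormalForms.

Variables (I : small) (ltI : I -> I -> Prop) (a r S : I -> game).
Variables (J : small) (ltJ : J -> J -> Prop) (b s T : J -> game).
Hypotheses (nfI : nf_family ltI a r S) (nfJ : nf_family ltJ b s T).

Definition nf_match i j : Prop :=
  [/\ No_of (S i) = No_of (T j), No_of (a i) = No_of (b j) & No_of (r i) = No_of (s j)].

Let num_a i : numeric (a i). Proof. by case: nfI. Qed.
Let num_b j : numeric (b j). Proof. by case: nfJ. Qed.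

Lemma match_omega i j : nf_match i j -> No_of (omega_pow (a i)) = No_of (omega_pow (b j)).
Proof. by move=> [_ e _]; exact: omega_pow_eq. Qed.

Lemma match_term i j : nf_match i j ->
  nf_term a r i = nf_term b s j.
Proof. by move=> m; rewrite /nf_term (match_omega m); case: m => _ _ ->. Qed.

(** At a limit both sums are simplest in the same class of numbers, which is convex, so that
    [simplest_unique] applies. *)
Lemma sum_of_match (D : I -> Prop) (E : J -> Prop) z w : numeric z -> numeric w ->
  (forall i, D i -> exists2 j, E j & nf_match i j) ->
  (forall j, E j -> exists2 i, D i & nf_match i j) ->
  sum_of I ltI a r S D z -> sum_of J ltJ b s T E w -> No_of z = No_of w.
Proof.
move=> nz nw DE ED hz hw.
case: (pselect (exists l, D l /\ forall k, D k -> ~ ltI l k)) => [[l [Dl hl]]|nl].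
  have [m Em mt] := DE _ Dl.
  rewrite (sum_of_last nfI nz hz Dl hl) (sum_of_last nfJ nw hw Em).
    by rewrite (match_term mt); case: mt => ->.
  move=> k Ek lt_mk; have [i Di mt'] := ED _ Ek; apply: (hl _ Di); apply: (nf_incr nfI).
  case: mt => _ -> _; case: mt' => _ -> _; exact: (nf_decr nfJ).
have nlD i : D i -> exists k, D k /\ ltI i k.
  move=> Di; apply: contrapT => hn; apply: nl; exists i; split=> // k Dk lt_ik.
  by apply: hn; exists k.
have nlE j : E j -> exists k, E k /\ ltJ j k.
  move=> Ej; have [i Di mt] := ED _ Ej; have [k [Dk lt_ik]] := nlD _ Di.
  have [j' Ej' mt'] := DE _ Dk; exists j'; split=> //; apply: (nf_incr nfJ).
  case: mt => _ <- _; case: mt' => _ <- _; exact: (nf_decr nfI).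
apply: No_of_eq => //.
have [_ /(_ nlD) sz] := hz; have [_ /(_ nlE)[_ [Cw sw]]] := hw.
have E1 y : numeric y -> (forall j, E j -> negligible (y - (T j + s j * omega_pow (b j))) (omega_pow (b j))) ->
    forall i, D i -> negligible (y - (S i + r i * omega_pow (a i))) (omega_pow (a i)).
  move=> ny h i Di; have [j Ej mt] := DE _ Di; have := h _ Ej.
  move=> /(nf_negligible nfJ j ny) h'; apply/(nf_negligible nfI i ny).
  by rewrite (match_term mt) (match_omega mt); case: mt => ->.
have E2 y : numeric y -> (forall i, D i -> negligible (y - (S i + r i * omega_pow (a i))) (omega_pow (a i))) ->
    forall j, E j -> negligible (y - (T j + s j * omega_pow (b j))) (omega_pow (b j)).
  move=> ny h j Ej; have [i Di mt] := ED _ Ej; have := h _ Di.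
  move=> /(nf_negligible nfI i ny) h'; apply/(nf_negligible nfJ j ny).
  by rewrite -(match_term mt) -(match_omega mt); case: mt => <-.
apply: simplest_unique sz _; last first.
  by split=> //; split; [exact: E1|move=> y ny hy; apply: sw => //; exact: E2].
move=> u v t nu nv nt hu ht /(leNoP nu nv) le1 /(leNoP nv nt) le2 i Di.
apply/(nf_negligible nfI i nv); have /(nf_negligible nfI i nu) h1 := hu _ Di.
have /(nf_negligible nfI i nt) h2 := ht _ Di.
move=> k; have := h1 k; have := h2 k; move: (No_of (S i) + nf_term a r i)%R => p.
have k0 : (0 <= k%:R :> No)%R by rewrite ler0n.
have N (q : No) : (k%:R * `|q| = `|k%:R * q|)%R by rewrite normrM (ger0_norm k0).
rewrite !N !ltr_norml => /andP[h3 h4] /andP[h5 h6].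
apply/andP; split.
  by apply: (lt_le_trans h5); rewrite ler_wpM2l // lerB.
by apply: (le_lt_trans _ h4); rewrite ler_wpM2l // lerB.
Qed.

(** If the difference had none of these classes, transfinite induction would match all indices,
    since a first mismatch would make a leading term visible in the difference. *)
Lemma nf_diff x y : numeric x -> numeric y ->
  sum_of I ltI a r S (fun _ => True) x -> sum_of J ltJ b s T (fun _ => True) y ->
  [\/ No_of x = No_of y,
      exists i, arch_equiv (No_of x - No_of y)%R (No_of (omega_pow (a i))) |
      exists j, arch_equiv (No_of x - No_of y)%R (No_of (omega_pow (b j)))].
Proof.
move=> nx ny hx hy.
case: (pselect (exists i, arch_equiv (No_of x - No_of y)%R (No_of (omega_pow (a i))))).
  by constructor 2.
move=> noI; case: (pselect (exists j, arch_equiv (No_of x - No_of y)%R (No_of (omega_pow (b j))))).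
  by constructor 3.
move=> noJ; constructor 1.
have wa i : (0 < No_of (omega_pow (a i)))%R by exact: omega_pow_gt0.
have wb j : (0 < No_of (omega_pow (b j)))%R by exact: omega_pow_gt0.
have [wfI trI totI _ [_ realI sumI]] := nfI; have [wfJ trJ totJ _ [_ realJ sumJ]] := nfJ.
(* The second clause says that the matching leaves no gaps in [J]. The partners of an initial
   segment thus form an initial segment, whose sum is [y] or the partial sum at the least index left
   out. *)
pose H i := exists2 j, nf_match i j & forall j', ltJ j' j -> exists2 i', ltI i' i & nf_match i' j'.
pose im (D : I -> Prop) j := exists2 i, D i & nf_match i j.
have im_init (D : I -> Prop) : (forall i i', D i -> ltI i' i -> D i') -> (forall i, D i -> H i) ->
    forall j j', im D j -> ltJ j' j -> im D j'.
  move=> Dinit DH j j' [i Di mt] lt'; have [j1 mt1 h1] := DH _ Di.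
  have e : j = j1.
    by apply: (nf_inj nfJ); case: mt => _ <- _; case: mt1 => _ <- _.
  by rewrite e in lt'; have [i' lt_i mt'] := h1 _ lt'; exists i' => //; exact: Dinit lt_i.
have min_out (D : I -> Prop) : (forall i i', D i -> ltI i' i -> D i') -> (forall i, D i -> H i) ->
    (forall j, im D j) \/ exists2 j, ~ im D j & forall j', ltJ j' j <-> im D j'.
  move=> Dinit DH; case: (pselect (exists j, ~ im D j)) => [[j nj]|hn]; last first.
    by left=> j; apply: contrapT => nj; apply: hn; exists j.
  right; elim/(well_founded_ind wfJ): j nj => j IH nj.
  case: (pselect (exists2 j', ltJ j' j & ~ im D j')) => [[j' lt' nj']|hn]; first exact: IH lt' nj'.
  exists j => // j'; split=> [lt'|Ej'].
    by apply: contrapT => nj'; apply: hn; exists j'.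
  case: (totJ j' j) => // -[e|lt']; first by rewrite e in Ej'.
  by case: nj; exact: im_init Ej' lt'.
have fst_match (D : I -> Prop) : (forall i, D i -> H i) -> forall i, D i -> exists2 j, im D j & nf_match i j.
  by move=> DH i Di; have [j mt _] := DH _ Di; exists j => //; exists i.
have allH i : H i.
  elim/(well_founded_ind wfI): i => i IH.
  pose D i' := ltI i' i.
  have Dinit k k' : D k -> ltI k' k -> D k' by move=> h h'; exact: trI h' h.
  have [nSi sSi] := sumI i; case: (min_out D Dinit IH) => [allJ|[j nj hj]].
    have e : No_of (S i) = No_of y.
      apply: (@sum_of_match D (fun _ => True)) => // k Dk.
        by have [j _ mt] := fst_match _ IH _ Dk; exists j.
      exact: allJ.
    by case: noI; exists i; rewrite -e; exact: (nf_rest_equiv nfI i nx hx).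
  have [nTj sTj] := sumJ j.
  have e : No_of (S i) = No_of (T j).
    apply: (@sum_of_match D (fun j' => ltJ j' j)) => // k.
      by move=> Dk; have [j' Ej' mt] := fst_match _ IH _ Dk; exists j' => //; apply/hj.
    by move/hj.
  have ex := nf_rest_equiv nfI i nx hx; have ey := nf_rest_equiv nfJ j ny hy.
  have rx := nf_rest nfI i nx hx; have ry := nf_rest nfJ j ny hy.
  have dom (u : No) c c' : numeric c -> numeric c' -> (No_of c < No_of c')%R ->
      arch_equiv u (No_of (omega_pow c)) -> dominated `|u|%R (No_of (omega_pow c')).
    move=> nc nc' lt' [k [h1 _]] l; apply: le_lt_trans _ (omega_pow_dom nc nc' lt' (l * k)%N).
    by rewrite natrM -mulrA ler_wpM2l ?ler0n.
  (* As [S i] and [T j] agree, the difference of [x] and [y] is that of two remainders. The larger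
     exponent determines its class; for equal exponents the difference of the coefficients does,
     unless it vanishes and the indices match. *)
  case: (ltgtP (No_of (a i)) (No_of (b j))) => hab.
  - case: noJ; exists j; rewrite -opprB; apply: arch_equivN.
    have := arch_equiv_add (wb j) ey _; move=> /(_ (- (No_of x - No_of (S i))))%R.
    rewrite normrN => /(_ (dom _ _ _ (num_a i) (num_b j) hab ex)).
    by rewrite e (_ : (_ - _ - (_ - _) = No_of y - No_of x)%R) //; ring.
  - case: noI; exists i.
    have := arch_equiv_add (wa i) ex _; move=> /(_ (- (No_of y - No_of (T j))))%R.
    rewrite normrN => /(_ (dom _ _ _ (num_b j) (num_a i) hab ey)).
    by rewrite e (_ : (_ - _ - (_ - _) = No_of x - No_of y)%R) //; ring.
  - case: (eqVneq (No_of (r i)) (No_of (s j))) => [er|ner].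
      exists j; first by split.
      by move=> j' /hj[i' lt' mt]; exists i'.
    case: noI; exists i; have ew := omega_pow_eq (num_a i) (num_b j) hab.
    rewrite -ew in ry; have [hr _] := realI i; have [hs _] := realJ j.
    have h0 : arch_equiv ((No_of (r i) - No_of (s j)) * No_of (omega_pow (a i)))%R (No_of (omega_pow (a i))).
      apply: arch_equiv_term => //; last exact: real_sep.
      have [n hn] := real_bound hr; have [m hm] := real_bound hs; exists (n + m)%N.
      by rewrite natrD; apply: le_lt_trans (ler_normB _ _) _; exact: ltrD.
    have := arch_equiv_add (wa i) (arch_equiv_add (wa i) h0 rx) _.
    move=> /(_ (- (No_of y - (No_of (T j) + nf_term b s j))))%R; rewrite normrN => /(_ ry).
    rewrite /nf_term -ew e (_ : (_ * _ + (_ - _) - (_ - _) = No_of x - No_of y)%R) //; ring.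
have Dinit (k k' : I) : True -> ltI k' k -> True by [].
have DH (i : I) : True -> H i by [].
case: (min_out _ Dinit DH) => [allJ|[j nj hj]].
  apply: (@sum_of_match (fun _ => True) (fun _ => True)) => // k _; last exact: allJ.
  by have [j _ mt] := fst_match _ DH k Logic.I; exists j.
have [nTj sTj] := sumJ j.
have e : No_of x = No_of (T j).
  apply: (@sum_of_match (fun _ => True) (fun j' => ltJ j' j)) => // k.
    by move=> Dk; have [j' Ej' mt] := fst_match _ DH k Dk; exists j' => //; apply/hj.
  by move/hj.
case: noJ; exists j; rewrite e -opprB; apply: arch_equivN; exact: (nf_rest_equiv nfJ j ny hy).
Qed.

End TwoNormalForms.

Lemma normal_form_family (I : small) (ltI : I -> I -> Prop) (a r : I -> game) x :
  normal_form I ltI a r x ->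
  exists2 S, nf_family ltI a r S & sum_of I ltI a r S (fun _ => True) x.
Proof.
by move=> [wf [tr [tot [na [dec [re [S [hS hx]]]]]]]]; exists S => //; split.
Qed.

Lemma hahn_diff (P : game -> Prop) x y : hahn P x -> hahn P y -> No_of x = No_of y \/
  exists a, [/\ numeric a, P (omega_pow a) &
                arch_equiv (No_of x - No_of y)%R (No_of (omega_pow a))].
Proof.
move=> [nx [I [ltI [a [r [/normal_form_family[S nfI hx] Pa]]]]]].
move=> [ny [J [ltJ [b [s [/normal_form_family[T nfJ hy] Pb]]]]]].
case: (nf_diff nfI nfJ nx ny hx hy) => [->|[i h]|[j h]]; first by left.
  by right; exists (a i); split=> //; case: nfI.
by right; exists (b j); split=> //; case: nfJ.
Qed.

Lemma simplest_zero (C : game -> Prop) : C zero -> simplest C zero.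
Proof.
move=> h; split; first exact: numeric_zero.
split=> // y ny _; exists zero; split; first exact: numeric_zero.
by split=> // z nz _; apply/created_no_later_opt => b z' /opt_zero.
Qed.

Lemma hahn_zero (P : game -> Prop) : hahn P zero.
Proof.
split; first exact: numeric_zero.
exists Empty_set, (fun _ _ => False), (Empty_set_rect _), (Empty_set_rect _).
split; last by case.
do 6![split; first by case].
exists (Empty_set_rect _); split; first by case.
(* The empty sum falls under the limit clause: it is the simplest of all numbers. *)
by split; [case|move=> _; apply: simplest_zero; case].
Qed.

Lemma intg_spec k : numeric (intg k) /\
  exists p q : nat, No_of (intg k) = (p%:R - q%:R)%R.
Proof.
case: k => [|p|p] /=.
- by split; [numeric|exists 0, 0; rewrite subr0].
- by split; [numeric|exists (BinPos.Pos.to_nat p), 0; rewrite No_of_nat subr0].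
- by split; [numeric|exists 0, (BinPos.Pos.to_nat p); rewrite No_ofN ?No_of_nat ?sub0r //; numeric].
Qed.

Lemma powz_omega_spec k : numeric (powz omega k) /\
  exists p q : nat, No_of (powz omega k) = (No_of omega ^+ p / No_of omega ^+ q)%R.
Proof.
case: k => [|p|p] /=.
- by split; [numeric|exists 0, 0; rewrite expr0 divr1].
- have [h1 h2] := pow_spec (BinPos.Pos.to_nat p) numeric_omega.
  by split=> //; exists (BinPos.Pos.to_nat p), 0; rewrite h2 expr0 divr1.
- have [h1 h2] := pow_spec (BinPos.Pos.to_nat p) numeric_omega.
  have [|n1 e1] := inv_spec h1; first by rewrite h2 expf_neq0 // gt_eqF // (omega_gt_nat 0).
  by split=> //; exists 0, (BinPos.Pos.to_nat p); rewrite e1 h2 expr0 mul1r.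
Qed.

(** * Gaps in the groups of monomials *)

Lemma GG_numeric n m : GG n m -> numeric m.
Proof. by case: n => [|n] []. Qed.

Lemma GG_eq n m m' : numeric m' -> m' == m -> GG n m -> GG n m'.
Proof.
move=> nm' e; case: n => [|n] [_].
  by move=> [k h]; split=> //; exists k; exact: eqg_trans e h.
move=> [g [t [k [h1 [h2 h]]]]]; split=> //; exists g, t, k; do 2!split=> //.
exact: eqg_trans e h.
Qed.

Definition arg (g t : game) (k : BinNums.Z) : game := g + log omega * (t + intg k).

Lemma arg_spec g t k : numeric g -> numeric t -> numeric (arg g t k) /\
  No_of (arg g t k) = (No_of g + No_of (log omega) * (No_of t + No_of (intg k)))%R.
Proof.
move=> ng nt; have [nk _] := intg_spec k; have [nl _] := log_omega_ok.
split; first by rewrite /arg; numeric.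
by rewrite /arg No_ofD; try numeric; rewrite No_ofM; try numeric; rewrite No_ofD.
Qed.

Lemma GG_one n : GG n one.
Proof.
case: n => [|n]; split; try exact: numeric_nat.
  by exists BinNums.Z0.
have nz := numeric_zero; exists zero, zero, BinNums.Z0; do 2![split; first by split; exact: hahn_zero].
have [na ea] := arg_spec BinNums.Z0 nz nz; apply/No_ofP; [numeric|exact: numeric_exp|].
by rewrite No_of1 -exp_zero; apply: exp_eq => //; rewrite ea No_of0 addr0 mulr0 addr0.
Qed.

Section Separation.
Local Open Scope ring_scope.

(* [D + L E] is either zero or infinite with respect to [L]: no cancellation is
   possible between [D] and [L E]. *)
Lemma main_part_large (M : No -> Prop) (L D E : No) : (forall n : nat, n%:R < L) ->
  (forall G T, M G -> M T -> T < G -> dominated (L * T) G) ->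
  (D = 0 \/ exists2 G, M G & [/\ 0 < G, arch_equiv D G & dominated L G]) ->
  (E = 0 \/ exists2 T, M T & [/\ 0 < T, arch_equiv E T & dominated L T]) ->
  D + L * E = 0 \/ dominated L `|D + L * E|.
Proof.
move=> Linf hM hD hE; have L0 : 0 < L by exact: (Linf 0%N).
have L1 : 1 < L by exact: (Linf 1%N).
have dom (u v w : No) : arch_equiv u v -> dominated w v -> dominated w `|u|.
  move=> [k [_ h2]] h n; have := lt_le_trans (h (k * n)%N) h2; rewrite natrM -mulrA => h3.
  by case: k h2 h3 => [|k] _; rewrite ?mul0r ?ltxx // ltr_pM2l // ltr0n.
case: hD => [->|[G MG [G0 eG dG]]]; case: hE => [->|[T MT [T0 eT dT]]].
- by left; rewrite mulr0 addr0.
- right; rewrite add0r normrM (gtr0_norm L0); apply: (dominated_le_trans (dom _ _ _ eT dT)).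
  by rewrite ler_peMl // ltW.
- by right; rewrite mulr0 addr0; exact: dom eG dG.
right=> n; have T1 : 1 < T by exact: lt_trans L1 (dominated_lt dT).
have n0 : 0 <= n%:R :> No by rewrite ler0n.
(* If [T < G], the gap makes [D] dominate [L * E]. If [G <= T], then [D] is at most of the class of
   [T], which the infinite [L] lifts above it in [L * E]. *)
case: (ltP T G) => cmp.
  have dD := dom _ _ _ eG (hM _ _ MG MT cmp); have [k [hk _]] := eT.
  have h1 := dD (n + k)%N; rewrite natrD in h1.
  have h2 : `|D| - `|L * E| <= `|D + L * E| by exact: lerB_normD.
  have h3 : `|L * E| <= L * (k%:R * T) by rewrite normrM (gtr0_norm L0) ler_pM2l.
  have h4 : n%:R * L <= n%:R * (L * T) by rewrite ler_wpM2l // ler_peMr // ltW.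
  apply: lt_le_trans h2; apply: le_lt_trans h4 _; rewrite ltrBrDr; apply: le_lt_trans h1.
  by rewrite mulrDl lerD2l; apply: le_trans h3 _; rewrite mulrCA.
have [k [hk _]] := eG; have [l [_ hl]] := eT.
have l0 : 0 < l%:R :> No.
  by case: (l) hl => [|i]; rewrite ?ltr0n // mul0r leNgt T0.
(* With [D] at most [k T] and [T] at most [l] times [E] in absolute value, this multiple makes
   [L * E] at least [(k + 1) T]; subtracting [D] leaves [T], which dominates [L]. *)
have h0 := Linf (l * (k + 1))%N; rewrite natrM natrD in h0.
have h2 : `|L * E| - `|D| <= `|D + L * E| by rewrite [D + _]addrC; exact: lerB_normD.
have h3 : `|D| <= k%:R * T by apply: le_trans hk _; rewrite ler_wpM2l // ler0n.
have h4 : (k%:R + 1) * T <= `|L * E|.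
  rewrite normrM (gtr0_norm L0) -(ler_pM2l l0) [X in X <= _]mulrA; apply: (@le_trans _ _ (L * (l%:R * `|E|))).
    apply: ler_pM; [|exact: ltW|exact: ltW|exact: hl].
    by rewrite mulr_ge0 ?addr_ge0 ?ler0n ?ler01.
  by rewrite mulrCA.
apply: lt_le_trans (dT n) _; apply: le_trans h2; lra.
Qed.

(** If [D + L * E] vanishes, a positive integer multiple of [L] remains. Otherwise it exceeds
    [(p + q + 1) L] in absolute value: the integer part cannot change its sign, and at least one [L]
    is left over. *)
Lemma separation (L D E : No) (p q : nat) : (forall n : nat, n%:R < L) ->
  (D + L * E = 0 \/ dominated L `|D + L * E|) ->
  0 < D + L * (E + (p%:R - q%:R)) -> L <= D + L * (E + (p%:R - q%:R)).
Proof.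
move=> Linf; have L0 : 0 < L by exact: (Linf 0%N).
rewrite mulrDr addrA; case=> [->|h].
  rewrite add0r pmulr_rgt0 // subr_gt0 ltr_nat => lt_qp.
  by rewrite ler_peMr ?(ltW L0) // lerBrDr nat1r ler_nat.
move: (D + L * E) (h (p + q + 1)%N) => {h}S.
rewrite !natrD; have p0 : 0 <= p%:R :> No by rewrite ler0n.
have q0 : 0 <= q%:R :> No by rewrite ler0n.
move: (p%:R) (q%:R) p0 q0 => P Q P0 Q0.
by case: (ger0P S) => hS h1 h2; nra.
Qed.
End Separation.

Lemma GG_zero_value m : GG 0 m ->
  exists p q : nat, No_of m = (No_of omega ^+ p / No_of omega ^+ q)%R.
Proof.
move=> [nm [k e]]; have [nk [p [q ek]]] := powz_omega_spec k.
by exists p, q; rewrite -ek; exact: No_of_eq.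
Qed.

Lemma GG_zero_gap g t : GG 0 g -> GG 0 t -> (No_of t < No_of g)%R ->
  (No_of omega * No_of t <= No_of g)%R.
Proof.
move=> /GG_zero_value[p [q ->]] /GG_zero_value[p' [q' ->]].
have w1 : (1 < No_of omega)%R by exact: (omega_gt_nat 1).
have w0 i : (0 < No_of omega ^+ i)%R by rewrite exprn_gt0 // (lt_trans _ w1).
rewrite ltr_pdivrMr // mulrAC ltr_pdivlMr // -!exprD ltr_eXn2l // => lt'.
rewrite mulrA -exprS ler_pdivrMr // mulrAC ler_pdivlMr // -!exprD.
by apply: (ler_weXn2l (ltW w1)); rewrite addSn.
Qed.

Definition gap (n : nat) : Prop := forall g t, GG n g -> GG n t -> (No_of t < No_of g)%R ->
  dominated (No_of (log omega) * No_of t)%R (No_of g).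

Lemma GG_gt0 n m : GG n m -> (0 < No_of m)%R.
Proof.
case: n => [|n] hm.
  have [p [q ->]] := GG_zero_value hm; have w0 := omega_gt_nat 0.
  by rewrite divr_gt0 ?exprn_gt0.
have [nm [g [t [k [[[ng _] _] [[[nt _] _] e]]]]]] := hm; have [na _] := arg_spec k ng nt.
rewrite (No_of_eq nm (numeric_exp na) e); exact: exp_gt0.
Qed.

(** Normal forms over [GG n] and over the monomials above 1 may be different witnesses. Each gives a
    monomial in the class of the difference, and uniqueness of the exponent identifies the two. The
    gap above [t = 1] then makes [G] dominate [L]. *)
Lemma pure_diff n x y : gap n -> KK n x -> purely_infinite x -> KK n y -> purely_infinite y ->
  (No_of x - No_of y = 0)%R \/ exists2 G, (exists2 g, GG n g & G = No_of g) &
    [/\ (0 < G)%R, arch_equiv (No_of x - No_of y)%R G & dominated (No_of (log omega)) G].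
Proof.
move=> gp kx px ky py; case: (hahn_diff kx ky) => [->|[a [na ga ea]]]; first by left; rewrite subrr.
case: (hahn_diff px py) => [->|[b [nb /ltNoP gb eb]]]; first by left; rewrite subrr.
right; exists (No_of (omega_pow a)); first by exists (omega_pow a).
split=> //; first exact: GG_gt0 ga.
have e := omega_pow_eq na nb (arch_equiv_unique na nb ea eb).
have := gp _ _ ga (GG_one n); rewrite No_of1 mulr1; apply.
by rewrite e; apply: gb; [exact: numeric_nat|exact: numeric_omega_pow].
Qed.

Lemma arg_gap n g1 t1 k1 g2 t2 k2 : gap n ->
  KK n g1 -> purely_infinite g1 -> KK n t1 -> purely_infinite t1 ->
  KK n g2 -> purely_infinite g2 -> KK n t2 -> purely_infinite t2 ->
  (No_of (arg g2 t2 k2) < No_of (arg g1 t1 k1))%R ->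
  (No_of (log omega) <= No_of (arg g1 t1 k1) - No_of (arg g2 t2 k2))%R.
Proof.
move=> gp kg1 pg1 kt1 pt1 kg2 pg2 kt2 pt2; rewrite -subr_gt0.
have [_ ->] := arg_spec k1 kg1.1 kt1.1; have [_ ->] := arg_spec k2 kg2.1 kt2.1.
have [_ [p1 [q1 ->]]] := intg_spec k1; have [_ [p2 [q2 ->]]] := intg_spec k2.
set L := No_of (log omega).
have -> : (No_of g1 + L * (No_of t1 + (p1%:R - q1%:R)) - (No_of g2 + L * (No_of t2 + (p2%:R - q2%:R))) =
  (No_of g1 - No_of g2) + L * ((No_of t1 - No_of t2) + ((p1 + q2)%:R - (q1 + p2)%:R)))%R.
  by rewrite !natrD; ring.
apply: separation; first exact: log_omega_inf.
apply: (main_part_large (M := fun G => exists2 g, GG n g & G = No_of g)).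
- exact: log_omega_inf.
- by move=> _ _ [g gg ->] [t gt ->]; exact: gp.
- exact: pure_diff.
- exact: pure_diff.
Qed.

Lemma gap_step n : gap n -> gap n.+1.
Proof.
move=> gp g t [ng [g1 [t1 [k1 [[kg1 pg1] [[kt1 pt1] e1]]]]]] [nt [g2 [t2 [k2 [[kg2 pg2] [[kt2 pt2] e2]]]]]].
have [n1 _] := arg_spec k1 kg1.1 kt1.1; have [n2 _] := arg_spec k2 kg2.1 kt2.1.
rewrite (No_of_eq ng (numeric_exp n1) e1) (No_of_eq nt (numeric_exp n2) e2) -!/(arg _ _ _) exp_lt // => lt'.
have := arg_gap gp kg1 pg1 kt1 pt1 kg2 pg2 kt2 pt2 lt'.
have := exp_ge_trunc 2 n2 n1 lt'; have := exp_gt0 n2; have linf := log_omega_inf.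
move: (No_of (exp (arg g2 t2 k2))) (No_of (exp (arg g1 t1 k1))) (No_of (log omega)) linf (_ - _)%R => T G L linf d T0 h hL k.
have L0 : (0 < L)%R by exact: (linf 0).
apply: lt_trans h; rewrite mulrA mulrC ltr_pM2l //.
apply: lt_le_trans (etr_le 2 (ltW L0) hL).
rewrite !etrS etr0 expr1 !factS fact0 /= divr1.
(* [L > 2 k] gives [L ^ 2 / 2 > k L]. *)
have := linf (k * 2)%N; rewrite natrM; nra.
Qed.

Lemma gapP n : gap n.
Proof.
elim: n => [|n]; last exact: gap_step.
move=> g t hg ht lt' k; apply: lt_le_trans (GG_zero_gap hg ht lt').
by rewrite mulrA ltr_pM2r ?(GG_gt0 ht) //; exact: log_omega_dom.
Qed.

Lemma GG_ge_omega n m : GG n m -> (1 < No_of m)%R -> (No_of omega <= No_of m)%R.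
Proof.
case: n => [|n] hm h; first by have := GG_zero_gap hm (GG_one 0) h; rewrite No_of1 mulr1.
move: hm h => [nm [g [t [k [[kg pg] [[kt pt] e]]]]]].
have [n1 _] := arg_spec k kg.1 kt.1; have nz := numeric_zero.
rewrite (No_of_eq nm (numeric_exp n1) e) -/(arg _ _ _) -exp_zero exp_lt // No_of0 => lt'.
(* The monomial 1 is presented as the exponential of [arg zero zero 0], so that [arg_gap] bounds the
   argument of [m] below by [log omega]. *)
have [_ e0] := arg_spec BinNums.Z0 nz nz; rewrite No_of0 addr0 mulr0 addr0 in e0.
have := @arg_gap n g t k zero zero BinNums.Z0 (@gapP n) kg pg kt pt (hahn_zero _) (hahn_zero _) (hahn_zero _) (hahn_zero _).
rewrite e0 subr0 => /(_ lt'); have [nl el] := log_omega_ok.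
by rewrite -exp_le // el.
Qed.

Lemma KK_omega : KK 0 omega.
Proof.
have nw := numeric_omega; have nw1 := numeric_omega_pow (numeric_nat 1); have n1 := numeric_nat 1.
have nz := numeric_zero.
split=> //; exists unit, (fun _ _ => False), (fun _ => one), (fun _ => one); split; last first.
  move=> _; split=> //; exists (BinNums.Zpos BinNums.xH); apply: eqg_trans omega_pow_one _.
  exact: eqg_sym (mulg1 _).
split; first by [].
split; first by [].
split; first by move=> [] []; right; left.
split; first by [].
split; first by [].
split.
  move=> _; split; first exact: is_real_nat.
  by move=> [h _]; case: glt01.
exists (fun _ => zero); split=> [[]|].
  by split=> //; split=> // _; apply: simplest_zero.
split; last by move/(_ tt Logic.I) => [k []].
move=> [] _ _; apply/No_ofP; [numeric|numeric|].
rewrite No_ofD; try numeric.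
by rewrite No_ofM // No_of0 No_of1 add0r mul1r; apply: No_of_eq => //; exact: eqg_sym omega_pow_one.
Qed.

Theorem mainTheorem6 :
  least (fun m => monomial m /\ KKunion m /\ infinite m) omega /\
  (forall m : game, GGunion m -> lt one m -> le omega m).
Proof.
have nw := numeric_omega; have n1 := numeric_nat 1.
have two m : GGunion m -> lt one m -> le omega m.
  move=> [n hm] h; have nm := GG_numeric hm; apply/leNoP => //; apply: GG_ge_omega hm _.
  by apply/ltNoP.
split=> //; split.
  split; first by split=> //; exists one; split=> //; exact: eqg_sym omega_pow_one.
  split; first by exists 0; exact: KK_omega.
  split=> // n; apply/ltNoP => //; [exact: numeric_nat|rewrite No_of_nat; exact: omega_gt_nat].
move=> y [[ny [b [nb eb]]] [[n hy] [_ yinf]]]; apply: two; last exact: yinf.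
have nwb := numeric_omega_pow nb.
have eY := No_of_eq ny nwb eb; have Y0 := omega_pow_gt0 nb; rewrite -eY in Y0.
(* Comparison with the empty normal form of zero finds a monomial of [GG n] in the archimedean class
   of [y]. As [y] is itself a monomial, the exponents agree and [y] belongs to [GG n]. *)
exists n; case: (hahn_diff hy (hahn_zero _)) => [h0|[a [na ga ea]]]; first by rewrite h0 ltxx in Y0.
apply: GG_eq ga => //; apply/No_ofP => //; first exact: numeric_omega_pow.
rewrite eY; apply: omega_pow_eq => //; apply: (@arch_equiv_unique b a (No_of y)) => //.
  by exists 1; rewrite mul1r gtr0_norm // mul1r eY.
by rewrite No_of0 subr0 in ea.
Qed.
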